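(* Let $V\in\mathcal C$ and let $g=2i$ with $i\ge1$, such that $\vee^gV$ is invertible. Put $r=\mathrm{rank}(V)$, $L=\vee^gV^{\vee\vee}$, $r_L=\mathrm{rank}(L)=\mathrm{rank}(\vee^gV)\in\{\pm1\}$, and $$\rho^i:=r_{L}\binom{g}{g-1}^{-1}\binom{g}{i}^{-1}\binom{r+g-1}{g-1}\binom{r+g-1}{i}\frac{g}{i}.$$ Let $\Delta^n:\mathrm{Sym}^n(\vee^iV)\to\mathrm{Sym}^{n-2}(\vee^iV)\otimes L$ $(n\ge2)$ and $\partial_1^n,\overline\partial_{i-1}^n,\partial_{i-1}^n,\overline\partial_1^n$ $(n\ge1)$ be the Laplace and Dirac operators defined in the context. (1) For every $n\ge2$, $$(\overline\partial_{i-1}^{n-1}\otimes1_L)\circ\partial_1^n=\Big(\tfrac{\rho^i}{2}\cdot1_{\mathrm{Sym}^{n-2}(\vee^iV)}\otimes\tau_{L,V}\Big)\circ(\Delta^n\otimes1_V)$$ as morphisms $\mathrm{Sym}^n(\vee^iV)\otimes V\to\mathrm{Sym}^{n-2}(\vee^iV)\otimes V\otimes L$. (2) If $r_L=1$, then for every $n\ge2$ $$\binom{r+g-1}{i}\cdot\partial_{i-1}^{n-1}\circ\overline\partial_1^n=\Big(\binom{r+g-1}{i}\tfrac{\rho^i}{2}\cdot1_{\mathrm{Sym}^{n-2}(\vee^iV)}\otimes\tau_{L,V^\vee}\Big)\circ(\Delta^n\otimes1_{V^\vee});$$ and if moreover $\binom{r+g-1}{i}\in\mathrm{End}(\mathbb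 I)$ is a non-zero divisor, this is equivalent to $$\partial_{i-1}^{n-1}\circ\overline\partial_1^n=\Big(\tfrac{\rho^i}{2}\cdot1_{\mathrm{Sym}^{n-2}(\vee^iV)}\otimes\tau_{L,V^\vee}\Big)\circ(\Delta^n\otimes1_{V^\vee}).$$ (3) Suppose that $L\simeq\mathbb L^{\otimes2}$ for some invertible object $\mathbb L$, that $\mathrm{rank}(\vee^iV)>0$, and that $V$ has symmetric rank $g$. Then there are morphisms $$s_\Delta^{n-2}:\mathrm{Sym}^{n-2}(\vee^iV)\otimes L\to\mathrm{Sym}^n(\vee^iV)\ (n\ge2),$$ $$s_{\overline\partial_{i-1}}^{n-1}:\mathrm{Sym}^{n-1}(\vee^iV)\otimes V\to\mathrm{Sym}^n(\vee^iV)\otimes\vee^{i-1}V^\vee\ (n\ge1),$$ $$s_{\partial_{i-1}}^{n-1}:\mathrm{Sym}^{n-1}(\vee^iV)\otimes V^\vee\otimes L\to\mathrm{Sym}^n(\vee^iV)\otimes\vee^{i-1}V\ (n\ge1)$$ such that $\Delta^n\circ s_\Delta^{n-2}=1$, $\overline\partial_{i-1}^n\circ s_{\overline\partial_{i-1}}^{n-1}=1$ and $\partial_{i-1}^n\circ s_{\partial_{i-1}}^{n-1}=1$. In particular the kernels $\ker(\Delta^n)\subset\mathrm{Sym}^n(\vee^iV)$, $\ker(\overline\partial_{i-1}^n)\subset\mathrm{Sym}^n(\vee^iV)\otimes\vee^{i-1}V^\vee$ and $\ker(\partial_{i-1}^n)\subset\mathrm{Sym}^n(\vee^iV)\otimes\vee^{i-1}V$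 exist in $\mathcal C$.
   Context: **Category.** $\mathcal C$ is a $\mathbb Q$-linear, rigid, pseudo-abelian (idempotents split) symmetric monoidal category with unit $\mathbb I$, symmetry $\tau_{X,Y}:X\otimes Y\to Y\otimes X$, internal homs $\hom(X,Y)$, duals $X^\vee$, evaluations $ev_X:X^\vee\otimes X\to\mathbb I$, and reflexivity isomorphisms $\kappa_X:X\to X^{\vee\vee}$; associativity constraints are suppressed. $\mathrm{rank}(X)\in\mathrm{End}(\mathbb I)$ is the trace of $1_X$; an invertible object has rank $\pm1$ here. For $T\in\mathrm{End}(\mathbb I)$, $\binom Tk=\frac1{k!}T(T-1)\cdots(T-k+1)$, $\binom T0=1$. **Powers.** $S_n$ acts on $\otimes^nX$. The idempotent $e^n_{X,s}=\frac1{n!}\sum_\sigma\sigma$ has image $\vee^nX$ (the symmetric power), with canonical monomorphism $i^n_{X,s}$ and epimorphism $p^n_{X,s}$, $i^n_{X,s}p^n_{X,s}=e^n_{X,s}$, $p^n_{X,s}i^n_{X,s}=1$. One writes $\mathrm{Sym}^n(M)=\vee^nM$ when $M$ is itself a symmetric power of $V$. **Operators attached to pairings.** For $\psi:X\otimes Y\to Z$ and $n\ge1$, $$\partial^n_{\psi,s}:\vee^nX\otimes Y\xrightarrow{i^n_{X,s}\otimes1}\otimes^nX\otimes Y\xrightarrow{1_{\otimes^{n-1}X}\otimes\psi}\otimes^{n-1}X\otimes Z\xrightarrow{p^{n-1}_{X,s}\otimes1}\vee^{n-1}X\otimes Z.$$ For $\psi:X\otimes X\to Z$ and $n\ge2$,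 $$\Delta^n_{\psi,s}:\vee^nX\xrightarrow{i^n_{X,s}}\otimes^nX\xrightarrow{1_{\otimes^{n-2}X}\otimes\psi}\otimes^{n-2}X\otimes Z\xrightarrow{p^{n-2}_{X,s}\otimes1}\vee^{n-2}X\otimes Z.$$ **Poincaré morphisms.** Put $A_k=\vee^kV$. $A_k^\vee$ is identified with $\vee^k(V^\vee)$ (written $\vee^kV^\vee$) through the restriction of the evaluation $\otimes^kV^\vee\otimes\otimes^kV\to\mathbb I$ pairing the $j$-th factor with the $j$-th factor; similarly for $V^{\vee\vee}$. Let $\varphi_{j,k}=p^{j+k}_{V,s}\circ(i^j_{V,s}\otimes i^k_{V,s}):A_j\otimes A_k\to A_{j+k}$ be the multiplication and $f_{j,k}:A_j\to\hom(A_k,A_{j+k})$ its adjoint. For $0\le j\le g$, $$D^{j,g}:A_j\xrightarrow{f_{j,g-j}}\hom(A_{g-j},A_g)\xrightarrow{d}\hom(A_g^\vee,A_{g-j}^\vee)\xrightarrow{\alpha^{-1}}A_{g-j}^\vee\otimes A_g^{\vee\vee},$$ with $d$ the internal duality (transpose) and $\alpha:Y\otimes X^\vee\to\hom(X,Y)$ canonical. Applying this to $V^\vee$ and composing with inverse reflexivities gives $D_{j,g}:A_j^\vee\to A_{g-j}\otimes A_g^\vee$. With $L=\vee^gV^{\vee\vee}$ and $L^{-1}=\vee^gV^\vee$, $ev^\tau:L^{-1}\otimes L\to\mathbb I$ is the evaluation composed with the symmetry. $\varphi^{13}_{j,k}:\vee^jV^\vee\otimes L\otimes\vee^kV^\vee\to\vee^{j+k}V^\vee\otimes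 L$ swaps the last two factors and then multiplies the first two. **Pairings** ($g=2i$): - $\psi_{i,1}:\vee^iV\otimes V\xrightarrow{\varphi_{i,1}}\vee^{i+1}V\xrightarrow{D^{i+1,g}}\vee^{i-1}V^\vee\otimes L$; - $\overline\psi_{i,i-1}:\vee^iV\otimes\vee^{i-1}V^\vee\xrightarrow{D^{i,g}\otimes1}\vee^iV^\vee\otimes L\otimes\vee^{i-1}V^\vee\xrightarrow{\varphi^{13}_{i,i-1}}\vee^{g-1}V^\vee\otimes L\xrightarrow{D_{g-1,g}\otimes1}V\otimes L^{-1}\otimes L\xrightarrow{1\otimes ev^\tau}V$; - $\psi_{i,i-1}:\vee^iV\otimes\vee^{i-1}V\xrightarrow{\varphi_{i,i-1}}\vee^{g-1}V\xrightarrow{D^{g-1,g}}V^\vee\otimes L$; - $\overline\psi_{i,1}:\vee^iV\otimes V^\vee\xrightarrow{D^{i,g}\otimes1}\vee^iV^\vee\otimes L\otimes V^\vee\xrightarrow{\varphi^{13}_{i,1}}\vee^{i+1}V^\vee\otimes L\xrightarrow{D_{i+1,g}\otimes1}\vee^{i-1}V\otimes L^{-1}\otimes L\xrightarrow{1\otimes ev^\tau}\vee^{i-1}V$. **Laplace and Dirac operators:** $\Delta^n=\Delta^n_{\kappa_{\vee^gV}\circ\varphi_{i,i},s}$, $\partial_1^n=\partial^n_{\psi_{i,1},s}$, $\overline\partial_{i-1}^n=\partial^n_{\overline\psi_{i,i-1},s}$, $\partial_{i-1}^n=\partial^n_{\psi_{i,i-1},s}$, $\overline\partial_1^n=\partial^n_{\overline\psi_{i,1},s}$,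 all with $X=\vee^iV$. **Terminology.** $V$ has *symmetric rank* $g\in\mathbb N_{\ge1}$ if $\vee^gV$ is invertible and $\binom{r+g-1}{g-j}$ and $\binom{r+g-1}{j}$ are invertible in $\mathrm{End}(\mathbb I)$ for all $0\le j\le g$. For $s\in\mathrm{End}(\mathbb I)$, $s>0$ means there is an ordered field $(K,\ge)$ with $s\in K\subset\mathrm{End}(\mathbb I)$ and $s>0$ in $K$. *)

(* Defs.v *)
From HB Require Import structures.
From mathcomp Require Import all_boot all_order all_fingroup all_algebra.
From mathcomp Require Import boolp classical_sets.

Set Implicit Arguments.
Unset Strict Implicit.
Unset Printing Implicit Defensive.

Import GRing.Theory Num.Theory.
Local Open Scope ring_scope.

Declare Scope cat_scope.
Delimit Scope cat_scope with cat.
Local Open Scope cat_scope.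

Reserved Notation "g ∘ f" (at level 50, left associativity).
Reserved Notation "X ⊗ Y" (at level 40, left associativity).
Reserved Notation "f ⊠ g" (at level 40, left associativity).

(* Q-linear closed symmetric monoidal categories, with explicit associativity
   and unit constraints and internal homs ihom X Y representing
   T |-> Mor (T ⊗ X) Y. *)
Record closedSymMonCat : Type := ClosedSymMonCat {
  Ob :> Type;
  Mor : Ob -> Ob -> lmodType rat;
  idm : forall X, Mor X X;
  compm : forall X Y Z, Mor Y Z -> Mor X Y -> Mor X Z;
  compA : forall X Y Z T (h : Mor Z T) (g : Mor Y Z) (f : Mor X Y),
    compm h (compm g f) = compm (compm h g) f;
  comp1m : forall X Y (f : Mor X Y), compm (idm Y) f = f;
  compm1 : forall X Y (f : Mor X Y), compm f (idm X) = f;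
  comp_linearl : forall X Y Z (f : Mor X Y),
    linear (fun g : Mor Y Z => compm g f);
  comp_linearr : forall X Y Z (g : Mor Y Z),
    linear (fun f : Mor X Y => compm g f);

  tunit : Ob;
  tens : Ob -> Ob -> Ob;
  tensm : forall X X' Y Y',
    Mor X X' -> Mor Y Y' -> Mor (tens X Y) (tens X' Y');
  tensm1 : forall X Y, tensm (idm X) (idm Y) = idm (tens X Y);
  tensm_comp : forall X X' X'' Y Y' Y''
    (f' : Mor X' X'') (f : Mor X X') (g' : Mor Y' Y'') (g : Mor Y Y'),
    tensm (compm f' f) (compm g' g) = compm (tensm f' g') (tensm f g);
  tensm_linearl : forall X X' Y Y' (g : Mor Y Y'),
    linear (fun f : Mor X X' => tensm f g);
  tensm_linearr : forall X X' Y Y' (f : Mor X X'),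
    linear (fun g : Mor Y Y' => tensm f g);

  asc : forall X Y Z, Mor (tens (tens X Y) Z) (tens X (tens Y Z));
  ascV : forall X Y Z, Mor (tens X (tens Y Z)) (tens (tens X Y) Z);
  ascK : forall X Y Z, compm (ascV X Y Z) (asc X Y Z) = idm _;
  ascVK : forall X Y Z, compm (asc X Y Z) (ascV X Y Z) = idm _;
  asc_nat : forall X X' Y Y' Z Z'
    (f : Mor X X') (g : Mor Y Y') (h : Mor Z Z'),
    compm (asc X' Y' Z') (tensm (tensm f g) h) =
    compm (tensm f (tensm g h)) (asc X Y Z);

  lun : forall X, Mor (tens tunit X) X;
  lunV : forall X, Mor X (tens tunit X);
  lunK : forall X, compm (lunV X) (lun X) = idm _;
  lunVK : forall X, compm (lun X) (lunV X) = idm _;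
  lun_nat : forall X Y (f : Mor X Y),
    compm (lun Y) (tensm (idm tunit) f) = compm f (lun X);

  run : forall X, Mor (tens X tunit) X;
  runV : forall X, Mor X (tens X tunit);
  runK : forall X, compm (runV X) (run X) = idm _;
  runVK : forall X, compm (run X) (runV X) = idm _;
  run_nat : forall X Y (f : Mor X Y),
    compm (run Y) (tensm f (idm tunit)) = compm f (run X);

  pentagon : forall X Y Z T,
    compm (asc X Y (tens Z T)) (asc (tens X Y) Z T) =
    compm (tensm (idm X) (asc Y Z T))
      (compm (asc X (tens Y Z) T) (tensm (asc X Y Z) (idm T)));
  triangle : forall X Y,
    compm (tensm (idm X) (lun Y)) (asc X tunit Y) = tensm (run X) (idm Y);

  swap : forall X Y, Mor (tens X Y) (tens Y X);
  swap_nat : forall X X' Y Y' (f : Mor X X') (g : Mor Y Y'),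
    compm (swap X' Y') (tensm f g) = compm (tensm g f) (swap X Y);
  swapK : forall X Y, compm (swap Y X) (swap X Y) = idm (tens X Y);
  hexagon : forall X Y Z,
    compm (asc Y Z X) (compm (swap X (tens Y Z)) (asc X Y Z)) =
    compm (tensm (idm Y) (swap X Z))
      (compm (asc Y X Z) (tensm (swap X Y) (idm Z)));

  ihom : Ob -> Ob -> Ob;
  evh : forall X Y, Mor (tens (ihom X Y) X) Y;
  curry : forall T X Y, Mor (tens T X) Y -> Mor T (ihom X Y);
  curryK : forall T X Y (f : Mor (tens T X) Y),
    compm (evh X Y) (tensm (curry f) (idm X)) = f;
  uncurryK : forall T X Y (f : Mor T (ihom X Y)),
    curry (compm (evh X Y) (tensm f (idm X))) = f
}.

Arguments idm {_} _.
Arguments compm {_ _ _ _} _ _.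
Arguments tunit {_}.
Arguments tens {_} _ _.
Arguments tensm {_ _ _ _ _} _ _.
Arguments asc {_} _ _ _.
Arguments ascV {_} _ _ _.
Arguments lun {_} _.
Arguments lunV {_} _.
Arguments run {_} _.
Arguments runV {_} _.
Arguments swap {_} _ _.
Arguments ihom {_} _ _.
Arguments evh {_} _ _.
Arguments curry {_ _ _ _} _.

Notation "g ∘ f" := (compm g f) : cat_scope.
Notation "X ⊗ Y" := (tens X Y) : cat_scope.
Notation "f ⊠ g" := (tensm f g) : cat_scope.

Section ClosedSymMonCat.
Context {C : closedSymMonCat}.
Implicit Types X Y Z T : C.

Definition is_iso X Y (f : Mor X Y) : Prop :=
  exists g : Mor Y X, g ∘ f = idm X /\ f ∘ g = idm Y.

(* the inverse of f if f is an isomorphism, 0 otherwise *)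
Definition invm X Y (f : Mor X Y) : Mor Y X :=
  xget 0 [set g : Mor Y X | g ∘ f = idm X /\ f ∘ g = idm Y]%classic.

Definition isomorphic X Y : Prop := exists f : Mor X Y, is_iso f.

Definition invertible X : Prop := exists Y : C, isomorphic (X ⊗ Y) tunit.

Definition has_kernel X Y (f : Mor X Y) : Prop :=
  exists (K : C) (k : Mor K X), f ∘ k = 0 /\
    forall T (h : Mor T X), f ∘ h = 0 -> exists! u : Mor T K, k ∘ u = h.

Definition interchange X Y Z T : Mor ((X ⊗ Y) ⊗ (Z ⊗ T)) ((X ⊗ Z) ⊗ (Y ⊗ T)) :=
  ascV X Z (Y ⊗ T)
  ∘ (idm X ⊠ (asc Z Y T ∘ (swap Y Z ⊠ idm T) ∘ ascV Y Z T))
  ∘ asc X Y (Z ⊗ T).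

Definition swap_last X Y Z : Mor ((X ⊗ Y) ⊗ Z) ((X ⊗ Z) ⊗ Y) :=
  ascV X Z Y ∘ (idm X ⊠ swap Y Z) ∘ asc X Y Z.

Definition dual X : C := ihom X tunit.
Definition ev X : Mor (dual X ⊗ X) tunit := evh X tunit.

Definition dualm X Y (f : Mor X Y) : Mor (dual Y) (dual X) :=
  curry (ev Y ∘ (idm (dual Y) ⊠ f)).

Definition kappa X : Mor X (dual (dual X)) :=
  curry (ev X ∘ swap X (dual X)).

(* α : Y ⊗ X^∨ -> hom(X, Y) *)
Definition alpha X Y : Mor (Y ⊗ dual X) (ihom X Y) :=
  curry (run Y ∘ (idm Y ⊠ ev X) ∘ asc Y (dual X) X).

(* d : hom(X, Y) -> hom(Y^∨, X^∨) *)
Definition transp X Y : Mor (ihom X Y) (ihom (dual Y) (dual X)) :=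
  curry (curry (ev Y ∘ (idm (dual Y) ⊠ evh X Y)
                ∘ asc (dual Y) (ihom X Y) X
                ∘ (swap (ihom X Y) (dual Y) ⊠ idm X))).

Definition tr X (u : Mor X X) : Mor (@tunit C) tunit :=
  ev X ∘ swap X (dual X) ∘ invm (alpha X X) ∘ curry (u ∘ lun X).

End ClosedSymMonCat.

(* Rigidity is invertibility of the canonical maps Y ⊗ X^∨ -> hom(X, Y) and
   X -> X^∨∨.  A splitting (im, imi, imp) of the idempotents is chosen; it is
   a total function of the endomorphism e, constrained only when e is
   idempotent. *)
Record rigidCat : Type := RigidCat {
  base :> closedSymMonCat;
  alpha_iso : forall X Y : base, is_iso (alpha X Y);
  kappa_iso : forall X : base, is_iso (kappa X);
  im : forall X : base, Mor X X -> base;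
  imi : forall (X : base) (e : Mor X X), Mor (im e) X;
  imp : forall (X : base) (e : Mor X X), Mor X (im e);
  im_split : forall (X : base) (e : Mor X X), e ∘ e = e ->
    imi e ∘ imp e = e /\ imp e ∘ imi e = idm (im e)
}.

Definition Endo (C : closedSymMonCat) (X : C) : Type := Mor X X.

Section EndRing.
Context {C : closedSymMonCat} (X : C).

HB.instance Definition _ := GRing.Lmodule.on (Endo X).

Let mulE (f g : Endo X) : Endo X := compm f g.

Fact Endo_mulDl : left_distributive mulE +%R.
Proof. by move=> f g h; rewrite /mulE -[f]scale1r comp_linearl !scale1r. Qed.

Fact Endo_mulDr : right_distributive mulE +%R.
Proof. by move=> f g h; rewrite /mulE -[g]scale1r comp_linearr !scale1r. Qed.

HB.instance Definition _ := GRing.Zmodule_isPzRing.Build (Endo X)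
  (@compA C X X X X) (@comp1m C X X) (@compm1 C X X) Endo_mulDl Endo_mulDr.

End EndRing.

Section Scalars.
Context {C : closedSymMonCat}.

Definition rank (X : C) : Endo (@tunit C) := tr (idm X).

(* the action of End(I) on morphisms *)
Definition escale (X Y : C) (s : Endo (@tunit C)) (f : Mor X Y) : Mor X Y :=
  lun Y ∘ (s ⊠ f) ∘ lunV X.

Definition ebinom (T : Endo (@tunit C)) (k : nat) : Endo (@tunit C) :=
  (k`!%:R^-1 : rat) *: \prod_(j < k) (T - (j : nat)%:R).

(* the ordered field K is embedded in End(I) by f *)
Definition epositive (s : Endo (@tunit C)) : Prop :=
  exists (K : realFieldType) (f : {rmorphism K -> Endo (@tunit C)}) (x : K),
    [/\ injective f, f x = s & 0 < x].

End Scalars.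

Section Powers.
Context {C : rigidCat}.
Implicit Types (X Y Z V : C) (n j k g : nat).

Fixpoint tpow X n : C := if n is m.+1 then tpow X m ⊗ X else tunit.

Fixpoint tpowm X Y (f : Mor X Y) n : Mor (tpow X n) (tpow Y n) :=
  if n is m.+1 then tpowm f m ⊠ f else idm tunit.

(* moves the last of the m.+1 factors to position k <= m *)
Fixpoint cyc X m k : Mor (tpow X m.+1) (tpow X m.+1) :=
  if m is m'.+1 then
    if (k <= m')%N then
      (cyc X m' k ⊠ idm X) ∘ swap_last (tpow X m') X X
    else idm _
  else idm _.

(* the t such that s = lift_perm ord_max (s ord_max) t *)
Definition perm_rest n (s : 'S_n.+1) : 'S_n :=
  odflt 1%g [pick t : 'S_n | lift_perm ord_max (s ord_max) t == s].

Lemma perm_restK n (s : 'S_n.+1) :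
  lift_perm ord_max (s ord_max) (perm_rest s) = s.
Proof.
rewrite /perm_rest; case: pickP => [t /eqP //|no_t].
have s_lift (k : 'I_n) : {k' : 'I_n | s (lift ord_max k) = lift (s ord_max) k'}.
  case: (unliftP (s ord_max) (s (lift ord_max k))) => [k' ->|/perm_inj eq_k].
    by exists k'.
  by have := neq_lift ord_max k; rewrite eq_k eqxx.
have t_inj : injective (fun k : 'I_n => sval (s_lift k)).
  move=> k l; case: (s_lift k) (s_lift l) => [k' Ek] [l' El] /= Ekl.
  by apply: (@lift_inj _ ord_max); apply: (@perm_inj _ s); rewrite Ek El Ekl.
case/eqP: (no_t (perm t_inj)); apply/permP=> k.
case: (unliftP ord_max k) => [k' ->|->]; last by rewrite lift_perm_id.
by rewrite lift_perm_lift permE; case: (s_lift k').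
Qed.

(* The place permutation carrying the factor in position k to position s k. *)
Fixpoint perm_act X n : 'S_n -> Mor (tpow X n) (tpow X n) :=
  if n is m.+1 then
    fun s : 'S_m.+1 =>
      cyc X m (s ord_max) ∘ (perm_act X (perm_rest s) ⊠ idm X)
  else fun=> idm tunit.

Definition symmetrizer X n : Mor (tpow X n) (tpow X n) :=
  (n`!%:R^-1 : rat) *: \sum_(s : 'S_n) perm_act X s.

Definition SymPow n X : C := im (symmetrizer X n).
Definition symi n X : Mor (SymPow n X) (tpow X n) := imi (symmetrizer X n).
Definition symp n X : Mor (tpow X n) (SymPow n X) := imp (symmetrizer X n).

Definition Symm n X Y (f : Mor X Y) : Mor (SymPow n X) (SymPow n Y) :=
  symp n Y ∘ tpowm f n ∘ symi n X.

Definition of_Sym1 X : Mor (SymPow 1 X) X := lun X ∘ symi 1 X.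
Definition to_Sym1 X : Mor X (SymPow 1 X) := symp 1 X ∘ lunV X.

(* diracop psi n is ∂^{n+1}_{ψ,s} and laplaceop psi n is Δ^{n+2}_{ψ,s}. *)
Definition diracop X Y Z (psi : Mor (X ⊗ Y) Z) n :
    Mor (SymPow n.+1 X ⊗ Y) (SymPow n X ⊗ Z) :=
  (symp n X ⊠ idm Z) ∘ (idm (tpow X n) ⊠ psi) ∘ asc (tpow X n) X Y
  ∘ (symi n.+1 X ⊠ idm Y).

Definition laplaceop X Z (psi : Mor (X ⊗ X) Z) n :
    Mor (SymPow n.+2 X) (SymPow n X ⊗ Z) :=
  (symp n X ⊠ idm Z) ∘ (idm (tpow X n) ⊠ psi) ∘ asc (tpow X n) X X
  ∘ symi n.+2 X.

Fixpoint tcat X j k : Mor (tpow X j ⊗ tpow X k) (tpow X (k + j)) :=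
  match k return Mor (tpow X j ⊗ tpow X k) (tpow X (k + j)) with
  | 0 => run (tpow X j)
  | k'.+1 => (tcat X j k' ⊠ idm X) ∘ ascV (tpow X j) (tpow X k') X
  end.

(* the identity when m = n, and 0 (never used) when m <> n *)
Definition tcast X m n : Mor (tpow X m) (tpow X n) :=
  if m =P n is ReflectT e then
    ecast l (Mor (tpow X m) (tpow X l)) e (idm (tpow X m))
  else 0.

(* φ_{j,k}, for n = j + k *)
Definition mulS X j k n : Mor (SymPow j X ⊗ SymPow k X) (SymPow n X) :=
  symp n X ∘ tcast X (k + j) n ∘ tcat X j k ∘ (symi j X ⊠ symi k X).

Fixpoint tpair V k : Mor (tpow (dual V) k ⊗ tpow V k) tunit :=
  if k is k'.+1 then
    lun tunit ∘ (tpair V k' ⊠ ev V)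
    ∘ interchange (tpow (dual V) k') (dual V) (tpow V k') V
  else lun tunit.

Definition evS V k : Mor (SymPow k (dual V) ⊗ SymPow k V) tunit :=
  tpair V k ∘ (symi k (dual V) ⊠ symi k V).

(* The identification ∨^k V^∨ = (∨^k V)^∨ and, iterating it,
   (∨^k V)^∨∨ = ∨^k V^∨∨. *)
Definition thetaS V k : Mor (SymPow k (dual V)) (dual (SymPow k V)) := curry (evS V k).

Definition bidualS V k :
    Mor (dual (dual (SymPow k V))) (SymPow k (dual (dual V))) :=
  invm (thetaS (dual V) k) ∘ dualm (thetaS V k).

(* D^{j,g}, for k = g - j *)
Definition Dup V j k g :
    Mor (SymPow j V) (SymPow k (dual V) ⊗ SymPow g (dual (dual V))) :=
  (invm (thetaS V k) ⊠ bidualS V g)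
  ∘ invm (alpha (dual (SymPow g V)) (dual (SymPow k V)))
  ∘ transp (SymPow k V) (SymPow g V)
  ∘ curry (mulS V j k g).

(* D_{j,g}, for k = g - j *)
Definition Ddown V j k g :
    Mor (SymPow j (dual V)) (SymPow k V ⊗ SymPow g (dual V)) :=
  (Symm k (invm (kappa V)) ⊠ Symm g (invm (kappa (dual V))))
  ∘ Dup (dual V) j k g.

Definition evtau V g : Mor (SymPow g (dual V) ⊗ SymPow g (dual (dual V))) tunit :=
  evS (dual V) g ∘ swap (SymPow g (dual V)) (SymPow g (dual (dual V))).

(* φ^{13}_{j,k}, for n = j + k *)
Definition mulS13 V j k n (L : C) :
    Mor ((SymPow j (dual V) ⊗ L) ⊗ SymPow k (dual V)) (SymPow n (dual V) ⊗ L) :=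
  (mulS (dual V) j k n ⊠ idm L)
  ∘ swap_last (SymPow j (dual V)) L (SymPow k (dual V)).

(* The common part of the two pairings defined through D^{i,g}:
   ∨^i V ⊗ ∨^j V^∨ -> ∨^k V, for k = i - j and g = 2i. *)
Definition pairing_bar V i j k g :
    Mor (SymPow i V ⊗ SymPow j (dual V)) (SymPow k V) :=
  let L := SymPow g (dual (dual V)) in
  run (SymPow k V) ∘ (idm (SymPow k V) ⊠ evtau V g)
  ∘ asc (SymPow k V) (SymPow g (dual V)) L
  ∘ (Ddown V (i + j) k g ⊠ idm L)
  ∘ mulS13 V i j (i + j) L
  ∘ (Dup V i i g ⊠ idm (SymPow j (dual V))).

End Powers.

Section Operators.
Context {C : rigidCat} (V : C) (i : nat).

Local Notation g := (2 * i)%N.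
Local Notation A := (SymPow i V).

Definition Lobj : C := SymPow g (dual (dual V)).

Definition psi_1 : Mor (A ⊗ V) (SymPow i.-1 (dual V) ⊗ Lobj) :=
  Dup V i.+1 i.-1 g ∘ mulS V i 1 i.+1 ∘ (idm A ⊠ to_Sym1 V).

Definition psibar_im1 : Mor (A ⊗ SymPow i.-1 (dual V)) V :=
  of_Sym1 V ∘ pairing_bar V i i.-1 1 g.

Definition psi_im1 : Mor (A ⊗ SymPow i.-1 V) (dual V ⊗ Lobj) :=
  (of_Sym1 (dual V) ⊠ idm Lobj) ∘ Dup V g.-1 1 g ∘ mulS V i i.-1 g.-1.

Definition psibar_1 : Mor (A ⊗ dual V) (SymPow i.-1 V) :=
  pairing_bar V i 1 i.-1 g ∘ (idm A ⊠ to_Sym1 (dual V)).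

(* Laplace V i n is Δ^{n+2}; Dirac1 V i n is ∂_1^{n+1}, and so on. *)
Definition Laplace (n : nat) : Mor (SymPow n.+2 A) (SymPow n A ⊗ Lobj) :=
  laplaceop (bidualS V g ∘ kappa (SymPow g V) ∘ mulS V i i g) n.

Definition Dirac1 (n : nat) :
    Mor (SymPow n.+1 A ⊗ V) (SymPow n A ⊗ (SymPow i.-1 (dual V) ⊗ Lobj)) :=
  diracop psi_1 n.

Definition Diracbar_im1 (n : nat) :
    Mor (SymPow n.+1 A ⊗ SymPow i.-1 (dual V)) (SymPow n A ⊗ V) :=
  diracop psibar_im1 n.

Definition Dirac_im1 (n : nat) :
    Mor (SymPow n.+1 A ⊗ SymPow i.-1 V) (SymPow n A ⊗ (dual V ⊗ Lobj)) :=
  diracop psi_im1 n.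

Definition Diracbar_1 (n : nat) :
    Mor (SymPow n.+1 A ⊗ dual V) (SymPow n A ⊗ SymPow i.-1 V) :=
  diracop psibar_1 n.

Definition rho : Endo (@tunit C) :=
  (('C(g, g.-1)%:R^-1 * 'C(g, i)%:R^-1 * (g%:R / i%:R) : rat) *:
   (rank Lobj * ebinom (rank V + g%:R - 1) g.-1
              * ebinom (rank V + g%:R - 1) i)).

End Operators.

Definition symmetric_rank (C : rigidCat) (V : C) (g : nat) : Prop :=
  [/\ (1 <= g)%N,
      invertible (SymPow g V) &
      forall j, (j <= g)%N ->
        is_iso (ebinom (rank V + g%:R - 1) (g - j)) /\
        is_iso (ebinom (rank V + g%:R - 1) j)].

(* Main.v *)
(** Multiplication and normalised comultiplication make the symmetric powers of
    an object a Fock space: they satisfy the canonical commutation relations, and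
    the comultiplication is a derivation up to normalisation.  Write A_k and B_k
    for the symmetric powers of V and of its dual.  Summing over dual bases of
    A_k, the pairing of θ b^* with x b is a binomial multiple of the pairing of θ
    with x.  As D^{j,g} sends x to the sum of b^* ⊗ x b, the pairings ψ-bar are
    multiples of contractions, and both composites of Dirac operators can be
    written with products and contractions only.

    Since A_g is invertible, an endomorphism of X ⊗ A_g is u ⊗ 1 with u given by
    a partial trace; hence w' v ⊗ w'' is a scalar multiple of w ⊗ v, for w in A_g
    with comultiplication w' ⊗ w''.  Symmetrising over the two factors of A_i
    split off from Sym^n(A_i) brings in the Leibniz rule for the product of these
    factors, which gives (1) and (2); the symmetrisation is the source of the 1/2.

    For (3), let q : A_g -> A_i ⊗ A_i be dual to the multiplication and let Δ^*_n
    be the operator multiplying by q.  The commutation relations give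
      (n+2)(n+1) Δ_n Δ^*_n = c (2 rank(A_i) + 4n) + n(n-1) Δ^*_{n-2} Δ_{n-2}
    with c invertible.  As t + ab is invertible if and only if t + ba is, Δ_n Δ^*_n
    is invertible by induction on n, because the scalars that occur are positive
    in an ordered field.  The sections of the Dirac operators then come from (1)
    and (2), after cancelling the invertible object L. *)

(* Objects have no elements, so the computations are string diagrams, and bracketing is the
   obstacle. A morphism between tensor products is replaced by its action on right-nested words with
   an arbitrary tail, where associators and unitors become identities. Identities on symmetric
   powers are tested after the split epimorphisms A_k ⊗ V -> A_{k+1}, which turns them into
   inductions resting on one commutation relation.

   The constant ρ^i has three sources: g/i comes from the Leibniz rule, the binomial in i from
   summing over dual bases in ψ-bar, and the binomial in g-1 together with r_L from a trace over the
   invertible A_g, whose rank is its own inverse.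

   In (3) the commutation relation first yields Δ^* Δ with two copies of A_g exchanged. This
   exchange is trivial: the multiplication A_i ⊗ A_i -> A_g absorbs it and is a split epimorphism
   once c and rank(A_i) are units. The induction proves that s + Δ_n Δ^*_n, rescaled, is invertible
   for all s >= 0, since each step adds a positive scalar to s. *)
From mathcomp Require Import all_boot all_order all_fingroup all_algebra.
From mathcomp Require Import boolp classical_sets.
Require Import Defs.

Set Implicit Arguments.
Unset Strict Implicit.
Unset Printing Implicit Defensive.

Import Order.TTheory GRing.Theory Num.Theory.
Local Open Scope ring_scope.
Local Open Scope cat_scope.

Notation "X ◁ f" := (tensm (idm X) f) (at level 36, right associativity) : cat_scope.

(** * Coherence *)

Section Basic.
Context {C : closedSymMonCat}.
Implicit Types X Y Z T W : C.

Lemma compDl X Y Z (g h : Mor Y Z) (f : Mor X Y) : (g + h) ∘ f = (g ∘ f) + (h ∘ f).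
Proof. by rewrite -[g]scale1r comp_linearl !scale1r. Qed.
Lemma compDr X Y Z (g : Mor Y Z) (f h : Mor X Y) : g ∘ (f + h) = (g ∘ f) + (g ∘ h).
Proof. by rewrite -[f]scale1r comp_linearr !scale1r. Qed.
Lemma comp0l X Y Z (f : Mor X Y) : (0 : Mor Y Z) ∘ f = 0.
Proof. by apply: (@addrI _ (0 ∘ f)); rewrite -compDl !addr0. Qed.
Lemma comp0r X Y Z (f : Mor Y Z) : f ∘ (0 : Mor X Y) = 0.
Proof. by apply: (@addrI _ (f ∘ 0)); rewrite -compDr !addr0. Qed.
Lemma compZl X Y Z (a : rat) (g : Mor Y Z) (f : Mor X Y) : (a *: g) ∘ f = a *: (g ∘ f).
Proof. by rewrite -[_ *: g]addr0 comp_linearl comp0l addr0. Qed.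
Lemma compZr X Y Z (a : rat) (g : Mor Y Z) (f : Mor X Y) : g ∘ (a *: f) = a *: (g ∘ f).
Proof. by rewrite -[_ *: f]addr0 comp_linearr comp0r addr0. Qed.
Lemma compNl X Y Z (g : Mor Y Z) (f : Mor X Y) : (- g) ∘ f = - (g ∘ f).
Proof. by rewrite -scaleN1r compZl scaleN1r. Qed.
Lemma compNr X Y Z (g : Mor Y Z) (f : Mor X Y) : g ∘ (- f) = - (g ∘ f).
Proof. by rewrite -scaleN1r compZr scaleN1r. Qed.
Lemma comp_suml X Y Z I (r : seq I) (P : pred I) (F : I -> Mor Y Z) (f : Mor X Y) :
  (\sum_(i <- r | P i) F i) ∘ f = \sum_(i <- r | P i) (F i ∘ f).
Proof. by apply: (big_morph (fun g => g ∘ f)) => [g h|]; rewrite ?compDl ?comp0l. Qed.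
Lemma comp_sumr X Y Z I (r : seq I) (P : pred I) (F : I -> Mor X Y) (f : Mor Y Z) :
  f ∘ (\sum_(i <- r | P i) F i) = \sum_(i <- r | P i) (f ∘ F i).
Proof. by apply: (big_morph (fun g => f ∘ g)) => [g h|]; rewrite ?compDr ?comp0r. Qed.

Lemma tensDl X X' Y Y' (f g : Mor X X') (h : Mor Y Y') : (f + g) ⊠ h = f ⊠ h + g ⊠ h.
Proof. by rewrite -[f]scale1r tensm_linearl !scale1r. Qed.
Lemma tensDr X X' Y Y' (f : Mor X X') (g h : Mor Y Y') : f ⊠ (g + h) = f ⊠ g + f ⊠ h.
Proof. by rewrite -[g]scale1r tensm_linearr !scale1r. Qed.
Lemma tens0l X X' Y Y' (h : Mor Y Y') : (0 : Mor X X') ⊠ h = 0.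
Proof. by apply: (@addrI _ (0 ⊠ h)); rewrite -tensDl !addr0. Qed.
Lemma tens0r X X' Y Y' (h : Mor Y Y') : h ⊠ (0 : Mor X X') = 0.
Proof. by apply: (@addrI _ (h ⊠ 0)); rewrite -tensDr !addr0. Qed.
Lemma tensZl X X' Y Y' (a : rat) (f : Mor X X') (h : Mor Y Y') : (a *: f) ⊠ h = a *: (f ⊠ h).
Proof. by rewrite -[_ *: f]addr0 tensm_linearl tens0l addr0. Qed.
Lemma tensZr X X' Y Y' (a : rat) (f : Mor X X') (h : Mor Y Y') : h ⊠ (a *: f) = a *: (h ⊠ f).
Proof. by rewrite -[_ *: f]addr0 tensm_linearr tens0r addr0. Qed.
Lemma tens_suml X X' Y Y' I (r : seq I) (P : pred I) (F : I -> Mor X X') (f : Mor Y Y') :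
  (\sum_(i <- r | P i) F i) ⊠ f = \sum_(i <- r | P i) (F i ⊠ f).
Proof. by apply: (big_morph (fun g => g ⊠ f)) => [g h|]; rewrite ?tensDl ?tens0l. Qed.

Lemma lcomp X Y Y' Y'' (g : Mor Y' Y'') (f : Mor Y Y') : X ◁ (g ∘ f) = (X ◁ g) ∘ (X ◁ f).
Proof. by rewrite -tensm_comp comp1m. Qed.
Lemma rcomp X Y Y' Y'' (g : Mor Y' Y'') (f : Mor Y Y') :
  (g ∘ f) ⊠ idm X = (g ⊠ idm X) ∘ (f ⊠ idm X).
Proof. by rewrite -tensm_comp comp1m. Qed.
Lemma tensE X X' Y Y' (f : Mor X X') (g : Mor Y Y') : f ⊠ g = (f ⊠ idm Y') ∘ (X ◁ g).
Proof. by rewrite -tensm_comp compm1 comp1m. Qed.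
Lemma tensE' X X' Y Y' (f : Mor X X') (g : Mor Y Y') : f ⊠ g = (X' ◁ g) ∘ (f ⊠ idm Y).
Proof. by rewrite -tensm_comp compm1 comp1m. Qed.
Lemma tens_inter X X' Y Y' (f : Mor X X') (g : Mor Y Y') :
  (f ⊠ idm Y') ∘ (X ◁ g) = (X' ◁ g) ∘ (f ⊠ idm Y).
Proof. by rewrite -tensE -tensE'. Qed.

Lemma cancel_epi X Y Z (f : Mor X Y) (h : Mor Y X) (u v : Mor Y Z) :
  f ∘ h = idm Y -> u ∘ f = v ∘ f -> u = v.
Proof. by move=> fh uv; rewrite -[u]compm1 -[v]compm1 -fh !compA uv. Qed.
Lemma cancel_mono X Y Z (f : Mor X Y) (h : Mor Y X) (u v : Mor Z X) :
  h ∘ f = idm X -> f ∘ u = f ∘ v -> u = v.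
Proof. by move=> fh uv; rewrite -[u]comp1m -[v]comp1m -fh -!compA uv. Qed.

Lemma ltunit_inj X Y (f g : Mor X Y) : tunit ◁ f = tunit ◁ g -> f = g.
Proof. by move=> fg; apply: (cancel_epi (lunVK X)); rewrite -!lun_nat fg. Qed.
Lemma rtunit_inj X Y (f g : Mor X Y) : f ⊠ idm tunit = g ⊠ idm tunit -> f = g.
Proof. by move=> fg; apply: (cancel_epi (runVK X)); rewrite -!run_nat fg. Qed.

Lemma ascV_nat X X' Y Y' Z Z' (f : Mor X X') (g : Mor Y Y') (h : Mor Z Z') :
  ascV X' Y' Z' ∘ (f ⊠ (g ⊠ h)) = ((f ⊠ g) ⊠ h) ∘ ascV X Y Z.
Proof.
apply: (cancel_mono (ascK _ _ _)); apply: (cancel_epi (ascVK _ _ _)).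
by rewrite !compA ascVK comp1m asc_nat -compA ascK compm1.
Qed.
Lemma lunV_nat X Y (f : Mor X Y) : lunV Y ∘ f = (tunit ◁ f) ∘ lunV X.
Proof.
apply: (cancel_mono (lunK _)); rewrite !compA lunVK comp1m lun_nat -compA.
by rewrite lunVK compm1.
Qed.

(** Kelly's argument: after tensoring with the unit on the left and composing with invertible
    associators, the claim follows from the pentagon and the triangle. *)
Lemma lun_tens X Y : lun (X ⊗ Y) ∘ asc tunit X Y = lun X ⊠ idm Y.
Proof.
apply: ltunit_inj; pose h := asc tunit (tunit ⊗ X) Y ∘ (asc tunit tunit X ⊠ idm Y).
have hK : h ∘ ((ascV tunit tunit X ⊠ idm Y) ∘ ascV tunit (tunit ⊗ X) Y) = idm _.
  by rewrite /h compA -(compA (asc _ _ _)) -rcomp ascVK tensm1 compm1 ascVK.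
apply: (cancel_epi hK); rewrite /h !compA lcomp -!compA -pentagon compA triangle.
rewrite -tensm1 -asc_nat -triangle rcomp compA asc_nat -!compA.
by [].
Qed.

Lemma lunI : lun (@tunit C) = run tunit.
Proof.
apply: rtunit_inj; rewrite -lun_tens -triangle; congr (_ ∘ _).
by apply: (cancel_mono (lunK _)); rewrite lun_nat.
Qed.

(** The hexagon at X, I, I, where naturality of the symmetry turns the unitors into one another. *)
Lemma lun_swap X : lun X ∘ swap X tunit = run X.
Proof.
apply: rtunit_inj; apply: (cancel_mono (swapK _ _)).
have e1 : swap X tunit ∘ (run X ⊠ idm tunit)
  = lun (tunit ⊗ X) ∘ (asc tunit tunit X ∘ (swap X (tunit ⊗ tunit) ∘ asc X tunit tunit)).
  by rewrite compA lun_tens compA -swap_nat -compA triangle.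
rewrite e1 hexagon !compA lun_nat -(compA _ (lun _)) lun_tens -compA.
by rewrite -rcomp.
Qed.

End Basic.

(** * Morphisms acting on words *)

Section Tails.
Context {C : closedSymMonCat}.
Implicit Types X Y Z T W : C.

(* A bracketed word [rob] in objects, with the isomorphic right-nested word
   [rF T = X1 ⊗ (X2 ⊗ (... ⊗ T))] ending in an arbitrary tail [T]. *)
Record robj := Robj {
  rob : C;
  rF : C -> C;
  rM : forall T T', Mor T T' -> Mor (rF T) (rF T');
  rI : forall T, Mor (rob ⊗ T) (rF T);
  rJ : forall T, Mor (rF T) (rob ⊗ T);
  rIJ : forall T, rI T ∘ rJ T = idm _;
  rJI : forall T, rJ T ∘ rI T = idm _;
  rnat : forall T T' (h : Mor T T'), rI T' ∘ (rob ◁ h) = rM h ∘ rI T }.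

Implicit Types a b c : robj.

Lemma rnatJ a T T' (h : Mor T T') : rJ a T' ∘ rM a h = (rob a ◁ h) ∘ rJ a T.
Proof.
apply: (cancel_epi (rIJ a T)); apply: (cancel_mono (rJI a T')).
by rewrite -compA -rnat !compA rIJ comp1m -!compA rJI compm1.
Qed.

Lemma atom_nat X T T' (h : Mor T T') :
  idm (X ⊗ T') ∘ (X ◁ h) = (X ◁ h) ∘ idm (X ⊗ T).
Proof. by rewrite comp1m compm1. Qed.

(** Default instance: an object that is neither the unit nor a tensor product counts as one
    letter. *)
Canonical ratom X : robj := @Robj X (tens X) (fun T T' (h : Mor T T') => X ◁ h)
  (fun T => idm (X ⊗ T)) (fun T => idm (X ⊗ T))
  (fun T => comp1m _) (fun T => comp1m _) (@atom_nat X).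

(** The unit contributes no letter; its word is the tail itself, which is why unitors act as
    identities. *)
Canonical runit : robj := @Robj tunit id (fun T T' h => h)
  lun lunV (@lunVK C) (@lunK C) (fun T T' h => lun_nat h).

Section Tens.
Variables a b : robj.
Let I T : Mor ((rob a ⊗ rob b) ⊗ T) (rF a (rF b T)) :=
  rI a (rF b T) ∘ (rob a ◁ rI b T) ∘ asc (rob a) (rob b) T.
Let J T : Mor (rF a (rF b T)) ((rob a ⊗ rob b) ⊗ T) :=
  ascV (rob a) (rob b) T ∘ (rob a ◁ rJ b T) ∘ rJ a (rF b T).
Fact rtens_IJ T : I T ∘ J T = idm _.
Proof.
rewrite /I /J !compA -(compA _ (asc _ _ _)) ascVK compm1.
by rewrite -(compA (rI a _)) -lcomp rIJ tensm1 compm1 rIJ.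
Qed.
Fact rtens_JI T : J T ∘ I T = idm _.
Proof.
rewrite /I /J !compA -(compA _ (rJ _ _)) rJI compm1.
by rewrite -(compA (ascV _ _ _)) -lcomp rJI tensm1 compm1 ascK.
Qed.
Fact rtens_nat T T' (h : Mor T T') :
  I T' ∘ ((rob a ⊗ rob b) ◁ h) = rM a (rM b h) ∘ I T.
Proof.
rewrite /I -tensm1 -compA asc_nat !compA -(compA (rI a _)) -lcomp (@rnat b).
by rewrite lcomp !compA rnat.
Qed.
Canonical rtens : robj := Robj rtens_IJ rtens_JI rtens_nat.
End Tens.

(* The action of [f], a morphism between bracketed words, on right-nested words
   ending in a tail [T]: associators and unitors act as identities.  Locked so
   that unification never unfolds it into a composite. *)
Fact str_key : unit. Proof. by []. Qed.
Definition str a b (f : Mor (rob a) (rob b)) T : Mor (rF a T) (rF b T) :=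
  locked_with str_key (rI b T ∘ (f ⊠ idm T) ∘ rJ a T).
Lemma strE a b (f : Mor (rob a) (rob b)) T :
  str f T = rI b T ∘ (f ⊠ idm T) ∘ rJ a T.
Proof. by rewrite /str unlock. Qed.

(** Faithfulness of the action on words: since X ⊗ I is isomorphic to X, the tail [tunit] already
    determines the morphism. *)
Lemma str_inj a b (f g : Mor (rob a) (rob b)) : str f tunit = str g tunit -> f = g.
Proof.
rewrite !strE => fg; apply: rtunit_inj; apply: (cancel_mono (rJI b _)).
by apply: (cancel_epi (rJI a _)).
Qed.

Lemma str_comp a b c (g : Mor (rob b) (rob c)) (f : Mor (rob a) (rob b)) T :
  str (g ∘ f) T = str g T ∘ str f T.
Proof. by rewrite !strE rcomp !compA -(compA _ (rJ b T)) rJI compm1. Qed.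

Lemma str_id a T : str (idm (rob a)) T = idm _.
Proof. by rewrite !strE tensm1 compm1 rIJ. Qed.

Lemma rM_id a T : rM a (idm T) = idm _.
Proof.
by apply: (cancel_epi (rIJ a T)); rewrite -rnat tensm1 compm1 comp1m.
Qed.
Lemma rM_comp a T T' T'' (g : Mor T' T'') (f : Mor T T') :
  rM a (g ∘ f) = rM a g ∘ rM a f.
Proof.
by apply: (cancel_epi (rIJ a T)); rewrite -rnat lcomp -compA -rnat !compA -rnat.
Qed.

Lemma str_nat a b (f : Mor (rob a) (rob b)) T T' (h : Mor T T') :
  str f T' ∘ rM a h = rM b h ∘ str f T.
Proof.
by rewrite !strE -!compA rnatJ !compA -rnat -(compA _ (f ⊠ _)) tens_inter !compA.
Qed.

Lemma str_tens a a' b b' (f : Mor (rob a) (rob b)) (g : Mor (rob a') (rob b')) T :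
  str (f ⊠ g) T = str f (rF b' T) ∘ rM a (str g T).
Proof.
rewrite !strE /= !compA -(compA _ (asc _ _ _)) asc_nat !compA.
rewrite -(compA _ (asc _ _ _)) ascVK compm1.
rewrite -!(compA _ (rJ a _)) rnatJ !compA; congr (_ ∘ _).
rewrite -!compA; congr (_ ∘ _).
by rewrite -!tensm_comp !compm1 !comp1m.
Qed.

Lemma str_lid a b b' (g : Mor (rob b) (rob b')) T :
  str (rob a ◁ g) T = rM a (str g T).
Proof. by rewrite str_tens str_id comp1m. Qed.

Lemma str_rid a b b' (g : Mor (rob b) (rob b')) T :
  str (g ⊠ idm (rob a)) T = str g (rF a T).
Proof. by rewrite str_tens str_id rM_id compm1. Qed.

Lemma str_asc a b c T : str (asc (rob a) (rob b) (rob c)) T = idm _.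
Proof.
rewrite !strE; apply: (cancel_epi (rIJ (rtens (rtens a b) c) T)); rewrite comp1m.
rewrite -compA rJI compm1 /= lcomp lcomp -!compA -pentagon !compA.
congr (_ ∘ _); rewrite -!compA; congr (_ ∘ _).
by rewrite -tensm1 asc_nat.
Qed.
Lemma str_ascV a b c T : str (ascV (rob a) (rob b) (rob c)) T = idm _.
Proof.
have := str_id (rtens (rtens a b) c) T.
by rewrite -(ascK (rob a)) (@str_comp (rtens (rtens a b) c) (rtens a (rtens b c)) (rtens
  (rtens a b) c)) str_asc compm1.
Qed.
Lemma str_lun a T : str (lun (rob a)) T = idm _.
Proof.
rewrite !strE; apply: (cancel_epi (rIJ (rtens runit a) T)); rewrite comp1m.
by rewrite -compA rJI compm1 /= lun_nat -compA lun_tens.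
Qed.
Lemma str_lunV a T : str (lunV (rob a)) T = idm _.
Proof.
have := str_id (rtens runit a) T.
by rewrite -(lunK (rob a)) (@str_comp (rtens runit a) a (rtens runit a)) str_lun compm1.
Qed.
Lemma str_run a T : str (run (rob a)) T = idm _.
Proof.
rewrite !strE; apply: (cancel_epi (rIJ (rtens a runit) T)); rewrite comp1m.
by rewrite -compA rJI compm1 /= -compA triangle.
Qed.
Lemma str_runV a T : str (runV (rob a)) T = idm _.
Proof.
have := str_id (rtens a runit) T.
by rewrite -(runK (rob a)) (@str_comp (rtens a runit) a (rtens a runit)) str_run compm1.
Qed.

Lemma strD a b (f g : Mor (rob a) (rob b)) T : str (f + g) T = str f T + str g T.
Proof. by rewrite !strE tensDl compDr compDl. Qed.
Lemma strZ a b k (f : Mor (rob a) (rob b)) T : str (k *: f) T = k *: str f T.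
Proof. by rewrite !strE tensZl compZr compZl. Qed.

Definition swp a b T : Mor (rF a (rF b T)) (rF b (rF a T)) :=
  str (swap (rob a) (rob b)) T.

Lemma swpK a b T : swp b a T ∘ swp a b T = idm _.
Proof.
by rewrite -(@str_comp (rtens a b) (rtens b a) (rtens a b)) swapK (str_id (rtens a b)).
Qed.
Lemma swp_tensr a b c T : swp a (rtens b c) T = rM b (swp a c T) ∘ swp a b (rF c T).
Proof.
have := congr1 (fun f => @str (rtens (rtens a b) c) (rtens b (rtens c a)) f T)
  (hexagon (rob a) (rob b) (rob c)).
rewrite /= (@str_comp (rtens (rtens a b) c) (rtens (rtens b c) a) (rtens b (rtens c a))).
rewrite str_asc comp1m.
rewrite (@str_comp (rtens (rtens a b) c) (rtens a (rtens b c)) (rtens (rtens b c) a)).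
rewrite str_asc compm1 -[LHS]/(swp a (rtens b c) T) => ->.
rewrite (@str_comp (rtens (rtens a b) c) (rtens b (rtens a c)) (rtens b (rtens c a))).
rewrite (@str_comp (rtens (rtens a b) c) (rtens (rtens b a) c) (rtens b (rtens a c))).
by rewrite str_asc comp1m str_lid str_rid.
Qed.
Lemma swp_tensl a b c T : swp (rtens a b) c T = swp a c (rF b T) ∘ rM a (swp b c T).
Proof.
apply: (cancel_mono (swpK c (rtens a b) T)); rewrite swpK swp_tensr.
by rewrite !compA -(compA _ (swp c a _)) swpK compm1 -(@rM_comp a) swpK rM_id.
Qed.
Lemma swp_unitr a T : swp a runit T = idm _.
Proof.
have := congr1 (fun f => @str (rtens a runit) a f T) (lun_swap (rob a)).
by rewrite /= (@str_comp _ (rtens runit a)) str_lun str_run comp1m.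
Qed.
Lemma swp_unitl a T : swp runit a T = idm _.
Proof. by have := swpK runit a T; rewrite swp_unitr comp1m. Qed.

Lemma swp_str a b c (f : Mor (rob a) (rob b)) T :
  swp b c T ∘ str f (rF c T) = rM c (str f T) ∘ swp a c T.
Proof.
rewrite -str_rid -str_lid -(@str_comp (rtens a c) (rtens b c) (rtens c b)) swap_nat.
by rewrite (@str_comp (rtens a c) (rtens c a) (rtens c b)).
Qed.
Lemma str_swp a b c (f : Mor (rob a) (rob b)) T :
  str f (rF c T) ∘ swp c a T = swp c b T ∘ rM c (str f T).
Proof.
rewrite -str_rid -str_lid -(@str_comp (rtens c a) (rtens c b) (rtens b c)) swap_nat.
by rewrite (@str_comp (rtens c a) (rtens a c) (rtens b c)).
Qed.

(* [omn f] has m letters in its source and n letters in its target. *)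
Definition o11 X Y (f : Mor X Y) T : Mor (X ⊗ T) (Y ⊗ T) := str f T.
Definition o21 X Y Z (f : Mor (X ⊗ Y) Z) T : Mor (X ⊗ (Y ⊗ T)) (Z ⊗ T) := str f T.
Definition o12 X Y Z (f : Mor X (Y ⊗ Z)) T : Mor (X ⊗ T) (Y ⊗ (Z ⊗ T)) := str f T.
Definition o20 X Y (f : Mor (X ⊗ Y) tunit) T : Mor (X ⊗ (Y ⊗ T)) T := str f T.
Definition o02 X Y (f : Mor tunit (X ⊗ Y)) T : Mor T (X ⊗ (Y ⊗ T)) := str f T.
Definition o10 X (f : Mor X tunit) T : Mor (X ⊗ T) T := str f T.
Definition o01 X (f : Mor tunit X) T : Mor T (X ⊗ T) := str f T.
Definition sw X Y T : Mor (X ⊗ (Y ⊗ T)) (Y ⊗ (X ⊗ T)) := swp (ratom X) (ratom Y) T.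

End Tails.

(* [compmn]: an equation between right-nested composites of m and n morphisms,
   precomposed with [z]; [ltensmn]: the same equation under [W ◁ _]. *)
Section Families.
Context {C : closedSymMonCat}.
Implicit Types A B S W X Y : C.

Lemma comp12 A B Y0 S (f0 : Mor A B) (g0 : Mor Y0 B) (g1 : Mor A Y0) :
  f0 = g0 ∘ g1 -> forall z : Mor S A, f0 ∘ z = g0 ∘ (g1 ∘ z).
Proof. by rewrite ?compA => H z; rewrite ?compA H ?comp1m. Qed.
Lemma ltens12 A B Y0 W (f0 : Mor A B) (g0 : Mor Y0 B) (g1 : Mor A Y0) :
  f0 = g0 ∘ g1 -> (W ◁ f0) = (W ◁ g0) ∘ (W ◁ g1).
Proof. by rewrite -?lcomp => ->; rewrite ?tensm1. Qed.
Lemma comp13 A B Y0 Y1 S (f0 : Mor A B) (g0 : Mor Y1 B) (g1 : Mor Y0 Y1) (g2 : Mor A Y0) :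
  f0 = g0 ∘ (g1 ∘ g2) -> forall z : Mor S A, f0 ∘ z = g0 ∘ (g1 ∘ (g2 ∘ z)).
Proof. by rewrite ?compA => H z; rewrite ?compA H ?comp1m. Qed.
Lemma ltens13 A B Y0 Y1 W (f0 : Mor A B) (g0 : Mor Y1 B) (g1 : Mor Y0 Y1) (g2 : Mor A Y0) :
  f0 = g0 ∘ (g1 ∘ g2) -> (W ◁ f0) = (W ◁ g0) ∘ ((W ◁ g1) ∘ (W ◁ g2)).
Proof. by rewrite -?lcomp => ->; rewrite ?tensm1. Qed.
Lemma comp20 A X0 S (f0 : Mor X0 A) (f1 : Mor A X0) :
  f0 ∘ f1 = idm A -> forall z : Mor S A, f0 ∘ (f1 ∘ z) = z.
Proof. by rewrite ?compA => H z; rewrite ?compA H ?comp1m. Qed.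
Lemma ltens20 A X0 W (f0 : Mor X0 A) (f1 : Mor A X0) :
  f0 ∘ f1 = idm A -> (W ◁ f0) ∘ (W ◁ f1) = idm (W ⊗ A).
Proof. by rewrite -?lcomp => ->; rewrite ?tensm1. Qed.
Lemma comp21 A B X0 S (f0 : Mor X0 B) (f1 : Mor A X0) (g0 : Mor A B) :
  f0 ∘ f1 = g0 -> forall z : Mor S A, f0 ∘ (f1 ∘ z) = g0 ∘ z.
Proof. by rewrite ?compA => H z; rewrite ?compA H ?comp1m. Qed.
Lemma ltens21 A B X0 W (f0 : Mor X0 B) (f1 : Mor A X0) (g0 : Mor A B) :
  f0 ∘ f1 = g0 -> (W ◁ f0) ∘ (W ◁ f1) = (W ◁ g0).
Proof. by rewrite -?lcomp => ->; rewrite ?tensm1. Qed.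
Lemma comp22 A B X0 Y0 S (f0 : Mor X0 B) (f1 : Mor A X0) (g0 : Mor Y0 B) (g1 : Mor A Y0) :
  f0 ∘ f1 = g0 ∘ g1 -> forall z : Mor S A, f0 ∘ (f1 ∘ z) = g0 ∘ (g1 ∘ z).
Proof. by rewrite ?compA => H z; rewrite ?compA H ?comp1m. Qed.
Lemma ltens22 A B X0 Y0 W (f0 : Mor X0 B) (f1 : Mor A X0) (g0 : Mor Y0 B) (g1 : Mor A Y0) :
  f0 ∘ f1 = g0 ∘ g1 -> (W ◁ f0) ∘ (W ◁ f1) = (W ◁ g0) ∘ (W ◁ g1).
Proof. by rewrite -?lcomp => ->; rewrite ?tensm1. Qed.
Lemma comp23 A B X0 Y0 Y1 S (f0 : Mor X0 B) (f1 : Mor A X0) (g0 : Mor Y1 B) (g1 : Mor Y0 Y1)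
  (g2 : Mor A Y0) :
  f0 ∘ f1 = g0 ∘ (g1 ∘ g2) -> forall z : Mor S A, f0 ∘ (f1 ∘ z) = g0 ∘ (g1 ∘ (g2 ∘ z)).
Proof. by rewrite ?compA => H z; rewrite ?compA H ?comp1m. Qed.
Lemma ltens23 A B X0 Y0 Y1 W (f0 : Mor X0 B) (f1 : Mor A X0) (g0 : Mor Y1 B) (g1 : Mor Y0 Y1)
  (g2 : Mor A Y0) :
  f0 ∘ f1 = g0 ∘ (g1 ∘ g2) -> (W ◁ f0) ∘ (W ◁ f1) = (W ◁ g0) ∘ ((W ◁ g1) ∘ (W ◁ g2)).
Proof. by rewrite -?lcomp => ->; rewrite ?tensm1. Qed.
Lemma comp24 A B X0 Y0 Y1 Y2 S (f0 : Mor X0 B) (f1 : Mor A X0) (g0 : Mor Y2 B)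
  (g1 : Mor Y1 Y2) (g2 : Mor Y0 Y1) (g3 : Mor A Y0) :
  f0 ∘ f1 = g0 ∘ (g1 ∘ (g2 ∘ g3)) ->
    forall z : Mor S A, f0 ∘ (f1 ∘ z) = g0 ∘ (g1 ∘ (g2 ∘ (g3 ∘ z))).
Proof. by rewrite ?compA => H z; rewrite ?compA H ?comp1m. Qed.
Lemma ltens24 A B X0 Y0 Y1 Y2 W (f0 : Mor X0 B) (f1 : Mor A X0) (g0 : Mor Y2 B)
  (g1 : Mor Y1 Y2) (g2 : Mor Y0 Y1) (g3 : Mor A Y0) :
  f0 ∘ f1 = g0 ∘ (g1 ∘ (g2 ∘ g3)) ->
    (W ◁ f0) ∘ (W ◁ f1) = (W ◁ g0) ∘ ((W ◁ g1) ∘ ((W ◁ g2) ∘ (W ◁ g3))).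
Proof. by rewrite -?lcomp => ->; rewrite ?tensm1. Qed.
Lemma comp30 A X0 X1 S (f0 : Mor X1 A) (f1 : Mor X0 X1) (f2 : Mor A X0) :
  f0 ∘ (f1 ∘ f2) = idm A -> forall z : Mor S A, f0 ∘ (f1 ∘ (f2 ∘ z)) = z.
Proof. by rewrite ?compA => H z; rewrite ?compA H ?comp1m. Qed.
Lemma ltens30 A X0 X1 W (f0 : Mor X1 A) (f1 : Mor X0 X1) (f2 : Mor A X0) :
  f0 ∘ (f1 ∘ f2) = idm A -> (W ◁ f0) ∘ ((W ◁ f1) ∘ (W ◁ f2)) = idm (W ⊗ A).
Proof. by rewrite -?lcomp => ->; rewrite ?tensm1. Qed.
Lemma comp31 A B X0 X1 S (f0 : Mor X1 B) (f1 : Mor X0 X1) (f2 : Mor A X0) (g0 : Mor A B) :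
  f0 ∘ (f1 ∘ f2) = g0 -> forall z : Mor S A, f0 ∘ (f1 ∘ (f2 ∘ z)) = g0 ∘ z.
Proof. by rewrite ?compA => H z; rewrite ?compA H ?comp1m. Qed.
Lemma ltens31 A B X0 X1 W (f0 : Mor X1 B) (f1 : Mor X0 X1) (f2 : Mor A X0) (g0 : Mor A B) :
  f0 ∘ (f1 ∘ f2) = g0 -> (W ◁ f0) ∘ ((W ◁ f1) ∘ (W ◁ f2)) = (W ◁ g0).
Proof. by rewrite -?lcomp => ->; rewrite ?tensm1. Qed.
Lemma comp32 A B X0 X1 Y0 S (f0 : Mor X1 B) (f1 : Mor X0 X1) (f2 : Mor A X0) (g0 : Mor Y0 B)
  (g1 : Mor A Y0) :
  f0 ∘ (f1 ∘ f2) = g0 ∘ g1 -> forall z : Mor S A, f0 ∘ (f1 ∘ (f2 ∘ z)) = g0 ∘ (g1 ∘ z).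
Proof. by rewrite ?compA => H z; rewrite ?compA H ?comp1m. Qed.
Lemma ltens32 A B X0 X1 Y0 W (f0 : Mor X1 B) (f1 : Mor X0 X1) (f2 : Mor A X0) (g0 : Mor Y0 B)
  (g1 : Mor A Y0) :
  f0 ∘ (f1 ∘ f2) = g0 ∘ g1 -> (W ◁ f0) ∘ ((W ◁ f1) ∘ (W ◁ f2)) = (W ◁ g0) ∘ (W ◁ g1).
Proof. by rewrite -?lcomp => ->; rewrite ?tensm1. Qed.
Lemma comp33 A B X0 X1 Y0 Y1 S (f0 : Mor X1 B) (f1 : Mor X0 X1) (f2 : Mor A X0)
  (g0 : Mor Y1 B) (g1 : Mor Y0 Y1) (g2 : Mor A Y0) :
  f0 ∘ (f1 ∘ f2) = g0 ∘ (g1 ∘ g2) ->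
    forall z : Mor S A, f0 ∘ (f1 ∘ (f2 ∘ z)) = g0 ∘ (g1 ∘ (g2 ∘ z)).
Proof. by rewrite ?compA => H z; rewrite ?compA H ?comp1m. Qed.
Lemma ltens33 A B X0 X1 Y0 Y1 W (f0 : Mor X1 B) (f1 : Mor X0 X1) (f2 : Mor A X0)
  (g0 : Mor Y1 B) (g1 : Mor Y0 Y1) (g2 : Mor A Y0) :
  f0 ∘ (f1 ∘ f2) = g0 ∘ (g1 ∘ g2) ->
    (W ◁ f0) ∘ ((W ◁ f1) ∘ (W ◁ f2)) = (W ◁ g0) ∘ ((W ◁ g1) ∘ (W ◁ g2)).
Proof. by rewrite -?lcomp => ->; rewrite ?tensm1. Qed.
Lemma comp40 A X0 X1 X2 S (f0 : Mor X2 A) (f1 : Mor X1 X2) (f2 : Mor X0 X1) (f3 : Mor A X0) :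
  f0 ∘ (f1 ∘ (f2 ∘ f3)) = idm A -> forall z : Mor S A, f0 ∘ (f1 ∘ (f2 ∘ (f3 ∘ z))) = z.
Proof. by rewrite ?compA => H z; rewrite ?compA H ?comp1m. Qed.
Lemma ltens40 A X0 X1 X2 W (f0 : Mor X2 A) (f1 : Mor X1 X2) (f2 : Mor X0 X1) (f3 : Mor A X0) :
  f0 ∘ (f1 ∘ (f2 ∘ f3)) = idm A -> (W ◁ f0) ∘ ((W ◁ f1) ∘ ((W ◁ f2) ∘ (W ◁ f3))) = idm (W ⊗ A).
Proof. by rewrite -?lcomp => ->; rewrite ?tensm1. Qed.
End Families.

(* [rwd H] rewrites with [H] inside a right-nested composite, below [d] tensor
   factors. *)
Tactic Notation "rw0" uconstr(H) :=
  first [ rewrite (comp40 H)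
        | rewrite (comp30 H)
        | rewrite (comp33 H)
        | rewrite (comp32 H)
        | rewrite (comp31 H)
        | rewrite (comp20 H)
        | rewrite (comp24 H)
        | rewrite (comp23 H)
        | rewrite (comp22 H)
        | rewrite (comp21 H)
        | rewrite (comp13 H)
        | rewrite (comp12 H) ].
Tactic Notation "rw1" uconstr(H) :=
  first [ rewrite (comp40 (ltens40 _ H))
        | rewrite (comp30 (ltens30 _ H))
        | rewrite (comp33 (ltens33 _ H))
        | rewrite (comp32 (ltens32 _ H))
        | rewrite (comp31 (ltens31 _ H))
        | rewrite (comp20 (ltens20 _ H))
        | rewrite (comp24 (ltens24 _ H))
        | rewrite (comp23 (ltens23 _ H))
        | rewrite (comp22 (ltens22 _ H))
        | rewrite (comp21 (ltens21 _ H))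
        | rewrite (comp13 (ltens13 _ H))
        | rewrite (comp12 (ltens12 _ H)) ].
Tactic Notation "rw2" uconstr(H) :=
  first [ rewrite (comp40 (ltens40 _ (ltens40 _ H)))
        | rewrite (comp30 (ltens30 _ (ltens30 _ H)))
        | rewrite (comp33 (ltens33 _ (ltens33 _ H)))
        | rewrite (comp32 (ltens32 _ (ltens32 _ H)))
        | rewrite (comp31 (ltens31 _ (ltens31 _ H)))
        | rewrite (comp20 (ltens20 _ (ltens20 _ H)))
        | rewrite (comp24 (ltens24 _ (ltens24 _ H)))
        | rewrite (comp23 (ltens23 _ (ltens23 _ H)))
        | rewrite (comp22 (ltens22 _ (ltens22 _ H)))
        | rewrite (comp21 (ltens21 _ (ltens21 _ H)))
        | rewrite (comp13 (ltens13 _ (ltens13 _ H)))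
        | rewrite (comp12 (ltens12 _ (ltens12 _ H))) ].
Tactic Notation "rw3" uconstr(H) :=
  first [ rewrite (comp40 (ltens40 _ (ltens40 _ (ltens40 _ H))))
        | rewrite (comp30 (ltens30 _ (ltens30 _ (ltens30 _ H))))
        | rewrite (comp33 (ltens33 _ (ltens33 _ (ltens33 _ H))))
        | rewrite (comp32 (ltens32 _ (ltens32 _ (ltens32 _ H))))
        | rewrite (comp31 (ltens31 _ (ltens31 _ (ltens31 _ H))))
        | rewrite (comp20 (ltens20 _ (ltens20 _ (ltens20 _ H))))
        | rewrite (comp24 (ltens24 _ (ltens24 _ (ltens24 _ H))))
        | rewrite (comp23 (ltens23 _ (ltens23 _ (ltens23 _ H))))
        | rewrite (comp22 (ltens22 _ (ltens22 _ (ltens22 _ H))))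
        | rewrite (comp21 (ltens21 _ (ltens21 _ (ltens21 _ H))))
        | rewrite (comp13 (ltens13 _ (ltens13 _ (ltens13 _ H))))
        | rewrite (comp12 (ltens12 _ (ltens12 _ (ltens12 _ H)))) ].
Tactic Notation "rw4" uconstr(H) :=
  first [ rewrite (comp40 (ltens40 _ (ltens40 _ (ltens40 _ (ltens40 _ H)))))
        | rewrite (comp30 (ltens30 _ (ltens30 _ (ltens30 _ (ltens30 _ H)))))
        | rewrite (comp33 (ltens33 _ (ltens33 _ (ltens33 _ (ltens33 _ H)))))
        | rewrite (comp32 (ltens32 _ (ltens32 _ (ltens32 _ (ltens32 _ H)))))
        | rewrite (comp31 (ltens31 _ (ltens31 _ (ltens31 _ (ltens31 _ H)))))
        | rewrite (comp20 (ltens20 _ (ltens20 _ (ltens20 _ (ltens20 _ H)))))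
        | rewrite (comp24 (ltens24 _ (ltens24 _ (ltens24 _ (ltens24 _ H)))))
        | rewrite (comp23 (ltens23 _ (ltens23 _ (ltens23 _ (ltens23 _ H)))))
        | rewrite (comp22 (ltens22 _ (ltens22 _ (ltens22 _ (ltens22 _ H)))))
        | rewrite (comp21 (ltens21 _ (ltens21 _ (ltens21 _ (ltens21 _ H)))))
        | rewrite (comp13 (ltens13 _ (ltens13 _ (ltens13 _ (ltens13 _ H)))))
        | rewrite (comp12 (ltens12 _ (ltens12 _ (ltens12 _ (ltens12 _ H))))) ].

Section Laws.
Context {C : closedSymMonCat}.
Implicit Types X Y Z T W : C.

Lemma o11_nat X Y (f : Mor X Y) T T' (h : Mor T T') : o11 f T' ∘ (X ◁ h) = (Y ◁ h) ∘ o11 f T.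
Proof. exact: (@str_nat C (ratom X) (ratom Y)). Qed.
Lemma o21_nat X Y Z (f : Mor (X ⊗ Y) Z) T T' (h : Mor T T') :
  o21 f T' ∘ (X ◁ (Y ◁ h)) = (Z ◁ h) ∘ o21 f T.
Proof. exact: (@str_nat C (rtens (ratom X) (ratom Y)) (ratom Z)). Qed.
Lemma o12_nat X Y Z (f : Mor X (Y ⊗ Z)) T T' (h : Mor T T') :
  o12 f T' ∘ (X ◁ h) = (Y ◁ Z ◁ h) ∘ o12 f T.
Proof. exact: (@str_nat C (ratom X) (rtens (ratom Y) (ratom Z))). Qed.
Lemma o20_nat X Y (f : Mor (X ⊗ Y) tunit) T T' (h : Mor T T') :
  o20 f T' ∘ (X ◁ (Y ◁ h)) = h ∘ o20 f T.
Proof. exact: (@str_nat C (rtens (ratom X) (ratom Y)) runit). Qed.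
Lemma o02_nat X Y (f : Mor tunit (X ⊗ Y)) T T' (h : Mor T T') :
  o02 f T' ∘ h = (X ◁ (Y ◁ h)) ∘ o02 f T.
Proof. exact: (@str_nat C runit (rtens (ratom X) (ratom Y))). Qed.
Lemma o01_nat X (f : Mor tunit X) T T' (h : Mor T T') : o01 f T' ∘ h = (X ◁ h) ∘ o01 f T.
Proof. exact: (@str_nat C runit (ratom X)). Qed.
Lemma sw_nat X Y T T' (h : Mor T T') : sw X Y T' ∘ (X ◁ Y ◁ h) = (Y ◁ X ◁ h) ∘ sw X Y T.
Proof. exact: (@str_nat C (rtens (ratom X) (ratom Y)) (rtens (ratom Y) (ratom X))). Qed.
Lemma swK X Y T : sw Y X T ∘ sw X Y T = idm _.
Proof. exact: (@swpK C (ratom X) (ratom Y)). Qed.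

Lemma o11_sw X Y W (f : Mor X Y) T : sw Y W T ∘ o11 f (W ⊗ T) = (W ◁ o11 f T) ∘ sw X W T.
Proof. exact: (@swp_str C (ratom X) (ratom Y) (ratom W)). Qed.
Lemma o21_sw X Y Z W (f : Mor (X ⊗ Y) Z) T :
  sw Z W T ∘ o21 f (W ⊗ T) = (W ◁ o21 f T) ∘ (sw X W (Y ⊗ T) ∘ (X ◁ sw Y W T)).
Proof.
have := @swp_str C (rtens (ratom X) (ratom Y)) (ratom Z) (ratom W) f T.
by rewrite swp_tensl.
Qed.
Lemma o12_sw X Y Z W (f : Mor X (Y ⊗ Z)) T :
  sw Y W (Z ⊗ T) ∘ ((Y ◁ sw Z W T) ∘ o12 f (W ⊗ T)) = (W ◁ o12 f T) ∘ sw X W T.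
Proof.
have := @swp_str C (ratom X) (rtens (ratom Y) (ratom Z)) (ratom W) f T.
by rewrite swp_tensl -compA.
Qed.
Lemma o20_sw X Y W (f : Mor (X ⊗ Y) tunit) T :
  o20 f (W ⊗ T) = (W ◁ o20 f T) ∘ (sw X W (Y ⊗ T) ∘ (X ◁ sw Y W T)).
Proof.
have := @swp_str C (rtens (ratom X) (ratom Y)) runit (ratom W) f T.
by rewrite swp_tensl swp_unitl comp1m.
Qed.
Lemma o02_sw X Y W (f : Mor tunit (X ⊗ Y)) T :
  sw X W (Y ⊗ T) ∘ ((X ◁ sw Y W T) ∘ o02 f (W ⊗ T)) = W ◁ o02 f T.
Proof.
have := @swp_str C runit (rtens (ratom X) (ratom Y)) (ratom W) f T.
by rewrite swp_tensl swp_unitl compm1 -compA.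
Qed.
Lemma o01_sw X W (f : Mor tunit X) T : sw X W T ∘ o01 f (W ⊗ T) = W ◁ o01 f T.
Proof.
by have := @swp_str C runit (ratom X) (ratom W) f T; rewrite swp_unitl compm1.
Qed.

Lemma sw_o11 X Y W (f : Mor X Y) T : o11 f (W ⊗ T) ∘ sw W X T = sw W Y T ∘ (W ◁ o11 f T).
Proof. exact: (@str_swp C (ratom X) (ratom Y) (ratom W)). Qed.
Lemma sw_o21 X Y Z W (f : Mor (X ⊗ Y) Z) T :
  o21 f (W ⊗ T) ∘ ((X ◁ sw W Y T) ∘ sw W X (Y ⊗ T)) = sw W Z T ∘ (W ◁ o21 f T).
Proof.
have := @str_swp C (rtens (ratom X) (ratom Y)) (ratom Z) (ratom W) f T.
by rewrite swp_tensr.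
Qed.
Lemma sw_o12 X Y Z W (f : Mor X (Y ⊗ Z)) T :
  o12 f (W ⊗ T) ∘ sw W X T = (Y ◁ sw W Z T) ∘ (sw W Y (Z ⊗ T) ∘ (W ◁ o12 f T)).
Proof.
have := @str_swp C (ratom X) (rtens (ratom Y) (ratom Z)) (ratom W) f T.
by rewrite swp_tensr -compA.
Qed.
Lemma sw_o20 X Y W (f : Mor (X ⊗ Y) tunit) T :
  o20 f (W ⊗ T) ∘ ((X ◁ sw W Y T) ∘ sw W X (Y ⊗ T)) = W ◁ o20 f T.
Proof.
have := @str_swp C (rtens (ratom X) (ratom Y)) runit (ratom W) f T.
by rewrite swp_tensr swp_unitr comp1m.
Qed.
Lemma sw_o02 X Y W (f : Mor tunit (X ⊗ Y)) T :
  o02 f (W ⊗ T) = (X ◁ sw W Y T) ∘ (sw W X (Y ⊗ T) ∘ (W ◁ o02 f T)).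
Proof.
have := @str_swp C runit (rtens (ratom X) (ratom Y)) (ratom W) f T.
by rewrite swp_tensr swp_unitr compm1 -compA.
Qed.
(** Naturality of the symmetry, applied to the symmetry itself. *)
Lemma swYB X Y Z T :
  (Z ◁ sw X Y T) ∘ (sw X Z (Y ⊗ T) ∘ (X ◁ sw Y Z T))
  = sw Y Z (X ⊗ T) ∘ ((Y ◁ sw X Z T) ∘ sw X Y (Z ⊗ T)).
Proof.
have := @swp_str C (rtens (ratom X) (ratom Y)) (rtens (ratom Y) (ratom X)) (ratom Z)
  (swap X Y) T.
by rewrite !swp_tensl -!compA => <-.
Qed.

Lemma o11_id X T : o11 (idm X) T = idm _.
Proof. exact: (str_id (ratom X)). Qed.
Lemma o11_comp X Y Z (g : Mor Y Z) (f : Mor X Y) T : o11 (g ∘ f) T = o11 g T ∘ o11 f T.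
Proof. exact: (@str_comp C (ratom X) (ratom Y) (ratom Z)). Qed.
Lemma o11_inj X Y (f g : Mor X Y) : o11 f tunit = o11 g tunit -> f = g.
Proof. exact: (@str_inj C (ratom X) (ratom Y)). Qed.

Lemma ltens1 X T : X ◁ idm T = idm _.
Proof. exact: tensm1. Qed.
End Laws.

(** Inductive step for [cycsum_absorb]: [s] and [t] stand for the two last adjacent transpositions
    and [k] for a cycle sum on factors that [t] does not move. Working in an abstract ring makes the
    mirror version available through the opposite ring. *)
Lemma braid_absorb (R : pzRingType) (k s t : R) : t * t = 1 -> t * s * t = s * t * s ->
  t * k = k * t -> (1 + k * s) * k * s = (1 + k * s) * k ->
  (1 + (1 + k * s) * t) * (1 + k * s) * t = (1 + (1 + k * s) * t) * (1 + k * s).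
Proof.
move=> tt tst tk ms; set a := 1 + k * s in ms *.
have -> : (1 + a * t) * a = a + (a * t + a * k * t * s).
  by rewrite mulrDl mul1r {2}/a mulrDr mulr1 mulrA -(mulrA a t k) tk mulrA.
clearbody a; rewrite !mulrDl -(mulrA a t t) tt mulr1 [a + _]addrCA; congr (_ + (_ + _)).
by rewrite -!mulrA (mulrA t s t) tst !mulrA ms.
Qed.

(** * Symmetrizers and coset decompositions *)

Section SwapLast.
Context {C : closedSymMonCat}.
Implicit Types X Y Z T : C.

Lemma str_swap_last (a b c : @robj C) T :
  str (swap_last (rob a) (rob b) (rob c)) T = rM a (swp b c T).
Proof.
rewrite /swap_last (@str_comp _ (rtens (rtens a b) c) (rtens a (rtens b c))).
rewrite (@str_comp _ (rtens a (rtens b c)) (rtens a (rtens c b))).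
by rewrite str_asc str_ascV str_lid /= compm1 comp1m.
Qed.

Lemma swap_lastK X Y Z : swap_last X Z Y ∘ swap_last X Y Z = idm _.
Proof.
apply: str_inj; rewrite str_comp !str_swap_last str_id /= -lcomp.
by rewrite swpK tensm1.
Qed.

Lemma swap_last_nat X X' Y Y' Z Z' (f : Mor X X') (g : Mor Y Y') (h : Mor Z Z') :
  swap_last X' Y' Z' ∘ ((f ⊠ g) ⊠ h) = ((f ⊠ h) ⊠ g) ∘ swap_last X Y Z.
Proof.
rewrite /swap_last -!compA asc_nat !compA; congr (_ ∘ _).
rewrite -!compA -tensm_comp comp1m swap_nat; rewrite -[f in LHS]compm1 tensm_comp compA.
by rewrite ascV_nat !compA.
Qed.

Lemma swap_last_braid X Y :
  swap_last (X ⊗ Y) Y Y ∘ (swap_last X Y Y ⊠ idm Y) ∘ swap_last (X ⊗ Y) Y Y =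
  (swap_last X Y Y ⊠ idm Y) ∘ swap_last (X ⊗ Y) Y Y ∘ (swap_last X Y Y ⊠ idm Y).
Proof.
have := @str_swap_last (rtens (ratom X) (ratom Y)) (ratom Y) (ratom Y).
have := @str_swap_last (ratom X) (ratom Y) (ratom Y).
move: (swap_last _ _ _) (swap_last _ _ _) => /= s t sE tE; apply: str_inj.
by rewrite !(str_comp, str_rid) sE tE /= -!lcomp -!compA swYB.
Qed.
End SwapLast.

Section Symmetrizer.
Context {C : rigidCat} (X : C).
Local Notation e := (symmetrizer X).

Definition last_swap m : Mor (tpow X m.+2) (tpow X m.+2) :=
  locked_with str_key (swap_last (tpow X m) X X).
Local Notation sg := last_swap.
Lemma last_swapE m : sg m = swap_last (tpow X m) X X.
Proof. by rewrite /last_swap unlock. Qed.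
Lemma last_swapK m : sg m ∘ sg m = idm _.
Proof. by rewrite last_swapE swap_lastK. Qed.
Lemma last_swap_braid m :
  sg m.+1 ∘ (sg m ⊠ idm X) ∘ sg m.+1 = (sg m ⊠ idm X) ∘ sg m.+1 ∘ (sg m ⊠ idm X).
Proof. by rewrite !last_swapE swap_last_braid. Qed.

Fixpoint cycsum m : Mor (tpow X m.+1) (tpow X m.+1) :=
  if m is m'.+1 then idm _ + ((cycsum m' ⊠ idm X) ∘ sg m') else idm _.

(** The products of transpositions in [cycsum], reversed: its terms are the inverses of those of
    [cycsum]. *)
Fixpoint cycsum' m : Mor (tpow X m.+1) (tpow X m.+1) :=
  if m is m'.+1 then idm _ + (sg m' ∘ (cycsum' m' ⊠ idm X)) else idm _.

(** The symmetrizer along the opposite cosets. [symmetrizerS] shows absorption of transpositions on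
    the right, this form shows it on the left; [symmetrizer_alt] identifies the two. *)
Fixpoint symm' m : Mor (tpow X m) (tpow X m) :=
  if m is m'.+1 then (m'.+1%:R^-1 : rat) *: ((symm' m' ⊠ idm X) ∘ cycsum' m') else idm _.

Lemma symm'S m : symm' m.+1 = (m.+1%:R^-1 : rat) *: ((symm' m ⊠ idm X) ∘ cycsum' m).
Proof. by []. Qed.

Lemma cycsumE m : \sum_(k < m.+1) cyc X m k = cycsum m.
Proof.
elim: m => [|m IHm]; first by rewrite big_ord_recl big_ord0 addr0.
rewrite big_ord_recr /= last_swapE ltnn addrC; congr (_ + _).
rewrite -IHm tens_suml comp_suml; apply: eq_bigr => k _.
by rewrite -ltnS ltn_ord.
Qed.

Lemma symmetrizer0 : e 0 = idm _.
Proof.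
rewrite /symmetrizer fact0 invr1 scale1r (big_pred1 1%g) // => s.
by apply/esym/eqP/permP; case.
Qed.

Lemma perm_rest_lift n (k : 'I_n.+1) (t : 'S_n) : perm_rest (lift_perm ord_max k t) = t.
Proof.
apply/permP=> j; apply: (@lift_inj _ k).
rewrite -(lift_perm_lift ord_max k t j) -{2}(perm_restK (lift_perm ord_max k t)).
by rewrite lift_perm_lift lift_perm_id.
Qed.

(** A permutation amounts to the image k of the last index and the permutation induced on the other
    indices; [perm_act] is defined along this bijection. *)
Lemma symmetrizerS m :
  e m.+1 = (m.+1%:R^-1 : rat) *: (cycsum m ∘ (e m ⊠ idm X)).
Proof.
rewrite /symmetrizer tensZl compZr scalerA -cycsumE factS natrM invfM mulrC.
congr (_ *: _); rewrite tens_suml comp_suml.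
rewrite (reindex (fun p : 'I_m.+1 * 'S_m => lift_perm ord_max p.1 p.2)) /=; last first.
  exists (fun s : 'S_m.+1 => (s ord_max, perm_rest s)) => [[k t] _|s _] /=.
    by rewrite lift_perm_id perm_rest_lift.
  exact: perm_restK.
rewrite -(pair_bigA _ (fun k t => cyc X m (lift_perm ord_max k t ord_max)
  ∘ (perm_act X (perm_rest (lift_perm ord_max k t)) ⊠ idm X))) /=.
apply: eq_bigr => k _; rewrite comp_sumr; apply: eq_bigr => t _.
by rewrite lift_perm_id perm_rest_lift.
Qed.

Lemma sg_comm m (f : Mor (tpow X m) (tpow X m)) :
  sg m ∘ ((f ⊠ idm X) ⊠ idm X) = ((f ⊠ idm X) ⊠ idm X) ∘ sg m.
Proof. by rewrite last_swapE swap_last_nat. Qed.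

Lemma cycsum_absorb m : cycsum m.+1 ∘ (cycsum m ⊠ idm X) ∘ sg m =
  cycsum m.+1 ∘ (cycsum m ⊠ idm X).
Proof.
elim: m => [|m IHm].
  rewrite /= !tensm1 !compm1 !comp1m compDl comp1m. rewrite (last_swapK 0) addrC; congr (_ + _).
have := @braid_absorb (Endo (tpow X m.+3)) ((cycsum m ⊠ idm X) ⊠ idm X)
  (sg m ⊠ idm X) (sg m.+1) (last_swapK _) (last_swap_braid _)
  (@sg_comm m.+1 (cycsum m)).
rewrite /GRing.mul /= => H; rewrite tensDl rcomp tensm1; refine (H _).
have := congr1 (fun f => f ⊠ idm X) IHm.
by rewrite 2!rcomp [cycsum m.+1]/= tensDl rcomp tensm1.
Qed.

Lemma cycsum_absorb' m :
  sg m ∘ ((cycsum' m ⊠ idm X) ∘ cycsum' m.+1) = (cycsum' m ⊠ idm X) ∘ cycsum' m.+1.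
Proof.
elim: m => [|m IHm].
  by rewrite /= !tensm1 !compm1 !comp1m compDr compm1 (last_swapK 0) addrC.
(* The opposite ring reverses all products, as required for [cycsum']. *)
have := @braid_absorb (Endo (tpow X m.+3))^c ((cycsum' m ⊠ idm X) ⊠ idm X)
  (sg m ⊠ idm X) (sg m.+1) (last_swapK _).
rewrite /GRing.mul /= /GRing.mul /= => H.
rewrite tensDl rcomp tensm1; refine (H _ _ _).
- by rewrite compA last_swap_braid -compA.
- by rewrite (@sg_comm m.+1 (cycsum' m)).
have := congr1 (fun f => f ⊠ idm X) IHm.
by rewrite (rcomp _ (sg m)) (rcomp _ (cycsum' m ⊠ _)) [cycsum' m.+1]/= tensDl (rcomp _
  (sg m)) tensm1.
Qed.

Lemma symmetrizer_sg m : e m.+2 ∘ sg m = e m.+2.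
Proof.
rewrite symmetrizerS compZl; congr (_ *: _).
rewrite symmetrizerS tensZl compZr compZl; congr (_ *: _).
by rewrite rcomp -!compA -sg_comm !compA cycsum_absorb.
Qed.

Lemma sg_symm' m : sg m ∘ symm' m.+2 = symm' m.+2.
Proof.
rewrite !symm'S compZr; congr (_ *: _); rewrite !tensZl !compZl !compZr; congr (_ *: _).
by rewrite rcomp -!compA [sg m ∘ _]compA sg_comm -!compA cycsum_absorb'.
Qed.

Lemma natS_neq0 m : (m.+1%:R : rat) != 0.
Proof. by rewrite pnatr_eq0. Qed.

(** Invariance of [symm'] under transpositions on the left shows that [e m] fixes it. As
    [symm_absorb'] evaluates the same composite to [e m], the two symmetrizers agree. *)
Lemma symm'_absorb m : cycsum m ∘ symm' m.+1 = m.+1%:R *: symm' m.+1 /\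
  e m ∘ symm' m = symm' m.
Proof.
elim: m => [|m [IH1 IH2]]; first by rewrite symmetrizer0 !comp1m scale1r.
have E : (e m.+1 ∘ symm' m.+1 = symm' m.+1).
  rewrite symmetrizerS compZl -compA.
  have -> : (e m ⊠ idm X) ∘ symm' m.+1 = symm' m.+1.
    by rewrite symm'S compZr compA -rcomp IH2.
  by rewrite IH1 scalerA mulVf ?scale1r ?natS_neq0.
split=> //; rewrite [cycsum _]/= compDl comp1m -compA sg_symm'.
have -> : (cycsum m ⊠ idm X) ∘ symm' m.+2 = m.+1%:R *: symm' m.+2.
  by rewrite symm'S compZr compA -rcomp IH1 tensZl compZl scalerA mulrC -scalerA.
by rewrite -[X in X + _ = _]scale1r -scalerDl nat1r.
Qed.

Lemma symm_absorb' m : e m.+1 ∘ cycsum' m = m.+1%:R *: e m.+1 /\ e m ∘ symm' m = e m.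
Proof.
elim: m => [|m [IH1 IH2]]; first by rewrite symmetrizer0 !compm1 scale1r.
have E : (e m.+1 ∘ symm' m.+1 = e m.+1).
  rewrite symm'S compZr compA.
  have -> : e m.+1 ∘ (symm' m ⊠ idm X) = e m.+1.
    by rewrite symmetrizerS compZl -compA -rcomp IH2.
  by rewrite IH1 scalerA mulVf ?scale1r ?natS_neq0.
split=> //; rewrite [cycsum' _]/= compDr compm1 compA symmetrizer_sg.
have -> : e m.+2 ∘ (cycsum' m ⊠ idm X) = m.+1%:R *: e m.+2.
  by rewrite [e m.+2]symmetrizerS compZl -compA -rcomp IH1 tensZl compZr scalerA mulrC -scalerA.
by rewrite -[X in X + _ = _]scale1r -scalerDl nat1r.
Qed.

Lemma symmetrizer_alt m : e m = symm' m.
Proof. by rewrite -(symm_absorb' m).2 (symm'_absorb m).2. Qed.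

Lemma symmetrizer_idem m : e m ∘ e m = e m.
Proof. by rewrite {2}symmetrizer_alt (symm_absorb' m).2. Qed.

Lemma sg_symmetrizer m : sg m ∘ e m.+2 = e m.+2.
Proof. by rewrite symmetrizer_alt sg_symm'. Qed.

Lemma symmetrizerS_l m : e m.+1 ∘ (e m ⊠ idm X) = e m.+1.
Proof. by rewrite symmetrizerS compZl -compA -rcomp symmetrizer_idem. Qed.

Lemma symmetrizerS_r m : (e m ⊠ idm X) ∘ e m.+1 = e m.+1.
Proof.
by rewrite (symmetrizer_alt m.+1) symm'S compZr compA -rcomp -symmetrizer_alt symmetrizer_idem.
Qed.

Lemma symmetrizer_cycsum m : e m.+1 ∘ cycsum m = m.+1%:R *: e m.+1.
Proof.
elim: m => [|m IHm]; first by rewrite compm1 scale1r.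
have E : e m.+2 ∘ (cycsum m ⊠ idm X) = m.+1%:R *: e m.+2.
  by rewrite -[in LHS](symmetrizerS_l m.+1) -compA -rcomp IHm tensZl compZr symmetrizerS_l.
rewrite /= compDr compm1 compA E compZl symmetrizer_sg.
by rewrite -[X in X + _ = _]scale1r -scalerDl nat1r.
Qed.

(** There are two double cosets of ['S_m.+1] in ['S_m.+2], those of the identity and of the last
    transposition, with relative sizes 1 and m.+1. *)
Lemma symmetrizerSS m : e m.+2 = (m.+2%:R^-1 : rat) *:
  ((e m.+1 ⊠ idm X) + m.+1%:R *: ((e m.+1 ⊠ idm X) ∘ sg m ∘ (e m.+1 ⊠ idm X))).
Proof.
rewrite -[LHS]symmetrizerS_r (symmetrizerS m.+1) compZr; congr (_ *: _).
rewrite [cycsum _]/= compDl comp1m compDr -(rcomp _ (e m.+1) (e m.+1)).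
rewrite (symmetrizer_idem m.+1); congr (_ + _).
rewrite !compA -(rcomp _ (e m.+1) (cycsum m)) symmetrizer_cycsum tensZl.
by rewrite !compZl.
Qed.
End Symmetrizer.

Section Ext.
Context {C : closedSymMonCat}.
Implicit Types X Y Z T : C.
(** An arbitrary [z] gives every composite a right end, which the [compmn] lemmas behind [rw0]
    expect. *)
Lemma mor_ext X Y (f g : Mor X Y) : (forall S (z : Mor S X), f ∘ z = g ∘ z) -> f = g.
Proof. by move=> fg; rewrite -[f]compm1 -[g]compm1 fg. Qed.
End Ext.

(** * Symmetric powers *)

Section Fock.
Context {C : rigidCat}.
Implicit Types X Y Z T : C.
Local Notation S n X := (SymPow n X).

Lemma symiK n X : symp n X ∘ symi n X = idm _.
Proof. exact: (im_split (symmetrizer_idem X n)).2. Qed.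
Lemma sympK n X : symi n X ∘ symp n X = symmetrizer X n.
Proof. exact: (im_split (symmetrizer_idem X n)).1. Qed.
Lemma symmetrizer_symi n X : symmetrizer X n ∘ symi n X = symi n X.
Proof. by rewrite -sympK -compA symiK compm1. Qed.
Lemma symp_symmetrizer n X : symp n X ∘ symmetrizer X n = symp n X.
Proof. by rewrite -sympK compA symiK comp1m. Qed.
Lemma sympK0 X : symi 0 X ∘ symp 0 X = idm _.
Proof. by rewrite sympK symmetrizer0. Qed.

(* Creation and annihilation operators, normalised by [mu ∘ nu = 1]; [nu_mu] is
   their commutation relation. *)
Definition mu n X : Mor (S n X ⊗ X) (S n.+1 X) :=
  locked_with str_key (symp n.+1 X ∘ (symi n X ⊠ idm X)).
Definition nu n X : Mor (S n.+1 X) (S n X ⊗ X) :=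
  locked_with str_key ((symp n X ⊠ idm X) ∘ symi n.+1 X).
Lemma muE n X : mu n X = symp n.+1 X ∘ (symi n X ⊠ idm X).
Proof. by rewrite /mu unlock. Qed.
Lemma nuE n X : nu n X = (symp n X ⊠ idm X) ∘ symi n.+1 X.
Proof. by rewrite /nu unlock. Qed.

Lemma symp_absorb n X : symp n.+1 X ∘ (symmetrizer X n ⊠ idm X) = symp n.+1 X.
Proof. by rewrite -symp_symmetrizer -compA symmetrizerS_l. Qed.
Lemma symi_absorb n X : (symmetrizer X n ⊠ idm X) ∘ symi n.+1 X = symi n.+1 X.
Proof. by rewrite -symmetrizer_symi compA symmetrizerS_r. Qed.

Lemma mu_nu n X : mu n X ∘ nu n X = idm _.
Proof.
by rewrite muE nuE -compA (compA _ _ (symi _ _)) -rcomp sympK symi_absorb symiK.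
Qed.
Lemma symi_nu n X : (symi n X ⊠ idm X) ∘ nu n X = symi n.+1 X.
Proof. by rewrite nuE compA -rcomp sympK symi_absorb. Qed.
Lemma mu_symp n X : mu n X ∘ (symp n X ⊠ idm X) = symp n.+1 X.
Proof. by rewrite muE -compA -rcomp sympK symp_absorb. Qed.

Lemma mu_mu n X : mu n.+1 X ∘ (mu n X ⊠ idm X) = symp n.+2 X ∘ ((symi n X ⊠ idm X) ⊠ idm X).
Proof. by rewrite [mu n X]muE rcomp compA mu_symp. Qed.
Lemma nu_nu n X : (nu n X ⊠ idm X) ∘ nu n.+1 X = ((symp n X ⊠ idm X) ⊠ idm X) ∘ symi n.+2 X.
Proof. by rewrite [nu n X]nuE rcomp -compA symi_nu. Qed.

Lemma mu_comm n X :
  mu n.+1 X ∘ (mu n X ⊠ idm X) ∘ swap_last (S n X) X X = mu n.+1 X ∘ (mu n X ⊠ idm X).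
Proof.
rewrite mu_mu -compA -swap_last_nat -last_swapE compA.
by rewrite -(symp_symmetrizer n.+2) -(compA _ _ (last_swap _ _)) symmetrizer_sg.
Qed.
Lemma nu_comm n X :
  swap_last (S n X) X X ∘ ((nu n X ⊠ idm X) ∘ nu n.+1 X) = (nu n X ⊠ idm X) ∘ nu n.+1 X.
Proof.
rewrite nu_nu compA swap_last_nat -last_swapE -compA.
by rewrite -(symmetrizer_symi n.+2) (compA (last_swap _ _)) sg_symmetrizer.
Qed.

Lemma nu_mu0 X : nu 0 X ∘ mu 0 X = idm _.
Proof.
rewrite nuE muE compA -(compA _ _ (symp _ _)) sympK symmetrizerS symmetrizer0 tensm1.
by rewrite invr1 scale1r !compm1 -rcomp symiK tensm1.
Qed.

(** The two summands come from the two double cosets of [symmetrizerSS]. *)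
Lemma nu_mu n X : nu n.+1 X ∘ mu n.+1 X = (n.+2%:R^-1 : rat) *:
  (idm _ + n.+1%:R *: ((mu n X ⊠ idm X) ∘ swap_last (S n X) X X ∘ (nu n X ⊠ idm X))).
Proof.
rewrite nuE muE compA -(compA _ _ (symp _ _)) sympK symmetrizerSS.
rewrite compZr compZl compDr compDl; congr (_ *: (_ + _)).
  by rewrite -!rcomp (symp_symmetrizer n.+1 X) symiK tensm1.
have := swap_last_nat (symp n X) (idm X) (idm X); rewrite -(last_swapE X n).
move: (swap_last _ _ _) => s E; rewrite compZr compZl; congr (_ *: _).
rewrite -!compA -rcomp (symmetrizer_symi n.+1 X) !compA -rcomp (symp_symmetrizer n.+1 X).
rewrite nuE muE (rcomp X (symp n X ⊠ _)) (rcomp X (symp n.+1 X)) !compA; congr (_ ∘ _).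
rewrite -(compA _ s) E compA; congr (_ ∘ _).
by rewrite -compA -!rcomp sympK (symp_absorb n X).
Qed.

Lemma tmu_nu n X T : o21 (mu n X) T ∘ o12 (nu n X) T = idm _.
Proof.
have := congr1 (fun f => str f T) (mu_nu n X).
by rewrite (@str_comp _ _ (rtens (ratom _) (ratom _)) (ratom _)) str_id.
Qed.
Lemma tmu_comm n X T :
  o21 (mu n.+1 X) T ∘ (o21 (mu n X) (X ⊗ T) ∘ (S n X ◁ sw X X T)) =
  o21 (mu n.+1 X) T ∘ o21 (mu n X) (X ⊗ T).
Proof.
have := congr1 (fun f => str f T) (mu_comm n X).
have := str_swap_last (ratom (S n X)) (ratom X) (ratom X) T.
move: (swap_last _ _ _) => /= s sE.
by rewrite !(str_comp, str_rid) sE -compA.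
Qed.
Lemma tnu_comm n X T :
  (S n X ◁ sw X X T) ∘ (o12 (nu n X) (X ⊗ T) ∘ o12 (nu n.+1 X) T) =
  o12 (nu n X) (X ⊗ T) ∘ o12 (nu n.+1 X) T.
Proof.
have := congr1 (fun f => str f T) (nu_comm n X).
have := str_swap_last (ratom (S n X)) (ratom X) (ratom X) T.
move: (swap_last _ _ _) => /= s sE.
by rewrite !(str_comp, str_rid) sE.
Qed.
Lemma tnu_mu0 X T : o12 (nu 0 X) T ∘ o21 (mu 0 X) T = idm _.
Proof.
have := congr1 (fun f => str f T) (nu_mu0 X).
by rewrite (@str_comp _ (rtens (ratom _) (ratom _)) (ratom _)) str_id.
Qed.
Lemma tnu_mu n X T : o12 (nu n.+1 X) T ∘ o21 (mu n.+1 X) T = (n.+2%:R^-1 : rat) *: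
  (idm _ + n.+1%:R *: (o21 (mu n X) (X ⊗ T) ∘ ((S n X ◁ sw X X T) ∘ o12 (nu n X) (X ⊗ T)))).
Proof.
have := congr1 (fun f => str f T) (nu_mu n X).
have := str_swap_last (ratom (S n X)) (ratom X) (ratom X) T.
move: (swap_last _ _ _) => /= s sE.
rewrite (@str_comp _ (rtens (ratom _) (ratom _)) (ratom _)).
by rewrite strZ strD strZ str_id !(str_comp, str_rid) sE -compA.
Qed.

Lemma tcast_id X n : tcast X n n = idm _.
Proof. by rewrite /tcast; case: eqP => // e; rewrite (eq_axiomK e). Qed.

Lemma mulSE X j k : mulS X j k (k + j) = symp _ X ∘ tcat X j k ∘ (symi j X ⊠ symi k X).
Proof. by rewrite /mulS tcast_id compm1. Qed.

Lemma tcat_last_swap X j k :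
  tcat X j k.+2 ∘ (tpow X j ◁ last_swap X k) = last_swap X (k + j) ∘ tcat X j k.+2.
Proof.
rewrite /= !last_swapE.
have := str_swap_last (ratom (tpow X k)) (ratom X) (ratom X).
have := str_swap_last (ratom (tpow X (k + j))) (ratom X) (ratom X).
move: (swap_last _ _ _) (swap_last _ _ _) (tcat X j k) => /= s t u sE tE; apply: str_inj.
rewrite !(str_comp, str_rid, str_lid, str_ascV) sE tE /= !compm1.
exact: (o21_nat u).
Qed.

Lemma tcat_S X j k (f : Mor (tpow X k) (tpow X k)) :
  tcat X j k.+1 ∘ (tpow X j ◁ (f ⊠ idm X)) =
  ((tcat X j k ∘ (tpow X j ◁ f)) ⊠ idm X) ∘ ascV (tpow X j) (tpow X k) X.
Proof. by rewrite /= -compA ascV_nat rcomp compA. Qed.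

Lemma symmetrizer_tcatS X j k (a : rat) (f : Mor (tpow X k) (tpow X k)) :
  symmetrizer X (k + j) ∘ (tcat X j k ∘ (tpow X j ◁ f)) =
    a *: (symmetrizer X (k + j) ∘ tcat X j k) ->
  symmetrizer X (k.+1 + j) ∘ (tcat X j k.+1 ∘ (tpow X j ◁ (f ⊠ idm X))) =
  a *: (symmetrizer X (k.+1 + j) ∘ tcat X j k.+1).
Proof.
move=> H; rewrite tcat_S -[in LHS](symmetrizerS_l X (k + j)) -!compA.
rewrite (compA _ _ (ascV _ _ _)) -rcomp H tensZl (compZl a) (compZr a); congr (_ *: _).
rewrite [tcat X j k.+1]/= rcomp -(compA (symmetrizer _ _ ⊠ _)).
exact: (comp21 (symmetrizerS_l X (k + j))).
Qed.

Lemma symmetrizer_tcat_cyc X j k :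
  symmetrizer X (k.+1 + j) ∘ (tcat X j k.+1 ∘ (tpow X j ◁ cycsum' X k)) =
  k.+1%:R *: (symmetrizer X (k.+1 + j) ∘ tcat X j k.+1).
Proof.
elim: k => [|k IHk]; first by rewrite /cycsum' tensm1 compm1 scale1r.
have E : symmetrizer X (k.+2 + j) ∘
    (tcat X j k.+2 ∘ (tpow X j ◁ (last_swap X k ∘ (cycsum' X k ⊠ idm X)))) =
  symmetrizer X (k.+2 + j) ∘ (tcat X j k.+2 ∘ (tpow X j ◁ (cycsum' X k ⊠ idm X))).
  rewrite lcomp (compA (tcat _ _ _)) tcat_last_swap -compA.
  exact: (comp21 (symmetrizer_sg X (k + j))).
rewrite [cycsum' _ _]/= tensDr !compDr tensm1 compm1 E (symmetrizer_tcatS IHk).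
by rewrite -[X in X + _ = _]scale1r -scalerDl nat1r.
Qed.

(** The permutations of the last k factors are absorbed by the full symmetrizer. The right factor is
    expanded as in [symm']: its first factor is absorbed by the induction hypothesis, then [cycsum']
    by [symmetrizer_tcat_cyc]. *)
Lemma symmetrizer_tcat X j k :
  symmetrizer X (k + j) ∘ (tcat X j k ∘ (tpow X j ◁ symmetrizer X k)) =
  symmetrizer X (k + j) ∘ tcat X j k.
Proof.
elim: k => [|k IHk]; first by rewrite symmetrizer0 tensm1 compm1.
rewrite [symmetrizer X k.+1]symmetrizer_alt symm'S -symmetrizer_alt.
have H := symmetrizer_tcatS (etrans IHk (esym (scale1r _))); rewrite scale1r in H.
rewrite tensZr lcomp (compZr _ (tcat _ _ _)) (compZr _ (symmetrizer _ _)).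
rewrite (compA (tcat _ _ _)) (compA (symmetrizer _ _)) H -compA.
by rewrite symmetrizer_tcat_cyc scalerA mulVf ?scale1r ?natS_neq0.
Qed.

Lemma symp_tcat X j k :
  symp (k + j) X ∘ (tcat X j k ∘ (tpow X j ◁ symmetrizer X k)) = symp (k + j) X ∘ tcat X j k.
Proof.
by rewrite -symp_symmetrizer -!(compA (symp _ _)) symmetrizer_tcat.
Qed.

Lemma symi_mu k X : symi k.+1 X ∘ mu k X = symmetrizer X k.+1 ∘ (symi k X ⊠ idm X).
Proof. by rewrite muE compA sympK. Qed.

(** Together with [mulS_0] this determines the product by recursion on its right factor;
    associativity, commutativity and the Leibniz rule are derived from these two rules. *)
Lemma mulS_S X j k n : n = (k + j)%N ->
  mulS X j k.+1 n.+1 ∘ ((S j X ◁ mu k X) ∘ asc (S j X) (S k X) X) =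
  mu n X ∘ (mulS X j k n ⊠ idm X).
Proof.
move=> ->; rewrite (mulSE X j k.+1) (mulSE X j k).
have -> : (symp (k + j) X ∘ tcat X j k ∘ (symi j X ⊠ symi k X)) ⊠ idm X =
  (symp (k + j) X ⊠ idm X) ∘ ((tcat X j k ⊠ idm X) ∘ ((symi j X ⊠ symi k X) ⊠ idm X)).
  by rewrite rcomp (rcomp _ (symp _ _)) compA.
rewrite (compA (mu _ _)) mu_symp.
rewrite (compA _ (_ ◁ _)) -(compA _ (symi _ _ ⊠ _)) -tensm_comp compm1 symi_mu.
rewrite -[symi j X in LHS]comp1m tensm_comp (compA _ (_ ◁ _)) -(compA (symp _ _)) symp_tcat.
rewrite -!compA; congr (_ ∘ (_ ∘ _)).
by rewrite compA ascV_nat -compA ascK compm1.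
Qed.

Lemma mulS_0 X j : mulS X j 0 j ∘ (S j X ◁ symp 0 X) = run (S j X).
Proof.
rewrite (mulSE X j 0) -(compA _ (symi _ _ ⊠ _)) -tensm_comp compm1 sympK0.
rewrite [tcat _ _ _]/= -(compA (symp _ _)) run_nat.
by rewrite compA symiK comp1m.
Qed.

Lemma tmulS_S X j k n T : n = (k + j)%N ->
  o21 (mulS X j k.+1 n.+1) T ∘ (S j X ◁ o21 (mu k X) T) =
  o21 (mu n X) T ∘ o21 (mulS X j k n) (X ⊗ T).
Proof.
move=> /(mulS_S X); move: (mulS _ _ _ _) (mulS _ _ _ _) => p q.
move/(congr1 (fun f => str f T)); rewrite !(str_comp, str_rid, str_lid) /=.
by rewrite (@str_asc _ (ratom _) (ratom _) (ratom _)) compm1.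
Qed.

Lemma tmulS_0 X j T : o21 (mulS X j 0 j) T ∘ (S j X ◁ o01 (symp 0 X) T) = idm _.
Proof.
have := mulS_0 X j; move: (mulS _ _ _ _) => p.
move/(congr1 (fun f => @str C (rtens (ratom _) runit) (ratom _) f T)).
rewrite (str_run (ratom (S j X))) => <-.
by rewrite (@str_comp _ (rtens (ratom _) runit) (rtens (ratom _) (ratom _)) (ratom _)) str_lid.
Qed.

Lemma tsymK0 X T : o01 (symp 0 X) T ∘ o10 (symi 0 X) T = idm _.
Proof.
have := congr1 (fun f => str f T) (symiK 0 X).
by rewrite (@str_comp _ (ratom _) runit (ratom _)) (@str_id _ (ratom _)).
Qed.

(** [mu] is split by [nu], so identities on a symmetric power of positive degree can be tested after
    [mu]. With [unit_epi] in degree 0, this is how inductions on the degree are run. *)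
Lemma mu_epi n X Y T (f g : Mor (S n.+1 X ⊗ T) Y) :
  f ∘ o21 (mu n X) T = g ∘ o21 (mu n X) T -> f = g.
Proof. exact: cancel_epi (tmu_nu n X T). Qed.
Lemma mu_epi1 n X Y Z T (f g : Mor (Z ⊗ (S n.+1 X ⊗ T)) Y) :
  f ∘ (Z ◁ o21 (mu n X) T) = g ∘ (Z ◁ o21 (mu n X) T) -> f = g.
Proof. exact: cancel_epi (ltens20 _ (tmu_nu n X T)). Qed.
Lemma mu_epi2 n X Y Z W T (f g : Mor (Z ⊗ (W ⊗ (S n.+1 X ⊗ T))) Y) :
  f ∘ (Z ◁ W ◁ o21 (mu n X) T) = g ∘ (Z ◁ W ◁ o21 (mu n X) T) -> f = g.
Proof. exact: cancel_epi (ltens20 _ (ltens20 _ (tmu_nu n X T))). Qed.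
Lemma unit_epi X Y T (f g : Mor (S 0 X ⊗ T) Y) :
  f ∘ o01 (symp 0 X) T = g ∘ o01 (symp 0 X) T -> f = g.
Proof. exact: cancel_epi (tsymK0 X T). Qed.
Lemma unit_epi1 X Y Z T (f g : Mor (Z ⊗ (S 0 X ⊗ T)) Y) :
  f ∘ (Z ◁ o01 (symp 0 X) T) = g ∘ (Z ◁ o01 (symp 0 X) T) -> f = g.
Proof. exact: cancel_epi (ltens20 _ (tsymK0 X T)). Qed.
Lemma unit_epi2 X Y Z W T (f g : Mor (Z ⊗ (W ⊗ (S 0 X ⊗ T))) Y) :
  f ∘ (Z ◁ W ◁ o01 (symp 0 X) T) = g ∘ (Z ◁ W ◁ o01 (symp 0 X) T) -> f = g.
Proof. exact: cancel_epi (ltens20 _ (ltens20 _ (tsymK0 X T))). Qed.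

Lemma tmulS_assoc X j k l m n N T : m = (k + j)%N -> n = (l + k)%N -> N = (n + j)%N ->
  o21 (mulS X m l N) T ∘ o21 (mulS X j k m) (S l X ⊗ T) =
  o21 (mulS X j n N) T ∘ (S j X ◁ o21 (mulS X k l n) T).
Proof.
move=> Em; elim: l n N T => [|l IHl] n N T.
  move=> En EN; have {}En : n = k by [].
  subst n; have {}EN : N = m by rewrite EN Em.
  subst N; apply: unit_epi2; apply: mor_ext => Z z; rewrite -!compA.
  by rw0 (o21_nat _ _); rw0 (tmulS_0 _ _ _); rw1 (tmulS_0 _ _ _).
case: n => [|n] //; case: N => [|N] //; rewrite !addSn => -[En] -[EN].
have EN' : N = (l + m)%N by rewrite EN En Em addnA.
apply: mu_epi2; apply: mor_ext => Z z; rewrite -!compA.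
rw0 (o21_nat _ _); rw0 (tmulS_S _ _ EN'); rw1 (tmulS_S _ _ En); rw0 (tmulS_S _ _ EN).
by rw0 (IHl _ _ _ En EN).
Qed.

Lemma sw_o01 X W (f : Mor tunit X) T : sw W X T ∘ (W ◁ o01 f T) = o01 f (W ⊗ T).
Proof. by rewrite -o01_sw compA swK comp1m. Qed.

Lemma tmulS_0l X k T : o21 (mulS X 0 k k) T ∘ o01 (symp 0 X) (S k X ⊗ T) = idm _.
Proof.
elim: k T => [|k IHk] T.
  apply: unit_epi; apply: mor_ext => Z z; rewrite -!compA.
  by rw0 (o01_nat _ _); rw0 (tmulS_0 _ _ _); rewrite comp1m.
apply: mu_epi; apply: mor_ext => Z z; rewrite -!compA comp1m.
rw0 (o01_nat _ _); rw0 (tmulS_S X T (esym (addn0 k))).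
by rw0 (IHk _).
Qed.

(** In elements (x v) y = (x y) v; this lets commutativity be proved by induction on the right
    factor. *)
Lemma tmulS_rcomm X k j n T : n = (j + k)%N ->
  o21 (mulS X k.+1 j n.+1) T ∘ o21 (mu k X) (S j X ⊗ T) =
  o21 (mu n X) T ∘ (o21 (mulS X k j n) (X ⊗ T) ∘ (S k X ◁ sw X (S j X) T)).
Proof.
elim: j n T => [|j IHj] n T.
  move=> ->; apply: unit_epi2; apply: mor_ext => Z z; rewrite -!compA.
  rw0 (o21_nat _ _); rw0 (tmulS_0 _ _ _).
  by rw1 (sw_o01 _ _ _); rw0 (tmulS_0 _ _ _).
case: n => [|n] //; rewrite addSn => -[En].
have En' : n.+1 = (j + k.+1)%N by rewrite addnS En.
apply: mu_epi2; apply: mor_ext => Z z; rewrite -!compA.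
rw0 (o21_nat _ _); rw0 (tmulS_S _ _ En'); rw0 (IHj _ _ En).
rw1 (esym (sw_o21 _ _ _)); rw0 (tmulS_S _ _ En).
by rw0 (o21_nat _ _); rw0 (tmu_comm _ _ _).
Qed.

Lemma tmulS_comm X j k n T : n = (k + j)%N ->
  o21 (mulS X k j n) T ∘ sw (S j X) (S k X) T = o21 (mulS X j k n) T.
Proof.
elim: k n T => [|k IHk] n T.
  move=> ->; apply: unit_epi1; apply: mor_ext => Z z; rewrite -!compA.
  by rw0 (sw_o01 _ _ _); rw0 (tmulS_0l _ _ _); rw0 (tmulS_0 _ _ _).
case: n => [|n] //; rewrite addSn => -[En].
apply: mu_epi1; apply: mor_ext => Z z; rewrite -!compA.
rw0 (tmulS_S _ _ En); rw0 (esym (IHk _ _ En)).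
rw0 (esym (sw_o21 _ _ _)); rw0 (tmulS_rcomm X T (etrans En (addnC k j))).
by rw1 (swK _ _ _).
Qed.

Lemma tnu_muE n X T Z (z : Mor Z (S n.+1 X ⊗ (X ⊗ T))) :
  n.+2%:R *: (o12 (nu n.+1 X) T ∘ (o21 (mu n.+1 X) T ∘ z)) =
  z + n.+1%:R *: (o21 (mu n X) (X ⊗ T) ∘ ((S n X ◁ sw X X T) ∘ (o12 (nu n X) (X ⊗ T) ∘ z))).
Proof.
rewrite compA tnu_mu compZl scalerA mulfV ?scale1r ?natS_neq0 //.
by rewrite compDl compZl comp1m -!compA.
Qed.
Lemma tnu_muE1 n X W T Z (z : Mor Z (W ⊗ (S n.+1 X ⊗ (X ⊗ T)))) :
  n.+2%:R *: ((W ◁ o12 (nu n.+1 X) T) ∘ ((W ◁ o21 (mu n.+1 X) T) ∘ z)) =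
  z + n.+1%:R *: ((W ◁ o21 (mu n X) (X ⊗ T)) ∘
    ((W ◁ S n X ◁ sw X X T) ∘ ((W ◁ o12 (nu n X) (X ⊗ T)) ∘ z))).
Proof.
rewrite compA -lcomp tnu_mu tensZr compZl scalerA mulfV ?scale1r ?natS_neq0 //.
by rewrite tensDr tensZr compDl compZl tensm1 comp1m !lcomp -!compA.
Qed.

(** The Leibniz term in which the letter is taken from the right factor; it vanishes in degree 0,
    where there is no letter to take. *)
Definition nu_right X j k N T : Mor (S j.+1 X ⊗ (S k X ⊗ T)) (S N X ⊗ (X ⊗ T)) :=
  if k is k'.+1 then
    k'.+1%:R *: (o21 (mulS X j.+1 k' N) (X ⊗ T) ∘ (S j.+1 X ◁ o12 (nu k' X) T))
  else 0.

(** Leibniz rule. [nu] is normalised by [mu ∘ nu = 1], so only its multiple by the degree is a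
    derivation; hence the three integer coefficients. *)
Lemma tnu_mulS X j k N T : N = (k + j)%N ->
  N.+1%:R *: (o12 (nu N X) T ∘ o21 (mulS X j.+1 k N.+1) T) =
  (j.+1%:R *: (o21 (mulS X j k N) (X ⊗ T) ∘ ((S j X ◁ sw X (S k X) T) ∘
    o12 (nu j X) (S k X ⊗ T))))
  + nu_right X j k N T.
Proof.
elim: k N T => [|k IHk] N T.
  move=> ->; apply: unit_epi1; rewrite addr0; apply: mor_ext => Z z.
  rewrite !compZl -!compA; congr (_ *: _).
  rw0 (tmulS_0 _ _ _).
  by rw0 (o12_nat _ _); rw1 (sw_o01 _ _ _); rw0 (tmulS_0 _ _ _).
case: N => [|N] //; rewrite addSn => -[EN].
have EN' : N.+1 = (k + j.+1)%N by rewrite addnS EN.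
apply: mu_epi1; apply: mor_ext => Z z; rewrite compDl !compZl compDl !compZl -!compA.
rw0 (tmulS_S _ _ EN').
rewrite tnu_muE.
have {IHk} := congr1 (fun f => o21 (mu N X) (X ⊗ T) ∘ ((S N X ◁ sw X X T) ∘ (f ∘
  z))) (IHk _ (X ⊗ T) EN).
rewrite !(compDr, compDl, compZr, compZl) -!compA => ->.
rw0 (o12_nat _ _); rw1 (esym (sw_o21 _ _ _)); rw0 (tmulS_S _ _ EN); rw0 (o21_nat _ _).
rewrite addrCA; congr (_ + _).
case: k EN EN' Z z => [|k] EN EN' Z z; rewrite /nu_right /= ?compZl -?compA.
  by rw1 (tnu_mu0 _ _); rewrite comp0l !comp0r addr0 scale1r.
rewrite -(compZr (k.+2%:R)) tnu_muE1 compDr compZr.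
congr (_ + _); rewrite !compZr; congr (_ *: _).
case: N EN EN' Z z => [|N] //; rewrite addSn => -[EN] _ Z z.
have EN' : N.+1 = (k + j.+1)%N by rewrite addnS EN.
by rw0 (tmulS_S _ _ EN'); rw0 (o21_nat _ _).
Qed.
End Fock.

(** * Scalars and dual pairs *)

Section Scalars.
Context {C : closedSymMonCat}.
Implicit Types (X Y Z T W : C) (s t : Endo (@tunit C)).

Lemma escaleE s X Y (f : Mor X Y) : escale s f = escale s (idm Y) ∘ f.
Proof.
by rewrite /escale -!compA lunV_nat (compA (_ ⊠ _)) -tensm_comp compm1 comp1m.
Qed.
Lemma escaleEr s X Y (f : Mor X Y) : escale s f = f ∘ escale s (idm X).
Proof. by rewrite /escale !compA -lun_nat -(compA _ (_ ◁ _)) -tensm_comp compm1 comp1m. Qed.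
Lemma str_scalar s T : @str C runit runit s T = escale s (idm T).
Proof. by rewrite strE. Qed.
Lemma escale_compr s X Y Z (g : Mor Y Z) (f : Mor X Y) : g ∘ escale s f = escale s (g ∘ f).
Proof. by rewrite (escaleEr s f) (escaleEr s (g ∘ f)) compA. Qed.
Lemma escale_compl s X Y Z (g : Mor Y Z) (f : Mor X Y) : escale s g ∘ f = escale s (g ∘ f).
Proof. by rewrite (escaleE s g) (escaleE s (g ∘ f)) compA. Qed.
Lemma escale_l s W X Y (f : Mor X Y) : W ◁ escale s f = escale s (W ◁ f).
Proof.
rewrite escaleE lcomp [RHS]escaleE; congr (_ ∘ _).
rewrite -!str_scalar; have := @swp_str C runit runit (ratom W) s Y.
by rewrite !swp_unitl compm1 comp1m.
Qed.
Lemma str_escale s (a b : @robj C) (f : Mor (rob a) (rob b)) T :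
  str (escale s f) T = escale s (str f T).
Proof.
rewrite [RHS]escaleE -str_scalar /escale (@str_comp _ a (rtens runit a) b).
rewrite (@str_comp _ (rtens runit a) (rtens runit b) b) str_lun str_lunV comp1m compm1.
by rewrite str_tens.
Qed.
Lemma escale_r s W X Y (f : Mor X Y) : escale s f ⊠ idm W = escale s (f ⊠ idm W).
Proof.
apply: str_inj; rewrite str_rid
  (@str_escale s (rtens (ratom X) (ratom W)) (rtens (ratom Y) (ratom W))).
by rewrite (@str_escale s (ratom X) (ratom Y)) str_rid.
Qed.

Lemma escaleDl s t X Y (f : Mor X Y) : escale (s + t) f = escale s f + escale t f.
Proof. by rewrite /escale tensDl compDr compDl. Qed.
Lemma escaleZl (a : rat) s X Y (f : Mor X Y) : escale (a *: s) f = a *: escale s f.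
Proof. by rewrite /escale tensZl compZr compZl. Qed.
Lemma escaleDr s X Y (f g : Mor X Y) : escale s (f + g) = escale s f + escale s g.
Proof. by rewrite /escale tensDr compDr compDl. Qed.
Lemma escaleZr (a : rat) s X Y (f : Mor X Y) : escale s (a *: f) = a *: escale s f.
Proof. by rewrite /escale tensZr compZr compZl. Qed.
Lemma escale1 X Y (f : Mor X Y) : escale 1 f = f.
Proof. by rewrite /escale lun_nat -compA lunVK compm1. Qed.
Lemma escale_unit s : escale s (idm tunit) = s.
Proof. by rewrite /escale lunI run_nat -lunI -compA lunVK compm1. Qed.
Lemma escale_endo s t : escale s t = s * t.
Proof. by rewrite escaleE escale_unit. Qed.
Lemma escaleM s t X Y (f : Mor X Y) : escale (s * t) f = escale s (escale t f).
Proof.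
rewrite escaleE -str_scalar (@str_comp _ runit runit runit) !str_scalar.
by rewrite escale_compl comp1m escale_compl -escaleE.
Qed.
(** Eckmann-Hilton: [escale s t] is the composite of [s] and [t] in either order. *)
Lemma endoC s t : s * t = t * s.
Proof. by rewrite -[LHS]escale_endo escaleEr escale_unit. Qed.
End Scalars.

Section Dual.
Context {C : rigidCat}.
Implicit Types X Y Z T W : C.

Lemma invmK X Y (f : Mor X Y) : is_iso f -> invm f ∘ f = idm _ /\ f ∘ invm f = idm _.
Proof. by move=> [g gf]; apply: (xgetPex 0 (P := [set g | g ∘ f = _ /\ f ∘ g = _]%classic));
  exists g. Qed.

Lemma uncurry_inj T X Y (f g : Mor T (ihom X Y)) :
  evh X Y ∘ (f ⊠ idm X) = evh X Y ∘ (g ⊠ idm X) -> f = g.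
Proof. by move=> fg; rewrite -[f]uncurryK -[g]uncurryK fg. Qed.

Lemma uncurry_dual_inj T X (f g : Mor T (dual X)) :
  ev X ∘ (f ⊠ idm X) = ev X ∘ (g ⊠ idm X) -> f = g.
Proof. exact: uncurry_inj. Qed.

Definition coev X : Mor tunit (X ⊗ dual X) :=
  locked_with str_key (invm (alpha X X) ∘ curry (idm X ∘ lun X)).
Lemma coevE X : coev X = invm (alpha X X) ∘ curry (idm X ∘ lun X).
Proof. by rewrite /coev unlock. Qed.

Lemma rankE X : rank X = ev X ∘ swap X (dual X) ∘ coev X.
Proof. by rewrite coevE /rank /tr !compA. Qed.

Lemma coev_zigzag1 X : run X ∘ (X ◁ ev X) ∘ asc X (dual X) X ∘ (coev X ⊠ idm X) = lun X.
Proof.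
rewrite -[RHS]comp1m -[RHS]curryK -[curry _]comp1m -(invmK (alpha_iso X X)).2.
rewrite -(compA (alpha X X)) -coevE rcomp compA; congr (_ ∘ _).
by rewrite /alpha curryK.
Qed.

(** The triangle identities, stated for every tail so that they can be applied at any place of a
    word. *)
Definition dualpair A B (e : Mor (B ⊗ A) tunit) (c : Mor tunit (A ⊗ B)) : Prop :=
  (forall T, (A ◁ o20 e T) ∘ o02 c (A ⊗ T) = idm (A ⊗ T)) /\
  (forall T, o20 e (B ⊗ T) ∘ (B ◁ o02 c T) = idm (B ⊗ T)).

(** The first identity expresses that [coev] is the preimage of the identity under [alpha]. The
    second is tested after uncurrying, where it reduces to the first. *)
Lemma dualpair_ev X : dualpair (ev X) (coev X).
Proof.
have z1 T : (X ◁ o20 (ev X) T) ∘ o02 (coev X) (X ⊗ T) = idm (X ⊗ T).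
  have := congr1 (fun f => str f T) (coev_zigzag1 X).
  rewrite (str_lun (ratom X)) => <-.
  rewrite !str_comp (str_run (ratom X)) comp1m (@str_asc _ (ratom _) (ratom _) (ratom _)).
  by rewrite compm1 str_lid str_rid.
split=> // T.
pose phi : Mor (dual X) (dual X) :=
  lun (dual X) ∘ (ev X ⊠ idm (dual X)) ∘ ascV (dual X) X (dual X) ∘ (dual X ◁ coev X) ∘
    runV (dual X).
have phiE S : str phi S = o20 (ev X) (dual X ⊗ S) ∘ (dual X ◁ o02 (coev X) S).
  rewrite /phi !str_comp (str_lun (ratom _)) (str_runV (ratom _)) compm1 comp1m.
  by rewrite (@str_ascV _ (ratom _) (ratom _) (ratom _)) compm1 str_lid str_rid.
rewrite -phiE; suff -> : phi = idm _ by exact: (str_id (ratom _)).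
apply: uncurry_dual_inj; apply: str_inj; rewrite tensm1 compm1.
rewrite str_comp str_rid phiE; apply: mor_ext => Z z; rewrite -!compA.
rewrite -[str (ev X) _]/(o20 (ev X) _).
rw0 (esym (o20_nat _ _)). rw1 (z1 _).
by [].
Qed.

Lemma loop_rank X T :
  o20 (ev X) T ∘ (sw X (dual X) T ∘ o02 (coev X) T) = escale (rank X) (idm T).
Proof.
rewrite -str_scalar rankE.
rewrite (@str_comp _ runit (rtens (ratom _) (ratom _)) runit).
by rewrite (@str_comp _ (rtens (ratom _) (ratom _)) (rtens (ratom _) (ratom _)) runit) compA.
Qed.

Section DualPair.
Variables (A B : C) (e : Mor (B ⊗ A) tunit) (c : Mor tunit (A ⊗ B)).
Hypothesis ec : dualpair e c.

Lemma dual_inj S T (f g : Mor S (A ⊗ T)) :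
  o20 e T ∘ (B ◁ f) = o20 e T ∘ (B ◁ g) -> f = g.
Proof.
move=> fg; rewrite -[f]comp1m -[g]comp1m -!(ec.1 T) -!compA !o02_nat !compA -!lcomp.
by rewrite fg.
Qed.
(** The value of a closed loop does not depend on the dual chosen: a zigzag of the standard dual
    pair is inserted and the given pair is contracted. *)
Lemma loop_dualpair T :
  o20 e T ∘ (sw A B T ∘ o02 c T) = escale (rank A) (idm T).
Proof.
rewrite -loop_rank; apply: mor_ext => Z z; rewrite -!compA.
have [z1 _] := dualpair_ev A.
rewrite -[o02 c T ∘ z]comp1m; rw0 (esym (z1 _)).
rw0 (o02_nat _ _); rw0 (esym (sw_o20 _ _ _)).
rw0 (esym (o20_nat (ev A) (sw A B T))); rw0 (sw_nat _ _ _); rw1 (esym (sw_o02 _ _ _)).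
by rw0 (esym (o20_nat (ev A) (o20 e T))); rw1 (ec.1 _).
Qed.
End DualPair.

Lemma rank_iso (A A' : C) (f : Mor A A') : is_iso f -> rank A = rank A'.
Proof.
move=> [g [gf fg]]; have [z1 z2] := dualpair_ev A.
pose e := ev A ∘ (dual A ◁ g); pose c := (f ⊠ idm (dual A)) ∘ coev A.
have eE T : o20 e T = o20 (ev A) T ∘ (dual A ◁ o11 g T).
  by rewrite /o20 /e (@str_comp _ (rtens (ratom _) (ratom _)) (rtens (ratom _)
    (ratom _)) runit) str_lid.
have cE T : o02 c T = o11 f (dual A ⊗ T) ∘ o02 (coev A) T.
  by rewrite /o02 /c (@str_comp _ runit (rtens (ratom _) (ratom _)) (rtens (ratom _)
    (ratom _))) str_rid.
have ec : dualpair e c.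
  split=> T.
    rewrite eE cE; apply: mor_ext => Z z; rewrite lcomp -!compA.
    rw0 (esym (o11_nat f (dual A ◁ o11 g T))).
    rw0 (esym (o11_nat f (o20 (ev A) _))).
    rw0 (esym (o02_nat (coev A) (o11 g T))).
    rw0 (z1 _); rewrite compA -o11_comp fg o11_id.
    by [].
  rewrite eE cE; apply: mor_ext => Z z; rewrite lcomp -!compA.
  rw1 (esym (o11_comp g f _)); rewrite gf o11_id ltens1 !comp1m.
  by rw0 (z2 _).
rewrite -[LHS]escale_unit -[RHS]escale_unit.
rewrite -(loop_dualpair ec tunit) -loop_rank eE cE; apply: mor_ext => Z z; rewrite -!compA.
rw0 (esym (o11_sw _ _ _)); rw0 (esym (o11_comp g f _)); rewrite gf o11_id !comp1m.
by [].
Qed.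
End Dual.

(** * Pairing symmetric powers of dual objects *)

Section PairProd.
Context {C : closedSymMonCat}.
Implicit Types X Y Z T W : C.

Lemma interchange_nat X X' Y Y' Z Z' T T' (f : Mor X X') (g : Mor Y Y') (h : Mor Z Z')
  (k : Mor T T') :
  interchange X' Y' Z' T' ∘ ((f ⊠ g) ⊠ (h ⊠ k)) =
  ((f ⊠ h) ⊠ (g ⊠ k)) ∘ interchange X Y Z T.
Proof.
have mid : asc Z' Y' T' ∘ (swap Y' Z' ⊠ idm T') ∘ ascV Y' Z' T' ∘ (g ⊠ (h ⊠ k)) =
    (h ⊠ (g ⊠ k)) ∘ (asc Z Y T ∘ (swap Y Z ⊠ idm T) ∘ ascV Y Z T).
  rewrite -compA ascV_nat !compA; congr (_ ∘ _); rewrite -asc_nat -!compA; congr (_ ∘ _).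
  by rewrite -!tensm_comp swap_nat comp1m compm1.
rewrite /interchange -compA asc_nat compA -[in LHS](compA (ascV _ _ _)) -tensm_comp comp1m mid.
by rewrite -[f in LHS]compm1 tensm_comp compA ascV_nat !compA.
Qed.

Lemma str_interchange (a b c d : @robj C) T :
  str (interchange (rob a) (rob b) (rob c) (rob d)) T = rM a (swp b c (rF d T)).
Proof.
rewrite /interchange.
rewrite (@str_comp _ (rtens (rtens a b) (rtens c d)) (rtens a (rtens b (rtens c d))) (rtens
  (rtens a c) (rtens b d))).
rewrite (@str_comp _ (rtens a (rtens b (rtens c d))) (rtens a (rtens c (rtens b d))) (rtens
  (rtens a c) (rtens b d))).
rewrite (@str_asc _ a b (rtens c d)) compm1 (@str_ascV _ a c (rtens b d)) comp1m.
rewrite (@str_lid _ a (rtens b (rtens c d)) (rtens c (rtens b d))); congr (rM a _).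
rewrite (@str_comp _ (rtens b (rtens c d)) (rtens (rtens b c) d) (rtens c (rtens b d))).
rewrite (@str_comp _ (rtens (rtens b c) d) (rtens (rtens c b) d) (rtens c (rtens b d))).
by rewrite str_asc str_ascV comp1m compm1 (@str_rid _ d (rtens b c) (rtens c b)).
Qed.

Definition pairprod X Y Z T (p : Mor (X ⊗ Z) tunit) (q : Mor (Y ⊗ T) tunit) :
    Mor ((X ⊗ Y) ⊗ (Z ⊗ T)) tunit :=
  locked_with str_key (lun tunit ∘ (p ⊠ q) ∘ interchange X Y Z T).
Lemma pairprodE X Y Z T (p : Mor (X ⊗ Z) tunit) (q : Mor (Y ⊗ T) tunit) :
  pairprod p q = lun tunit ∘ (p ⊠ q) ∘ interchange X Y Z T.
Proof. by rewrite /pairprod unlock. Qed.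

Lemma pairprod_nat X X' Y Y' Z Z' T T' (f : Mor X X') (g : Mor Y Y') (h : Mor Z Z') (k : Mor T T')
    (p : Mor (X' ⊗ Z') tunit) (q : Mor (Y' ⊗ T') tunit) :
  pairprod p q ∘ ((f ⊠ g) ⊠ (h ⊠ k)) = pairprod (p ∘ (f ⊠ h)) (q ∘ (g ⊠ k)).
Proof. by rewrite !pairprodE -compA interchange_nat compA -(compA (lun _)) -tensm_comp. Qed.

Lemma str_pairprod (a b c d : @robj C) (p : Mor (rob a ⊗ rob c) tunit) (q : Mor
  (rob b ⊗ rob d) tunit) T :
  @str C (rtens (rtens a b) (rtens c d)) runit (pairprod p q) T =
  @str C (rtens a c) runit p T ∘ (rM a (rM c (@str C (rtens b d) runit q T)) ∘
    rM a (swp b c (rF d T))).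
Proof.
rewrite pairprodE (@str_comp _ _ (rtens (rtens a c) (rtens b d)) runit) str_interchange.
rewrite (@str_comp _ _ (rtens runit runit) runit) (str_lun runit) comp1m.
by rewrite (@str_tens _ (rtens a c) (rtens b d) runit runit) -compA.
Qed.

(** Transpositions are self-adjoint for the factorwise pairing: exchanging the two Y or the two T
    matches the same letters. *)
Lemma pairprod_swap X Y Z T (p : Mor (X ⊗ Z) tunit) (q : Mor (Y ⊗ T) tunit) :
  pairprod (pairprod p q) q ∘ (swap_last X Y Y ⊠ idm _) =
  pairprod (pairprod p q) q ∘ (idm _ ⊠ swap_last Z T T).
Proof.
have := str_swap_last (ratom X) (ratom Y) (ratom Y).
have := str_swap_last (ratom Z) (ratom T) (ratom T).
move: (swap_last _ _ _) (swap_last _ _ _) => /= s t sE tE; apply: str_inj.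
rewrite !(str_comp, str_rid, str_lid) sE tE /=.
rewrite (@str_pairprod (rtens (ratom X) (ratom Y)) (ratom Y) (rtens (ratom Z) (ratom T))
  (ratom T)).
rewrite str_pairprod swp_tensr /=.
apply: mor_ext => S z; rewrite !lcomp -!compA.
have swq V : o20 q (Y ⊗ V) ∘ (Y ◁ sw Y T V) = (Y ◁ o20 q V) ∘ sw Y Y (T ⊗ V).
  by rewrite -(sw_o20 Y q) -!compA swK compm1.
have qsw V : (T ◁ o20 q V) ∘ sw Y T (T ⊗ V) = o20 q (T ⊗ V) ∘ (Y ◁ sw T T V).
  rewrite (o20_sw T q); apply: mor_ext => R y; rewrite -!compA.
  by rw1 (swK T T V).
have G1 V : o20 q V ∘ ((Y ◁ T ◁ o20 q V) ∘ (Y ◁ sw Y T (T ⊗ V))) =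
  o20 q V ∘ ((Y ◁ o20 q (T ⊗ V)) ∘ sw Y Y (T ⊗ (T ⊗ V))).
  by rewrite -swq compA o20_nat -compA.
have G2 V : o20 q V ∘ ((Y ◁ T ◁ o20 q V) ∘ (Y ◁ sw Y T (T ⊗ V))) =
  o20 q V ∘ ((Y ◁ o20 q (T ⊗ V)) ∘ (Y ◁ Y ◁ sw T T V)).
  by rewrite -!lcomp qsw.
rewrite -!/(sw _ _ _) -!/(o20 q _).
have H R (y : Mor R (X ⊗ (Y ⊗ (Y ⊗ (Z ⊗ (T ⊗ (T ⊗ tunit))))))) :
  (X ◁ Z ◁ o20 q tunit) ∘ ((X ◁ sw Y Z (T ⊗ tunit)) ∘ ((X ◁ Y ◁ Z ◁ T ◁ o20 q tunit) ∘
     ((X ◁ Y ◁ Z ◁ sw Y T (T ⊗ tunit)) ∘ ((X ◁ Y ◁ sw Y Z (T ⊗ (T ⊗ tunit))) ∘ y)))) =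
  (X ◁ Z ◁ o20 q tunit) ∘ ((X ◁ Z ◁ Y ◁ T ◁ o20 q tunit) ∘ ((X ◁ Z ◁ Y ◁ sw Y T (T ⊗ tunit)) ∘
     ((X ◁ sw Y Z (Y ⊗ (T ⊗ (T ⊗ tunit)))) ∘ ((X ◁ Y ◁ sw Y Z (T ⊗ (T ⊗ tunit))) ∘ y)))).
  by rw1 (sw_nat _ _ (T ◁ o20 q tunit)); rw1 (sw_nat _ _ (sw Y T (T ⊗ tunit))).
have E (f g : Mor S (X ⊗ (Z ⊗ tunit))) : f = g -> str p tunit ∘ f = str p tunit ∘ g by move->.
apply: E; rewrite !H.
rw2 (G1 _); rw1 (esym (swYB _ _ _ _)); rw2 (swK _ _ _).
rw2 (sw_nat _ _ (sw T T tunit)); rw1 (sw_nat _ _ (Y ◁ sw T T tunit)); rw2 (G2 _).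
by rw4 (swK _ _ _).
Qed.
End PairProd.

Section EvS.
Context {C : rigidCat}.
Implicit Types (V X Y Z T W : C).
Local Notation S n X := (SymPow n X).

Lemma tpairS V k : tpair V k.+1 = pairprod (tpair V k) (ev V).
Proof. by rewrite pairprodE. Qed.

Lemma tpair_S_sym V k (f : Mor (tpow (dual V) k) (tpow (dual V) k)) (h : Mor (tpow V k)
  (tpow V k)) :
  tpair V k ∘ (f ⊠ idm _) = tpair V k ∘ (idm _ ⊠ h) ->
  tpair V k.+1 ∘ ((f ⊠ idm _) ⊠ idm _) = tpair V k.+1 ∘ (idm _ ⊠ (h ⊠ idm _)).
Proof.
by move=> fh; rewrite tpairS -[X in _ ⊠ X]tensm1 -[X in _ = _ ∘ (X ⊠ _)]tensm1 !pairprod_nat fh.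
Qed.

Lemma tpair_cycsum V k :
  tpair V k.+1 ∘ (cycsum (dual V) k ⊠ idm _) = tpair V k.+1 ∘ (idm _ ⊠ cycsum' V k).
Proof.
elim: k => [|k IHk] //.
rewrite [cycsum _ k.+1]/= [cycsum' _ k.+1]/= tensDl tensDr !compDr rcomp lcomp.
congr (_ + _).
have sgE : tpair V k.+2 ∘ (last_swap (dual V) k ⊠ idm _) = tpair V k.+2 ∘ (idm _ ⊠ last_swap V k).
  by rewrite !tpairS !last_swapE pairprod_swap.
by rewrite !compA (tpair_S_sym IHk) -sgE -!compA tens_inter.
Qed.

(** Transposition reverses products, so the adjoint of [cycsum] is [cycsum']; the two factorisations
    of the symmetrizer are used on the two sides. *)
Lemma tpair_symmetrizer V k :
  tpair V k ∘ (symmetrizer (dual V) k ⊠ idm _) = tpair V k ∘ (idm _ ⊠ symmetrizer V k).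
Proof.
elim: k => [|k IHk]; first by rewrite !symmetrizer0.
rewrite symmetrizerS [symmetrizer V _]symmetrizer_alt symm'S -symmetrizer_alt.
rewrite tensZl tensZr !compZr; congr (_ *: _).
rewrite rcomp lcomp !compA tpair_cycsum -(tpair_S_sym IHk) -!compA tens_inter.
by [].
Qed.

(** Creation on one side is adjoint to annihilation on the other. No constant appears, because both
    are built from the same symmetrizer and that is self-adjoint. *)
Lemma evS_mul V k :
  evS V k.+1 ∘ (mu k (dual V) ⊠ idm _) =
  pairprod (evS V k) (ev V) ∘ (idm _ ⊠ nu k V).
Proof.
rewrite /evS -compA -tensm_comp compm1 symi_mu -[symi k.+1 V]comp1m tensm_comp.
rewrite compA tpair_symmetrizer -compA -tensm_comp comp1m (symmetrizer_symi k.+1 V) -symi_nu.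
rewrite -[symi k (dual V) ⊠ _]compm1 tensm_comp compA tpairS pairprod_nat (tensm1
  (dual V) V) compm1.
by [].
Qed.

Lemma evS_mul' V k :
  evS V k.+1 ∘ (idm _ ⊠ mu k V) =
  pairprod (evS V k) (ev V) ∘ (nu k (dual V) ⊠ idm _).
Proof.
rewrite /evS -compA -tensm_comp compm1 symi_mu -[symi k.+1 (dual V)]comp1m tensm_comp.
rewrite compA -tpair_symmetrizer -compA -tensm_comp comp1m (symmetrizer_symi k.+1
  (dual V)) -symi_nu.
rewrite -[symi k V ⊠ _]compm1 tensm_comp compA tpairS pairprod_nat (tensm1 (dual V) V) compm1.
by [].
Qed.

Lemma evS_0 V : evS V 0 ∘ (symp 0 (dual V) ⊠ symp 0 V) = lun tunit.
Proof. by rewrite /evS -compA -tensm_comp !sympK0 tensm1 compm1. Qed.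

Lemma tpairprod X Y Z T (p : Mor (X ⊗ Z) tunit) (q : Mor (Y ⊗ T) tunit) W :
  @str C (rtens (rtens (ratom X) (ratom Y)) (rtens (ratom Z) (ratom T))) runit (pairprod p q) W =
  o20 p W ∘ ((X ◁ Z ◁ o20 q W) ∘ (X ◁ sw Y Z (T ⊗ W))).
Proof. by rewrite str_pairprod. Qed.

Lemma tev_mul V k T :
  o20 (evS V k.+1) T ∘ o21 (mu k (dual V)) (S k.+1 V ⊗ T) =
  o20 (evS V k) T ∘ ((S k (dual V) ◁ S k V ◁ o20 (ev V) T) ∘
   ((S k (dual V) ◁ sw (dual V) (S k V) (V ⊗ T)) ∘ (S k (dual V) ◁ dual V ◁ o12 (nu k V) T))).
Proof.
have := evS_mul V k; move: (evS _ _) (evS _ _) => p q.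
move/(congr1 (fun f => @str C (rtens (rtens (ratom _) (ratom _)) (ratom _)) runit f T)).
rewrite (@str_comp _ _ (rtens (ratom _) (ratom _)) runit) str_rid => ->.
rewrite (@str_comp _ _ (rtens (rtens (ratom _) (ratom _)) (rtens (ratom _) (ratom _))) runit).
by rewrite tpairprod (@str_lid _ (rtens (ratom _) (ratom _))) -!compA.
Qed.

Lemma tev_mul' V k T :
  o20 (evS V k.+1) T ∘ (S k.+1 (dual V) ◁ o21 (mu k V) T) =
  o20 (evS V k) T ∘ ((S k (dual V) ◁ S k V ◁ o20 (ev V) T) ∘
   ((S k (dual V) ◁ sw (dual V) (S k V) (V ⊗ T)) ∘ o12 (nu k (dual V)) (S k V ⊗ (V ⊗ T)))).
Proof.
have := evS_mul' V k; move: (evS _ _) (evS _ _) => p q.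
move/(congr1 (fun f => @str C (rtens (ratom _) (rtens (ratom _) (ratom _))) runit f T)).
rewrite (@str_comp _ _ (rtens (ratom _) (ratom _)) runit) str_lid => ->.
rewrite (@str_comp _ _ (rtens (rtens (ratom _) (ratom _)) (rtens (ratom _) (ratom _))) runit).
by rewrite tpairprod (@str_rid _ (rtens (ratom _) (ratom _))) -!compA.
Qed.

Lemma tev_0 V T :
  o20 (evS V 0) T ∘ (o01 (symp 0 (dual V)) (S 0 V ⊗ T) ∘ o01 (symp 0 V) T) = idm _.
Proof.
have := evS_0 V; move: (evS _ _) => p.
move/(congr1 (fun f => @str C (rtens runit runit) runit f T)).
rewrite (str_lun runit) => <-.
rewrite (@str_comp _ _ (rtens (ratom _) (ratom _)) runit).
by rewrite (@str_tens _ runit runit (ratom _) (ratom _)).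
Qed.
End EvS.

Section Slide.
Context {C : closedSymMonCat}.
Implicit Types (X Y Z T W : C).
Lemma o20_swr X Y W (f : Mor (X ⊗ Y) tunit) T :
  o20 f (W ⊗ T) ∘ (X ◁ sw W Y T) = (W ◁ o20 f T) ∘ sw X W (Y ⊗ T).
Proof. by rewrite -(sw_o20 W f) -!compA swK compm1. Qed.
End Slide.

Section CoevS.
Context {C : rigidCat} (V : C).
Local Notation A n := (SymPow n V).
Local Notation B n := (SymPow n (dual V)).
Local Notation V' := (dual V).
Implicit Types T : C.

(** Dual bases of degree k.+1 as products of dual bases of degrees k and 1. No binomial factor is
    needed: in the triangle identities the adjoint of [mu] is [nu], and [mu ∘ nu = 1]. *)
Fixpoint coevS k : Mor tunit (A k ⊗ B k) :=
  if k is k'.+1 then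
    (mu k' V ⊠ mu k' V') ∘ interchange (A k') (B k') V V' ∘ (coevS k' ⊠ coev V) ∘ lunV tunit
  else (symp 0 V ⊠ symp 0 V') ∘ lunV tunit.

Lemma tcoev_0 T :
  o02 (coevS 0) T = o01 (symp 0 V) (B 0 ⊗ T) ∘ o01 (symp 0 V') T.
Proof.
rewrite /o02 /coevS (@str_comp _ runit (rtens runit runit) (rtens (ratom _) (ratom _))).
rewrite (str_lunV runit) compm1.
by rewrite (@str_tens _ runit runit (ratom _) (ratom _)).
Qed.

Lemma tcoev_S k T :
  o02 (coevS k.+1) T = (A k.+1 ◁ o21 (mu k V') T) ∘ (o21 (mu k V) (B k ⊗ (V' ⊗ T)) ∘
    ((A k ◁ sw (B k) V (V' ⊗ T)) ∘ (o02 (coevS k) (V ⊗ (V' ⊗ T)) ∘ o02 (coev V) T))).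
Proof.
rewrite /o02 [coevS k.+1]/=; move: (coevS k) (coev V) => c d.
rewrite (@str_comp _ runit (rtens runit runit) (rtens (ratom _) (ratom _))).
rewrite (str_lunV runit) compm1.
rewrite (@str_comp _ (rtens runit runit) (rtens (rtens (ratom _) (ratom _)) (rtens (ratom _)
  (ratom _))) (rtens (ratom _) (ratom _))).
rewrite (@str_comp _ (rtens (rtens (ratom _) (ratom _)) (rtens (ratom _) (ratom _))) (rtens
  (rtens (ratom _) (ratom _)) (rtens (ratom _) (ratom _))) (rtens (ratom _) (ratom _))).
rewrite (@str_interchange _ (ratom _) (ratom _) (ratom _) (ratom _)).
rewrite (@str_tens _ runit runit (rtens (ratom _) (ratom _)) (rtens (ratom _) (ratom _))).
rewrite (@str_tens _ (rtens (ratom _) (ratom _)) (rtens (ratom _) (ratom _)) (ratom _)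
  (ratom _)) /= -!compA.
rewrite compA (str_nat (a := rtens (ratom _) (ratom _)) (b := ratom _)) -!compA.
by [].
Qed.

Lemma dualpair_evS k : dualpair (evS V k) (coevS k).
Proof.
have [z1 z2] := dualpair_ev V.
elim: k => [|k [IH1 IH2]]; split=> T.
- apply: unit_epi; apply: mor_ext => Z z; rewrite tcoev_0 -!compA comp1m.
  by rw0 (esym (o01_nat _ _)); rw0 (tev_0 _ _).
- apply: unit_epi; apply: mor_ext => Z z; rewrite tcoev_0 lcomp -!compA comp1m.
  by rw0 (esym (o01_nat _ _)); rw0 (esym (o01_nat _ _)); rw0 (tev_0 _ _).
- apply: mor_ext => Z z; rewrite tcoev_S -!compA comp1m.
  rw1 (tev_mul _ _ _); do 4!rw0 (esym (o21_nat (mu k V) _)).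
  rw1 (esym (sw_nat _ _ _)); rw0 (esym (o02_nat (coevS k) _)); rw0 (esym (o02_nat (coev V) _)).
  rw2 (o20_nat (evS V k) _); rw2 (o20_swr _ _ _); rw0 (o02_nat (coevS k) (o02 (coev V) _)).
  rw1 (esym (sw_o02 _ _ _)); rw1 (esym (o02_nat (coev V) _)); rw0 (IH1 _); rw1 (z1 _).
  by rw0 (tmu_nu _ _ _).
apply: mor_ext => Z z; rewrite tcoev_S !lcomp -!compA comp1m.
rw0 (o20_nat (evS V k.+1) _); rw0 (tev_mul' _ _ _); do 3!rw0 (o12_nat (nu k V') _).
rw2 (o02_nat (coevS k) _); rw1 (sw_nat _ _ (sw _ _ _)); rw1 (sw_nat _ _ (B k ◁ _)).
do 3!rw0 (o20_nat (evS V k) _).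
rw0 (o20_swr _ (evS V k) _); rw0 (sw_nat (B k) V' _); rw1 (IH2 _).
rw0 (o20_swr _ (ev V) _); rw0 (sw_nat V' (B k) _); rw1 (z2 _); rw0 (swK _ _ _).
by rw0 (tmu_nu _ _ _).
Qed.

(** By adjunction a [nu] meets the [mu], and the commutation relation splits the result: its
    identity term closes a loop of value [rank V], its crossing term straightens and contributes
    n. *)
Lemma tev_loop n T Z (z : Mor Z (B n ⊗ (A n ⊗ T))) :
  o20 (evS V n.+1) T ∘ (o21 (mu n V') (A n.+1 ⊗ T) ∘ ((B n ◁ sw (A n.+1) V' T) ∘
    ((B n ◁ o21 (mu n V) (V' ⊗ T)) ∘ ((B n ◁ A n ◁ o02 (coev V) T) ∘ z)))) =
  (n.+1%:R^-1 : rat) *: escale (rank V + n%:R) (o20 (evS V n) T ∘ z).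
Proof.
have [z1 z2] := dualpair_ev V.
rw0 (tev_mul _ _ _); rw1 (esym (o12_sw _ _ _)); rw1 (swK _ _ _).
have loop S (y : Mor S (B n ⊗ (A n ⊗ T))) :
    (B n ◁ A n ◁ o20 (ev V) T) ∘ ((B n ◁ A n ◁ sw V V' T) ∘ ((B n ◁ A n ◁ o02 (coev V) T) ∘ y)) =
    escale (rank V) y.
  have := congr1 (fun f => (B n ◁ A n ◁ f) ∘ y) (loop_rank V T).
  by rewrite !escale_l !ltens1 escale_compl comp1m !lcomp -!compA.
case: n z loop => [|n] z loop.
  by rw1 (tnu_mu0 _ _); rewrite loop escale_compr invr1 scale1r addr0.
apply: (scalerI (natS_neq0 n.+1)); rewrite scalerA mulfV ?natS_neq0 // scale1r.
rewrite -3!compZr tnu_muE1 !(compDr, compZr) loop escaleDl escale_compr; congr (_ + _).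
rw1 (esym (o21_nat (mu n V) _)); rw1 (esym (o21_nat (mu n V) _)); rw1 (o12_nat (nu n V) _).
rw2 (esym (sw_o02 _ _ _)); rw2 (z1 _); rw1 (tmu_nu _ _ _).
by rewrite -[n.+1%:R in RHS]scaler_nat escaleZl escale1.
Qed.

(* The binomial coefficient (r+k+j-1 choose k) divided by (k+j choose k), see
   [loopcoefE]. *)
Fixpoint loopcoef j k : Endo (@tunit C) :=
  if k is k'.+1 then
    ((k' + j).+1%:R^-1 : rat) *: (loopcoef j k' * (rank V + (k' + j)%:R))
  else 1.

(* The pairing of [θ b^*] with [x b], summed over dual bases, for θ and x of
   degree j and b of degree k. *)
Lemma tev_loops j k n T Z (z : Mor Z (B j ⊗ (A j ⊗ T))) : n = (k + j)%N ->
  o20 (evS V n) T ∘ (o21 (mulS V' j k n) (A n ⊗ T) ∘ ((B j ◁ sw (A n) (B k) T) ∘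
    ((B j ◁ o21 (mulS V j k n) (B k ⊗ T)) ∘ ((B j ◁ A j ◁ o02 (coevS k) T) ∘ z)))) =
  escale (loopcoef j k) (o20 (evS V j) T ∘ z).
Proof.
elim: k n T z => [|k IHk] n T z.
  move=> ->; rewrite escale1 tcoev_0 !lcomp -!compA.
  by rw1 (tmulS_0 _ _ _); rw1 (sw_o01 _ _ _); rw0 (tmulS_0 _ _ _).
case: n => [|n] //; rewrite addSn => -[En].
rewrite tcoev_S !lcomp -!compA.
rw1 (o21_nat (mulS V j k.+1 n.+1) _); rw1 (tmulS_S _ _ En); rw1 (esym (sw_o21 _ _ _)).
rw0 (tmulS_S _ _ En); rw1 (o21_sw _ _ _); rw1 (esym (o21_nat (mulS V j k n) _)).
rw3 (swK _ _ _); rw2 (o02_nat (coevS k) (o02 (coev V) _)).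
rw1 (o21_nat (mulS V j k n) (B k ◁ _)); rw1 (sw_nat _ _ (o02 (coev V) T)).
do 3!rw0 (o21_nat (mulS V' j k n) _).
by rewrite tev_loop (IHk _ _ _ En) -escaleM endoC -escaleZl En.
Qed.

End CoevS.

(** * Invertible objects *)

Section Invertible.
Context {C : rigidCat}.
Implicit Types X Y Z T W L : C.

(** [u] and [v] are only known to be mutually inverse, so the formula for [m] first recovers [f] on
    tails beginning with L'. *)
Lemma invertible_full L X Y (f : Mor (X ⊗ L) (Y ⊗ L)) : invertible L ->
  exists m : Mor X Y, f = m ⊠ idm L.
Proof.
move=> [L' [u [v [vu uv]]]].
have uvT T : o20 u T ∘ o02 v T = idm T.
  by rewrite -(@str_comp _ runit (rtens (ratom _) (ratom _)) runit) uv (str_id runit).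
have vuT T : o02 v T ∘ o20 u T = idm (L ⊗ (L' ⊗ T)).
  by rewrite -(@str_comp _ (rtens (ratom _) (ratom _)) runit (rtens (ratom _) (ratom _))) vu
    (str_id (rtens (ratom _) (ratom _))).
pose F T : Mor (X ⊗ (L ⊗ T)) (Y ⊗ (L ⊗ T)) := str f T.
have Fnat T T' (h : Mor T T') : F T' ∘ (X ◁ L ◁ h) = (Y ◁ L ◁ h) ∘ F T.
  exact: (str_nat (a := rtens (ratom X) (ratom L)) (b := rtens (ratom Y) (ratom L))).
pose m : Mor X Y := run Y ∘ ((Y ◁ u) ∘ (asc Y L L' ∘ ((f ⊠ idm L') ∘ (ascV X L L' ∘ ((X ◁ v) ∘
  runV X))))).
have mE T : o11 m T = (Y ◁ o20 u T) ∘ (F (L' ⊗ T) ∘ (X ◁ o02 v T)).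
  rewrite /o11 /m !(str_comp, str_rid, str_lid) (str_run (ratom Y)) (str_runV (ratom X)).
  rewrite (str_asc (ratom _) (ratom _) (ratom _)) (str_ascV (ratom _) (ratom _) (ratom _)).
  by rewrite !comp1m compm1.
have FmL' T : F (L' ⊗ T) = o11 m (L ⊗ (L' ⊗ T)).
  apply: (cancel_mono (ltens20 Y (vuT T))); rewrite -o11_nat mE.
  by apply: mor_ext => Z z; rewrite -!compA; rw1 (vuT _).
(* L' ⊗ (L ⊗ T) retracts onto T by an exchange followed by [u]; naturality of F in the tail carries
   the result over to T. *)
have Fm T : F T = o11 m (L ⊗ T).
  have vK : (L' ◁ o20 u T) ∘ ((L' ◁ sw L' L T) ∘ ((L' ◁ sw L L' T) ∘ (L' ◁ o02 v T))) = idm _.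
    by rewrite -!lcomp (compA (sw _ _ _)) swK comp1m uvT ltens1.
  have wK : (o20 u T ∘ sw L' L T) ∘ (sw L L' T ∘ o02 v T) = idm T.
    by rewrite -!compA (compA (sw _ _ _)) swK comp1m uvT.
  apply: (cancel_epi (ltens20 X (ltens20 L wK))); rewrite Fnat FmL'.
  by rewrite (o11_nat m (L ◁ (o20 u T ∘ sw L' L T))).
exists m; apply: str_inj; rewrite (@str_rid _ (ratom L) (ratom X) (ratom Y)).
exact: Fm.
Qed.

Section TraceCyc.
Variables (An Bn Ak Bk X Xd : C).
Variables (en : Mor (Bn ⊗ An) tunit) (cn : Mor tunit (An ⊗ Bn)).
Variables (ek : Mor (Bk ⊗ Ak) tunit) (ck : Mor tunit (Ak ⊗ Bk)).
Hypotheses (pn : dualpair en cn) (pk : dualpair ek ck).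
Variables (m : Mor (X ⊗ Ak) An) (D : Mor An (Xd ⊗ Ak)).

Lemma yank A B (e : Mor (B ⊗ A) tunit) (c : Mor tunit (A ⊗ B)) T : dualpair e c ->
  (A ◁ o20 e T) ∘ ((A ◁ sw A B T) ∘ (sw A A (B ⊗ T) ∘ (A ◁ o02 c T))) = idm (A ⊗ T).
Proof. by move=> [z1 _]; rewrite -sw_o02 z1. Qed.

(** Cyclicity of the partial trace: [m] is slid around the loop through An, which becomes a loop
    through Ak. *)
Lemma trace_cyc T :
  (Xd ◁ o20 en T) ∘ ((Xd ◁ sw An Bn T) ∘ ((Xd ◁ o21 m (Bn ⊗ T)) ∘ (sw X Xd (Ak ⊗ (Bn ⊗ T)) ∘
    ((X ◁ o12 D (Bn ⊗ T)) ∘ (X ◁ o02 cn T))))) =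
  (Xd ◁ o20 ek T) ∘ ((Xd ◁ sw Ak Bk T) ∘ (o12 D (Bk ⊗ T) ∘ (o21 m (Bk ⊗ T) ∘ (X ◁ o02 ck T)))).
Proof.
apply: mor_ext => Z z; rewrite -!compA.
have slide S (y : Mor S (Ak ⊗ (Bn ⊗ (X ⊗ T)))) :
  o20 ek T ∘ (sw Ak Bk T ∘ ((Ak ◁ o20 en (Bk ⊗ T)) ∘ ((Ak ◁ Bn ◁ o21 m (Bk ⊗ T)) ∘
    ((Ak ◁ Bn ◁ X ◁ o02 ck T) ∘ y)))) =
  o20 en T ∘ ((Bn ◁ o21 m T) ∘ ((Bn ◁ sw Ak X T) ∘ (sw Ak Bn (X ⊗ T) ∘ y))).
  rewrite -[(Bn ◁ sw Ak X T) ∘ _]comp1m -(ltens1 Bn) -(ltens1 X) -(yank T pk) !lcomp -!compA.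
  rw1 (esym (sw_nat _ _ (o02 ck T))); rw0 (esym (sw_nat _ _ (X ◁ o02 ck T))).
  rw1 (o21_nat m (o20 ek T)); rw0 (o20_nat en (o20 ek T)).
  rw1 (o21_nat m (sw Ak Bk T)); rw0 (o20_nat en (sw Ak Bk T)).
  rw1 (sw_o21 _ _ _); rw0 (esym (sw_nat Ak Bn (o21 m (Bk ⊗ T)))).
  by rw0 (sw_o20 _ _ _).
rewrite -[o21 m (Bk ⊗ T) ∘ _]comp1m -(pn.1 (Bk ⊗ T)) -!compA.
rw0 (o12_nat D _); rw0 (o02_nat cn (o21 m _)); rw0 (o02_nat cn (X ◁ o02 ck T)).
rw0 (o12_nat D (Bn ◁ o21 m _)); rw0 (o12_nat D (Bn ◁ X ◁ o02 ck T)).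
have {slide} := congr1 (fun f => (Xd ◁ f) ∘ (o12 D _ ∘ (o02 cn _ ∘ z))) (slide _ (idm _)).
rewrite !compm1 !lcomp -!compA => ->.
rw0 (sw_o02 X cn _); rw0 (o12_nat D (sw X Bn _)); rw0 (sw_o12 _ _ _).
rw1 (esym (swYB X Ak Bn T)); rw2 (swK _ _ _); rw1 (esym (o21_sw Bn m T)).
by [].
Qed.
End TraceCyc.

(* If [p] is dual to [D], then tracing [D] against [m] amounts to summing the
   pairings of [p] and [m] over dual bases of [Ak]. *)
Section TraceInvertible.
Variables (An Bn Ak Bk X X' : C).
Variables (en : Mor (Bn ⊗ An) tunit) (cn : Mor tunit (An ⊗ Bn)).
Variables (ek : Mor (Bk ⊗ Ak) tunit) (ck : Mor tunit (Ak ⊗ Bk)).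
Variables (ex : Mor (X' ⊗ X) tunit) (cx : Mor tunit (X ⊗ X')).
Hypotheses (pn : dualpair en cn) (pk : dualpair ek ck) (px : dualpair ex cx).
Variables (m : Mor (X ⊗ Ak) An) (D : Mor An (X ⊗ Ak)) (p : Mor (X' ⊗ Bk) Bn).
Hypothesis adj : forall T,
  o20 en T ∘ o21 p (An ⊗ T) = o20 ex T ∘ ((X' ◁ X ◁ o20 ek T) ∘
    ((X' ◁ sw Bk X (Ak ⊗ T)) ∘ (X' ◁ Bk ◁ o12 D T))).
Variable s : Endo (@tunit C).
Hypothesis loop : forall T,
  o20 en T ∘ (o21 p (An ⊗ T) ∘ ((X' ◁ sw An Bk T) ∘ ((X' ◁ o21 m (Bk ⊗ T)) ∘
    (X' ◁ X ◁ o02 ck T)))) =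
  escale s (o20 ex T).
Hypothesis An_inv : invertible An.
Hypothesis rank_An : rank An * rank An = 1.

(** By fullness the composite is [phi] on X. Tracing out An multiplies [phi] by [rank An], whereas
    [trace_cyc], [adj] and [loop] evaluate this trace to [s]. Since [rank An] squares to 1,
    multiplying by it recovers [phi]. *)
Lemma invertible_trace T :
  (X ◁ o21 m T) ∘ (sw X X (Ak ⊗ T) ∘ (X ◁ o12 D T)) =
  escale (rank An * s) (idm (X ⊗ (An ⊗ T))).
Proof.
pose N : Mor (X ⊗ An) (X ⊗ An) :=
  (X ◁ m) ∘ (asc X X Ak ∘ ((swap X X ⊠ idm Ak) ∘ (ascV X X Ak ∘ (X ◁ D)))).
have NE U : str N U = (X ◁ o21 m U) ∘ (sw X X (Ak ⊗ U) ∘ (X ◁ o12 D U)).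
  rewrite /N !(str_comp, str_lid, str_rid) (str_asc (ratom _) (ratom _) (ratom _)).
  by rewrite (str_ascV (ratom _) (ratom _) (ratom _)) !comp1m.
have [phi phiE] := invertible_full N An_inv.
have {}NE U : (X ◁ o21 m U) ∘ (sw X X (Ak ⊗ U) ∘ (X ◁ o12 D U)) = o11 phi (An ⊗ U).
  by rewrite -NE phiE (@str_rid _ (ratom An) (ratom X) (ratom X)).
suff {T} phis T : o11 phi T = escale (rank An * s) (idm (X ⊗ T)) by rewrite NE phis.
rewrite escaleM; have <- : escale (rank An) (o11 phi T) = escale s (idm (X ⊗ T)); last first.
  by rewrite -escaleM rank_An escale1.
have -> : escale (rank An) (o11 phi T) =
    (X ◁ o20 en T) ∘ ((X ◁ sw An Bn T) ∘ (o11 phi (An ⊗ (Bn ⊗ T)) ∘ (X ◁ o02 cn T))).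
  apply: mor_ext => Z z; rewrite escale_compl -!compA.
  rw0 (o11_nat phi _).
  have := congr1 (fun f => (X ◁ f) ∘ (o11 phi T ∘ z)) (loop_dualpair pn T).
  by rewrite escale_l ltens1 escale_compl comp1m !lcomp -!compA => ->.
rewrite -NE; have := trace_cyc pn pk m D T; rewrite -!compA => ->.
apply: (dual_inj px); rewrite escale_l ltens1 escale_compr compm1 -loop.
apply: mor_ext => Z z; rewrite !lcomp -!compA; rw0 (adj _).
by rw1 (esym (o12_sw _ _ _)); rw1 (swK _ _ _).
Qed.
End TraceInvertible.
End Invertible.

(** * Degree one and comultiplication on an invertible power *)

Section Sym1.
Context {C : rigidCat}.
Implicit Types X Y Z T W L : C.
Local Notation S n X := (SymPow n X).

Lemma tto_Sym1 X T : o11 (to_Sym1 X) T = o21 (mu 0 X) T ∘ o01 (symp 0 X) (X ⊗ T).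
Proof.
rewrite /to_Sym1 -mu_symp -compA /o11.
rewrite (@str_comp _ _ (rtens (ratom _) (ratom _)) (ratom _)).
rewrite (@str_comp _ _ (rtens runit (ratom _)) (rtens (ratom _) (ratom _))).
by rewrite (str_lunV (ratom _)) compm1 str_rid.
Qed.
Lemma to_Sym1K X : of_Sym1 X ∘ to_Sym1 X = idm _.
Proof.
rewrite /of_Sym1 /to_Sym1 -compA (compA (symi _ _)) sympK symmetrizerS symmetrizer0 tensm1.
by rewrite invr1 scale1r !compm1 comp1m lunVK.
Qed.
Lemma of_Sym1K X : to_Sym1 X ∘ of_Sym1 X = idm _.
Proof. by rewrite /of_Sym1 /to_Sym1 -compA (compA (lunV _)) lunK comp1m symiK. Qed.
Lemma tto_Sym1K X T : o11 (of_Sym1 X) T ∘ o11 (to_Sym1 X) T = idm _.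
Proof. by rewrite -o11_comp to_Sym1K o11_id. Qed.
Lemma tof_Sym1K X T : o11 (to_Sym1 X) T ∘ o11 (of_Sym1 X) T = idm _.
Proof. by rewrite -o11_comp of_Sym1K o11_id. Qed.

Lemma tmulS_1 X k T :
  o21 (mulS X k 1 k.+1) T ∘ (S k X ◁ o11 (to_Sym1 X) T) = o21 (mu k X) T.
Proof.
rewrite tto_Sym1 lcomp; apply: mor_ext => Z z; rewrite -!compA.
by rw0 (tmulS_S X T (esym (add0n k))); rw0 (tmulS_0 _ _ _).
Qed.
Lemma tmulS_1l X k T :
  o21 (mulS X 1 k k.+1) T ∘ o11 (to_Sym1 X) (S k X ⊗ T) = o21 (mu k X) T ∘ sw X (S k X) T.
Proof.
have E : k.+1 = (k + 1)%N by rewrite addn1.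
apply: mor_ext => Z z; rewrite -!compA -(tmulS_comm X T E) -(tmulS_1 X k T) -!compA.
by rw0 (o11_sw (S k X) _ _).
Qed.

Variable V : C.
Local Notation A n := (SymPow n V).
Local Notation B n := (SymPow n (dual V)).
Local Notation V' := (dual V).

Lemma tev_1 T :
  o20 (evS V 1) T ∘ (o11 (to_Sym1 V') (A 1 ⊗ T) ∘ (V' ◁ o11 (to_Sym1 V) T)) = o20 (ev V) T.
Proof.
rewrite !tto_Sym1 !lcomp; apply: mor_ext => Z z; rewrite -!compA.
rw0 (tev_mul V 0 T); rw0 (esym (o01_nat (symp 0 V') (V' ◁ o12 _ _))).
rw1 (tnu_mu0 _ _); rw0 (esym (o01_nat (symp 0 V') (sw _ _ _))); rw0 (sw_o01 _ _ _).
rw0 (esym (o01_nat (symp 0 V') (A 0 ◁ _))); rw0 (esym (o01_nat (symp 0 V) _)).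
by rw0 (tev_0 _ _).
Qed.

(** [invertible_trace] for X = V. It wants V as the left factor, so [mu] and [nu] are composed with
    exchanges, which are undone at the end. *)
Lemma invertible_mu_nu k T : invertible (A k.+1) -> rank (A k.+1) * rank (A k.+1) = 1 ->
  o21 (mu k V) (V ⊗ T) ∘ ((A k ◁ sw V V T) ∘ o12 (nu k V) (V ⊗ T)) =
  escale (rank (A k.+1) * loopcoef V 1 k) (idm (A k.+1 ⊗ (V ⊗ T))).
Proof.
move=> inv rk.
pose m := mu k V ∘ swap V (A k); pose p := mu k V' ∘ swap V' (B k).
pose D := swap (A k) V ∘ nu k V.
have mE U : o21 m U = o21 (mu k V) U ∘ sw V (A k) U.
  by rewrite /m /o21 (@str_comp _ _ (rtens (ratom _) (ratom _)) (ratom _)).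
have pE U : o21 p U = o21 (mu k V') U ∘ sw V' (B k) U.
  by rewrite /p /o21 (@str_comp _ _ (rtens (ratom _) (ratom _)) (ratom _)).
have DE U : o12 D U = sw (A k) V U ∘ o12 (nu k V) U.
  by rewrite /D /o12 (@str_comp _ (ratom _) (rtens (ratom _) (ratom _)) (rtens (ratom _)
    (ratom _))).
unshelve epose proof (@invertible_trace _ _ _ _ _ _ _ _ _ _ _ _ _ (dualpair_evS V k.+1)
  (dualpair_evS V k) (dualpair_ev V) m D p _ (loopcoef V 1 k) _ inv rk T) as N.
- move=> U; rewrite pE DE !lcomp; apply: mor_ext => Z z; rewrite -!compA.
  rw0 (tev_mul _ _ _); rw0 (esym (sw_nat _ _ (o12 _ _))); rw0 (o20_nat (evS V k) _).
  by rw0 (sw_o20 _ _ _); rw1 (o20_sw _ (evS V k) _).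
- move=> U; apply: mor_ext => Z z; rewrite escale_compl -!compA.
  have E : k.+1 = (k + 1)%N by rewrite addn1.
  have := @tev_loops _ V 1 k k.+1 U Z (o11 (to_Sym1 V') _ ∘ ((V' ◁ o11 (to_Sym1 V) _) ∘ z)) E.
  rw0 (tev_1 _) => <-.
  do 3!rw0 (esym (o11_nat (to_Sym1 V') _)).
  rw1 (esym (o11_nat (to_Sym1 V) (o02 _ _))).
  by rw1 (tmulS_1l _ _ _); rw0 (tmulS_1l _ _ _); rewrite pE mE !lcomp -!compA.
have -> : escale (rank (A k.+1) * loopcoef V 1 k) (idm (A k.+1 ⊗ (V ⊗ T))) =
  sw V (A k.+1) T ∘ (escale (rank (A k.+1) * loopcoef V 1 k) (idm (V ⊗ (A k.+1 ⊗ T))) ∘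
    sw (A k.+1) V T).
  by rewrite escale_compl comp1m escale_compr swK.
rewrite -N mE DE !lcomp; apply: mor_ext => Z z; rewrite -!compA.
rw0 (esym (o12_sw _ _ _)); rw0 (esym (sw_o21 _ _ _)); rw0 (esym (swYB (A k) V V T)).
by rw1 (swK _ _ _); rw0 (swK _ _ _); rw1 (swK _ _ _).
Qed.

(* Dual to the multiplication [mulS V' j k n]. *)

Variables (j k n : nat).
Hypothesis nE : n = (k + j)%N.

Definition comulS : Mor (A n) (A j ⊗ A k) :=
  locked_with str_key (run (A j ⊗ A k)
  ∘ (((A j ⊗ A k) ◁ (evS V n ∘ (mulS V' j k n ⊠ idm (A n))))
  ∘ (asc (A j ⊗ A k) (B j ⊗ B k) (A n)
  ∘ (((interchange (A j) (B j) (A k) (B k) ∘ ((coevS V j ⊠ coevS V k) ∘ lunV tunit)) ⊠ idm (A n))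
  ∘ lunV (A n))))).

Lemma tcomulS T : o12 comulS T =
  (A j ◁ A k ◁ o20 (evS V n) T) ∘ ((A j ◁ A k ◁ o21 (mulS V' j k n) (A n ⊗ T)) ∘
  ((A j ◁ sw (B j) (A k) (B k ⊗ (A n ⊗ T))) ∘ (o02 (coevS V j) (A k ⊗ (B k ⊗ (A n ⊗ T))) ∘
    o02 (coevS V k) (A n ⊗ T)))).
Proof.
rewrite /o12 /comulS unlock.
have := @str_interchange _ (ratom (A j)) (ratom (B j)) (ratom (A k)) (ratom (B k)) (A n ⊗ T).
move: (interchange _ _ _ _) (evS V n) (mulS _ _ _ _) (coevS V j) (coevS V k) => i e q c d iE.
rewrite (@str_comp _ (ratom _) (rtens (rtens (ratom _) (ratom _)) runit) (rtens (ratom _)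
  (ratom _))).
rewrite (str_run (rtens (ratom _) (ratom _))) comp1m.
rewrite (@str_comp _ (ratom _) (rtens (rtens (ratom _) (ratom _)) (rtens (rtens (ratom _)
  (ratom _)) (ratom _))) (rtens (rtens (ratom _) (ratom _)) runit)).
rewrite (@str_lid _ (rtens (ratom (A j)) (ratom (A k))) (rtens (rtens (ratom _) (ratom _))
  (ratom _)) runit).
rewrite (@str_comp _ (rtens (rtens (ratom _) (ratom _)) (ratom _)) (rtens (ratom _)
  (ratom _)) runit) (@str_rid _ (ratom _) (rtens (ratom _) (ratom _)) (ratom _)).
rewrite (@str_comp _ (ratom _) (rtens (rtens (rtens (ratom _) (ratom _)) (rtens (ratom _)
  (ratom _))) (ratom _)) (rtens (rtens (ratom _) (ratom _)) (rtens (rtens (ratom _) (ratom _))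
    (ratom _)))).
rewrite (str_asc (rtens (ratom _) (ratom _)) (rtens (ratom _) (ratom _)) (ratom _)) comp1m.
rewrite (@str_comp _ (ratom _) (rtens runit (ratom _)) (rtens (rtens (rtens (ratom _)
  (ratom _)) (rtens (ratom _) (ratom _))) (ratom _))).
rewrite (str_lunV (ratom _)) compm1.
rewrite (@str_rid _ (ratom _) runit (rtens (rtens (ratom _) (ratom _)) (rtens (ratom _)
  (ratom _)))).
rewrite (@str_comp _ runit (rtens (rtens (ratom _) (ratom _)) (rtens (ratom _) (ratom _)))
  (rtens (rtens (ratom _) (ratom _)) (rtens (ratom _) (ratom _)))) iE.
rewrite (@str_comp _ runit (rtens runit runit) (rtens (rtens (ratom _) (ratom _)) (rtens
  (ratom _) (ratom _)))).
rewrite (str_lunV runit) compm1.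
rewrite (@str_tens _ runit runit (rtens (ratom _) (ratom _)) (rtens (ratom _) (ratom _))).
by rewrite [LHS]/= !lcomp -!compA.
Qed.

Lemma comulS_adj T :
  o20 (evS V n) T ∘ o21 (mulS V' j k n) (A n ⊗ T) =
    o20 (evS V j) T ∘ ((B j ◁ A j ◁ o20 (evS V k) T) ∘
    ((B j ◁ sw (B k) (A j) (A k ⊗ T)) ∘ (B j ◁ B k ◁ o12 comulS T))).
Proof.
have [_ zj] := dualpair_evS V j; have [_ zk] := dualpair_evS V k.
rewrite tcomulS !lcomp; apply: mor_ext => Z z; rewrite -!compA.
rw1 (sw_nat (B k) (A j) (A k ◁ o20 (evS V n) _));
  rw1 (sw_nat (B k) (A j) (A k ◁ o21 (mulS V' j k n) _)).
rw2 (o20_nat (evS V k) (o20 (evS V n) _)); rw2 (o20_nat (evS V k) (o21 (mulS V' j k n) _)).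
do 2!rw0 (o20_nat (evS V j) _).
rw1 (sw_nat (B k) (A j) (sw _ _ _)); rw2 (o02_nat (coevS V j) (o02 (coevS V k) _)).
rw1 (sw_nat (B k) (A j) (B j ◁ _)).
rw2 (o20_swr _ _ _); rw2 (sw_nat (B k) (B j) _); rw3 (zk _).
rw1 (esym (sw_o02 _ _ _)); rw0 (zj _).
by [].
Qed.

(** With j = k this is the relation [Pq] required of [q := comulS] in the section on the Laplace
    operator. *)
Lemma invertible_mul_comul T : invertible (A n) -> rank (A n) * rank (A n) = 1 ->
  (A j ◁ o21 (mulS V j k n) T) ∘ (sw (A j) (A j) (A k ⊗ T) ∘ (A j ◁ o12 comulS T)) =
  escale (rank (A n) * loopcoef V j k) (idm (A j ⊗ (A n ⊗ T))).
Proof.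
move=> inv rk.
apply: (invertible_trace (dualpair_evS V n) (dualpair_evS V k)
  (dualpair_evS V j) comulS_adj) => // U.
apply: mor_ext => Z z; rewrite escale_compl -!compA; exact: tev_loops.
Qed.
End Sym1.

(** * Reflexivity of symmetric powers *)

Section Duals.
Context {C : rigidCat}.
Implicit Types A B X Y Z T W L : C.

Lemma is_iso_comp X Y Z (g : Mor Y Z) (f : Mor X Y) : is_iso g -> is_iso f -> is_iso (g ∘ f).
Proof.
move=> [g' [g'g gg']] [f' [f'f ff']]; exists (f' ∘ g'); split.
  by rewrite -compA (compA g') g'g comp1m.
by rewrite -compA (compA f) ff' comp1m.
Qed.
Lemma is_iso_invm X Y (f : Mor X Y) : is_iso f -> is_iso (invm f).
Proof. by move=> /invmK[? ?]; exists f. Qed.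

Lemma ev_curry X Y (e : Mor (Y ⊗ X) tunit) : ev X ∘ (curry e ⊠ idm X) = e.
Proof. exact: curryK. Qed.
Lemma tev_curry X Y (e : Mor (Y ⊗ X) tunit) T :
  o20 (ev X) T ∘ o11 (curry e) (X ⊗ T) = o20 e T.
Proof.
rewrite -[in RHS](ev_curry e) /o20 (@str_comp _ _ (rtens (ratom _) (ratom _)) runit).
by rewrite str_rid.
Qed.

Lemma dualpair_iso A B (e : Mor (B ⊗ A) tunit) (c : Mor tunit (A ⊗ B)) :
  dualpair e c -> is_iso (curry e).
Proof.
move=> [z1 z2].
pose g := lun B ∘ ((ev A ⊠ idm B) ∘ (ascV (dual A) A B ∘ ((dual A ◁ c) ∘ runV (dual A)))).
have gE T : o11 g T = o20 (ev A) (B ⊗ T) ∘ (dual A ◁ o02 c T).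
  rewrite /g /o11 (@str_comp _ _ (rtens runit (ratom _)) (ratom _)) (str_lun (ratom _)) comp1m.
  rewrite (@str_comp _ _ (rtens (rtens (ratom _) (ratom _)) (ratom _)) (rtens runit (ratom _))).
  rewrite (@str_comp _ _ (rtens (ratom _) (rtens (ratom _) (ratom _))) (rtens (rtens (ratom _)
    (ratom _)) (ratom _))).
  rewrite (str_ascV (ratom _) (ratom _) (ratom _)) comp1m.
  rewrite (@str_comp _ _ (rtens (ratom _) runit)) (str_runV (ratom _)) compm1.
  by rewrite (@str_rid _ (ratom B) (rtens (ratom _) (ratom _)) runit)
    (@str_lid _ (ratom _) runit).
exists g; split.
  apply: o11_inj; rewrite o11_comp gE o11_id; apply: mor_ext => Z z; rewrite -!compA.
  rw0 (esym (o11_nat (curry e) (o02 c _))); rw0 (tev_curry _ _); rw0 (z2 _).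
  by rewrite comp1m.
apply: uncurry_dual_inj; apply: str_inj; rewrite tensm1 compm1 str_comp str_rid.
rewrite -/(o20 (ev A) tunit) -/(o11 _ _) o11_comp gE.
apply: mor_ext => Z z; rewrite -!compA; rw0 (tev_curry _ _).
by rw0 (esym (o20_nat (ev A) (o20 e _))); rw1 (z1 _).
Qed.

(** An evaluation determines its coevaluation. [c'] is a natural family over tails, so a composite
    on words can be used without first bracketing it into a morphism. *)
Lemma coev_unique A B (e : Mor (B ⊗ A) tunit) (c : Mor tunit (A ⊗ B)) T
    (c' : forall T, Mor T (A ⊗ (B ⊗ T))) : dualpair e c ->
  (forall T T' (h : Mor T T'), c' T' ∘ h = (A ◁ B ◁ h) ∘ c' T) ->
  (forall T, (A ◁ o20 e T) ∘ c' (A ⊗ T) = idm (A ⊗ T)) -> o02 c T = c' T.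
Proof.
move=> [z1 z2] c'nat z1'; rewrite -[RHS]comp1m -(ltens1 A) -(z2 T) lcomp.
by rewrite -compA -c'nat compA z1' comp1m.
Qed.

Lemma ev_dualm X Y (f : Mor X Y) :
  ev X ∘ (dualm f ⊠ idm X) = ev Y ∘ (dual Y ◁ f).
Proof. exact: curryK. Qed.
Lemma dualm_comp X Y Z (g : Mor Y Z) (f : Mor X Y) : dualm (g ∘ f) = dualm f ∘ dualm g.
Proof.
apply: uncurry_dual_inj; rewrite rcomp compA !ev_dualm -[in RHS]compA -tens_inter compA ev_dualm.
by rewrite -compA -lcomp.
Qed.
Lemma dualm1 X : dualm (idm X) = idm _.
Proof. by apply: uncurry_dual_inj; rewrite ev_dualm !tensm1. Qed.
Lemma dualm_iso X Y (f : Mor X Y) : is_iso f -> is_iso (dualm f).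
Proof. by move=> [g [gf fg]]; exists (dualm g); rewrite -!dualm_comp gf fg !dualm1. Qed.

Lemma ev_kappa X : ev (dual X) ∘ (kappa X ⊠ idm (dual X)) = ev X ∘ swap X (dual X).
Proof. exact: curryK. Qed.
Lemma tev_kappa X T :
  o20 (ev (dual X)) T ∘ o11 (kappa X) (dual X ⊗ T) = o20 (ev X) T ∘ sw X (dual X) T.
Proof.
have := congr1 (fun f => str f T) (ev_kappa X).
rewrite (@str_comp _ _ (rtens (ratom _) (ratom _)) runit) str_rid.
by rewrite (@str_comp _ _ (rtens (ratom _) (ratom _)) runit).
Qed.

End Duals.

Section Symm.
Context {C : rigidCat}.
Implicit Types X Y Z T W L V : C.
Local Notation S n X := (SymPow n X).

Lemma tpowm_comp X Y Z (g : Mor Y Z) (f : Mor X Y) n : tpowm (g ∘ f) n = tpowm g n ∘ tpowm f n.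
Proof. by elim: n => [|n IHn] /=; rewrite ?comp1m // IHn tensm_comp. Qed.
Lemma tpowm1 X n : tpowm (idm X) n = idm _.
Proof. by elim: n => [|n IHn] //=; rewrite IHn tensm1. Qed.

Lemma tpowm_last_swap X Y (f : Mor X Y) n :
  tpowm f n.+2 ∘ last_swap X n = last_swap Y n ∘ tpowm f n.+2.
Proof. by rewrite !last_swapE [tpowm f n.+2]/= swap_last_nat. Qed.

Lemma tpowm_cycsum X Y (f : Mor X Y) n :
  tpowm f n.+1 ∘ cycsum X n = cycsum Y n ∘ tpowm f n.+1.
Proof.
elim: n => [|n IHn]; first by rewrite comp1m compm1.
rewrite [cycsum X _]/= [cycsum Y _]/= compDr compDl compm1 comp1m; congr (_ + _).
rewrite -compA -tpowm_last_swap !compA; congr (_ ∘ _).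
by rewrite [tpowm f n.+2]/= -!tensm_comp compm1 comp1m IHn.
Qed.

Lemma tpowm_symmetrizer X Y (f : Mor X Y) n :
  tpowm f n ∘ symmetrizer X n = symmetrizer Y n ∘ tpowm f n.
Proof.
elim: n => [|n IHn]; first by rewrite !symmetrizer0.
rewrite !symmetrizerS compZr compZl compA tpowm_cycsum; congr (_ *: _).
rewrite -!compA; congr (_ ∘ _).
by rewrite [tpowm f n.+1]/= -!tensm_comp compm1 comp1m IHn.
Qed.

Lemma Symm_comp X Y Z (g : Mor Y Z) (f : Mor X Y) n : Symm n (g ∘ f) = Symm n g ∘ Symm n f.
Proof.
rewrite /Symm tpowm_comp -!compA [in RHS](compA (symi n Y)) sympK.
rewrite [in RHS](compA (tpowm g n)) tpowm_symmetrizer -[in RHS]compA.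
by rewrite [in RHS](compA (symp n Z)) symp_symmetrizer.
Qed.
Lemma Symm1 X n : Symm n (idm X) = idm _.
Proof. by rewrite /Symm tpowm1 compm1 symiK. Qed.

Lemma Symm_mu X Y (f : Mor X Y) n : Symm n.+1 f ∘ mu n X = mu n Y ∘ (Symm n f ⊠ f).
Proof.
have -> : Symm n f ⊠ f = (symp n Y ⊠ idm Y) ∘ ((tpowm f n ∘ symi n X) ⊠ f).
  by rewrite -tensm_comp comp1m compA.
rewrite compA mu_symp /Symm -compA symi_mu -compA (compA (tpowm _ _)) tpowm_symmetrizer.
rewrite -compA compA symp_symmetrizer; congr (_ ∘ _).
by rewrite [tpowm f n.+1]/= -tensm_comp compm1.
Qed.

Lemma tSymm_mu X Y (f : Mor X Y) n T :
  o11 (Symm n.+1 f) T ∘ o21 (mu n X) T =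
  o21 (mu n Y) T ∘ (o11 (Symm n f) (Y ⊗ T) ∘ (S n X ◁ o11 f T)).
Proof.
have := Symm_mu f n; move: (Symm _ _) (Symm _ _) => s t.
move/(congr1 (fun f => str f T)).
rewrite (@str_comp _ (rtens (ratom _) (ratom _)) (ratom _) (ratom _)).
rewrite (@str_comp _ (rtens (ratom _) (ratom _)) (rtens (ratom _) (ratom _)) (ratom _)).
by rewrite str_tens.
Qed.
Lemma tSymm_0 X Y (f : Mor X Y) T :
  o11 (Symm 0 f) T ∘ o01 (symp 0 X) T = o01 (symp 0 Y) T.
Proof.
have E : Symm 0 f ∘ symp 0 X = symp 0 Y by rewrite /Symm -!compA sympK0 comp1m compm1.
by rewrite /o11 /o01 -E (@str_comp _ runit (ratom _) (ratom _)).
Qed.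

Variable V : C.
Local Notation A n := (SymPow n V).
Local Notation B n := (SymPow n (dual V)).
Local Notation V' := (dual V).

Lemma thetaS_iso k : is_iso (thetaS V k).
Proof. exact: dualpair_iso (dualpair_evS V k). Qed.
Lemma tev_thetaS k T : o20 (ev (A k)) T ∘ o11 (thetaS V k) (A k ⊗ T) = o20 (evS V k) T.
Proof. exact: tev_curry. Qed.
End Symm.

Section Bidual.
Context {C : rigidCat}.
Implicit Types T W : C.
Variable V : C.
Local Notation A n := (SymPow n V).
Local Notation B n := (SymPow n (dual V)).
Local Notation V' := (dual V).

(** The isomorphism from ∨^k V to ∨^k V^∨∨ that enters both the Laplace operator and the Poincaré
    morphisms. *)
Definition lamS k : Mor (A k) (SymPow k (dual V')) :=
  locked_with str_key (bidualS V k ∘ kappa (A k)).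
Lemma lamSE k : lamS k = bidualS V k ∘ kappa (A k).
Proof. by rewrite /lamS unlock. Qed.

Lemma lamS_iso k : is_iso (lamS k).
Proof.
rewrite lamSE; apply: is_iso_comp (kappa_iso _).
apply: is_iso_comp (dualm_iso (thetaS_iso _ _)).
exact: is_iso_invm (thetaS_iso _ _).
Qed.

Lemma evS_lamS k : evS V' k ∘ (lamS k ⊠ idm _) = evS V k ∘ swap (A k) (B k).
Proof.
rewrite -(ev_curry (evS V' k)) -/(thetaS V' k) -compA -rcomp lamSE /bidualS.
rewrite !compA (invmK (thetaS_iso V' k)).2 comp1m rcomp compA ev_dualm.
rewrite -compA -tens_inter compA ev_kappa -compA swap_nat compA.
by rewrite /thetaS ev_curry.
Qed.
Lemma tev_lamS k T :
  o20 (evS V' k) T ∘ o11 (lamS k) (B k ⊗ T) = o20 (evS V k) T ∘ sw (A k) (B k) T.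
Proof.
have := evS_lamS k; move: (evS _ _) (evS _ _) => p q; move/(congr1 (fun f => str f T)).
rewrite (@str_comp _ _ (rtens (ratom _) (ratom _)) runit) str_rid.
by rewrite (@str_comp _ _ (rtens (ratom _) (ratom _)) runit).
Qed.

Lemma lamS_unique k (f : Mor (A k) (SymPow k (dual V'))) :
  (forall T, o20 (evS V' k) T ∘ o11 f (B k ⊗ T) = o20 (evS V k) T ∘ sw (A k) (B k) T) ->
  f = lamS k.
Proof.
move=> H; apply: (cancel_mono (invmK (thetaS_iso V' k)).1).
apply: uncurry_dual_inj; rewrite !rcomp !compA /thetaS !ev_curry; apply: str_inj.
have {H} := etrans (H tunit) (esym (tev_lamS k tunit)).
by move: (evS V' k) => p; rewrite !(@str_comp _ _ (rtens (ratom _) (ratom _)) runit) !str_rid.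
Qed.

(** This is what lets the inverse reflexivities in [Ddown] cancel the bidual identifications. By
    [lamS_unique] only the pairing with [B k] has to be compared. *)
Lemma Symm_kappa k : Symm k (kappa V) = lamS k.
Proof.
apply: lamS_unique; elim: k => [|k IHk] T.
  apply: unit_epi; rewrite -!compA tSymm_0 o01_sw.
  apply: unit_epi; rewrite -!compA tev_0.
  by rewrite -(o01_nat (symp 0 V') (o01 (symp 0 V) T)) tev_0.
apply: mu_epi; apply: mor_ext => Z z; rewrite -!compA.
rw0 (tSymm_mu _ _ _); rw0 (tev_mul _ _ _); do 3!rw0 (esym (o11_nat (Symm k (kappa V)) _)).
rw0 (IHk _); rw1 (esym (o11_nat (kappa V) _)); rw1 (o11_sw _ _ _); rw2 (tev_kappa _ _).
rw0 (o21_sw _ _ _); rw0 (tev_mul' _ _ _); rw0 (sw_o12 _ _ _); rw1 (swK _ _ _).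
by rw1 (sw_o12 _ _ _); rw0 (sw_nat _ _ (o20 (ev V) T)).
Qed.
End Bidual.

(** * Poincaré morphisms *)

Section Dup.
Context {C : rigidCat}.
Implicit Types T W : C.
Local Notation A V n := (SymPow n V).
Local Notation B V n := (SymPow n (dual V)).

(* [x] is sent to the sum of [b^* ⊗ x b] over dual bases. *)
Definition polar (V : C) j k g : Mor (A V j) (B V k ⊗ A V g) :=
  locked_with str_key (swap (A V g) (B V k) ∘ ((mulS V j k g ⊠ idm (B V k)) ∘
    (ascV (A V j) (A V k) (B V k) ∘ ((A V j ◁ coevS V k) ∘ runV (A V j))))).
Lemma tpolar V j k g T : o12 (polar V j k g) T =
  sw (A V g) (B V k) T ∘ (o21 (mulS V j k g) (B V k ⊗ T) ∘ (A V j ◁ o02 (coevS V k) T)).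
Proof.
rewrite /polar unlock; move: (mulS _ _ _ _) (coevS _ _) => m c; rewrite /o12.
rewrite (@str_comp _ _ (rtens (ratom _) (ratom _)) (rtens (ratom _) (ratom _))).
rewrite (@str_comp _ _ (rtens (rtens (ratom _) (ratom _)) (ratom _)) (rtens (ratom _) (ratom _))).
rewrite (@str_comp _ _ (rtens (ratom _) (rtens (ratom _) (ratom _))) (rtens (rtens (ratom _)
  (ratom _)) (ratom _))).
rewrite (str_ascV (ratom _) (ratom _) (ratom _)) comp1m.
rewrite (@str_comp _ _ (rtens (ratom _) runit)) (str_runV (ratom _)) compm1.
rewrite (@str_rid _ (ratom (B V k)) (rtens (ratom _) (ratom _)) (ratom _)).
by rewrite (@str_lid _ (ratom _) runit (rtens (ratom _) (ratom _))).
Qed.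

Lemma tpairing_polar V j k g T Z (z : Mor Z (A V j ⊗ (dual (A V g) ⊗ (A V k ⊗ T)))) :
  o20 (evS V k) T ∘ ((B V k ◁ o20 (ev (A V g)) (A V k ⊗ T)) ∘
    ((B V k ◁ sw (A V g) (dual (A V g)) (A V k ⊗ T)) ∘ (o12 (polar V j k g) _ ∘ z))) =
  o20 (ev (A V g)) T ∘ ((dual (A V g) ◁ o21 (mulS V j k g) T) ∘
    (sw (A V j) (dual (A V g)) (A V k ⊗ T) ∘ z)).
Proof.
have [z1 z2] := dualpair_evS V k.
rewrite tpolar -!compA.
rw0 (esym (sw_o20 (B V k) _ _)).
rw0 (esym (swYB (A V g) (B V k) _ _)); rw1 (swK _ _ _).
rw0 (esym (o21_nat (mulS V j k g) (sw (B V k) _ _))); rw0 (o21_sw _ _ _); rw1 (o02_sw _ _ _).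
rw0 (sw_nat _ _ (o02 (coevS V k) _)); rw0 (esym (o20_nat (ev (A V g)) (o20 (evS V k) T))).
by rw1 (esym (o21_nat (mulS V j k g) (o20 (evS V k) T))); rw2 (z1 _).
Qed.

(** After uncurrying twice both sides are morphisms to the unit, related by [tpairing_polar]. Thus
    the inverse of [alpha] in D^{j,g} never has to be computed. *)
Lemma alpha_polar V j k g :
  alpha (dual (A V g)) (dual (A V k)) ∘ ((thetaS V k ⊠ kappa (A V g)) ∘ polar V j k g) =
  transp (A V k) (A V g) ∘ curry (mulS V j k g).
Proof.
apply: uncurry_inj; rewrite !rcomp !compA /alpha /transp !curryK.
apply: uncurry_dual_inj; rewrite !rcomp !compA.
rewrite ev_curry.
have -> : ev (A V g) ∘ (dual (A V g) ◁ evh (A V k) (A V g)) ∘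
  asc (dual (A V g)) (ihom (A V k) (A V g)) (A V k)
    ∘ (swap (ihom (A V k) (A V g)) (dual (A V g)) ⊠ idm (A V k))
    ∘ (curry (mulS V j k g) ⊠ idm (dual (A V g)) ⊠ idm (A V k)) =
  ev (A V g) ∘ ((dual (A V g) ◁ mulS V j k g) ∘ (asc (dual (A V g)) (A V j) (A V k)
    ∘ (swap (A V j) (dual (A V g)) ⊠ idm (A V k)))).
  rewrite -!compA -rcomp swap_nat rcomp (compA (asc _ _ _)) asc_nat -!compA.
  by rewrite (compA (dual (A V g) ◁ evh _ _)) -lcomp curryK.
move: (@tpairing_polar V j k g) (tev_thetaS V k) (tev_kappa (A V g)).
move: (polar V j k g) (mulS V j k g) (thetaS V k) (kappa (A V g))
  (evS V k) => f m th ka e E thE kaE.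
rewrite -!compA; apply: (@str_inj _ (rtens (rtens (ratom _) (ratom _)) (ratom _)) runit).
rewrite (@str_comp _ _ (rtens (ratom _) (ratom _)) runit).
rewrite (@str_comp _ _ (rtens (rtens (ratom _) runit) (ratom _)) (rtens (ratom _) (ratom _))).
rewrite (@str_rid _ (ratom _) (rtens (ratom _) runit) (ratom _)) (str_run (ratom _)) comp1m.
rewrite (@str_comp _ _ (rtens (rtens (ratom _) (rtens (ratom _) (ratom _))) (ratom _)) (rtens
  (rtens (ratom _) runit) (ratom _))).
rewrite (@str_rid _ (ratom _) (rtens (ratom _) (rtens (ratom _) (ratom _))) (rtens
  (ratom _) runit)).
rewrite (@str_lid _ (ratom _) (rtens (ratom _) (ratom _)) runit).
rewrite (@str_comp _ _ (rtens (rtens (rtens (ratom _) (ratom _)) (ratom _)) (ratom _)) (rtens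
  (rtens (ratom _) (rtens (ratom _) (ratom _))) (ratom _))).
rewrite (@str_rid _ (ratom _) (rtens (rtens (ratom _) (ratom _)) (ratom _)) (rtens (ratom _)
  (rtens (ratom _) (ratom _)))).
rewrite (str_asc (ratom _) (ratom _) (ratom _)) comp1m.
rewrite (@str_comp _ _ (rtens (rtens (rtens (ratom _) (ratom _)) (ratom _)) (ratom _)) (rtens
  (rtens (rtens (ratom _) (ratom _)) (ratom _)) (ratom _))).
rewrite (@str_rid _ (ratom _) (rtens (rtens (ratom _) (ratom _)) (ratom _)) (rtens (rtens
  (ratom _) (ratom _)) (ratom _))).
rewrite (@str_rid _ (ratom _) (rtens (ratom _) (ratom _)) (rtens (ratom _) (ratom _))).
rewrite (@str_tens _ (ratom _) (ratom _) (ratom _) (ratom _)).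
rewrite (@str_rid _ (ratom _) (rtens (ratom _) (ratom _)) (rtens (rtens (ratom _) (ratom _))
  (ratom _))).
rewrite (@str_rid _ (ratom _) (ratom _) (rtens (ratom _) (ratom _))).
rewrite (@str_comp _ _ (rtens (ratom _) (ratom _)) runit).
rewrite (@str_comp _ _ (rtens (ratom _) (rtens (ratom _) (ratom _))) (rtens (ratom _) (ratom _))).
rewrite (@str_lid _ (ratom _) (rtens (ratom _) (ratom _)) (ratom _)).
rewrite (@str_comp _ _ (rtens (rtens (ratom _) (ratom _)) (ratom _)) (rtens (ratom _) (rtens
  (ratom _) (ratom _)))).
rewrite (str_asc (ratom _) (ratom _) (ratom _)) comp1m.
rewrite (@str_rid _ (ratom _) (rtens (ratom _) (ratom _)) (rtens (ratom _) (ratom _))).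
have := E tunit _ (idm _); rewrite !compm1; rewrite -thE -!compA => <-.
rw0 (esym (o11_nat th _)); rw1 (kaE _).
by [].
Qed.

Lemma Dup_polar V j k g : Dup V j k g = (B V k ◁ lamS V g) ∘ polar V j k g.
Proof.
rewrite /Dup -!compA -alpha_polar (compA (invm (alpha _ _))) (invmK (alpha_iso _ _)).1 comp1m.
by rewrite compA -tensm_comp (invmK (thetaS_iso _ _)).1 lamSE.
Qed.

Lemma tDup V j k g T :
  o12 (Dup V j k g) T = (B V k ◁ o11 (lamS V g) T) ∘ o12 (polar V j k g) T.
Proof.
rewrite Dup_polar; move: (polar _ _ _ _) (lamS _ _) => f l; rewrite /o12.
rewrite (@str_comp _ _ (rtens (ratom _) (ratom _)) (rtens (ratom _) (ratom _))).
by rewrite (@str_lid _ (ratom _) (ratom _) (ratom _)).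
Qed.

Lemma tcoevS_dual V k T :
  o02 (coevS (dual V) k) T =
  (B V k ◁ o11 (lamS V k) T) ∘ (sw (A V k) (B V k) T ∘ o02 (coevS V k) T).
Proof.
have [z1 z2] := dualpair_evS V k.
pose c' T := (B V k ◁ o11 (lamS V k) T) ∘ (sw (A V k) (B V k) T ∘ o02 (coevS V k) T).
rewrite -/(c' T); apply: coev_unique (dualpair_evS (dual V) k) _ _ => [U U' h|U]; rewrite /c'.
  apply: mor_ext => Z z; rewrite -!compA.
  by rw0 (o02_nat (coevS V k) h); rw0 (sw_nat _ _ h); rw1 (o11_nat (lamS V k) h).
apply: mor_ext => Z z; rewrite -!compA comp1m.
rw1 (tev_lamS _ _ _).
rw0 (sw_o02 (B V k) (coevS V k) U).
rw0 (swYB (A V k) (B V k) (B V k) U); rw0 (swK _ _ _).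
rw0 (esym (o20_swr (B V k) (evS V k) U)); rw1 (swK _ _ _).
by rw0 (z2 _).
Qed.

Lemma evS_inj V k X T (f h : Mor X (A V k ⊗ T)) :
  o20 (evS V k) T ∘ (B V k ◁ f) = o20 (evS V k) T ∘ (B V k ◁ h) -> f = h.
Proof. move=> fh; exact: (dual_inj (dualpair_evS V k) fh). Qed.

(** The inverse reflexivities cancel the two [lamS], and θ is sent to the sum of b ⊗ θ b^* over dual
    bases of [A k]. *)
Lemma tDdown V j k g T : o12 (Ddown V j k g) T =
  sw (B V g) (A V k) T ∘ (o21 (mulS (dual V) j k g) (A V k ⊗ T) ∘
    ((B V j ◁ sw (A V k) (B V k) T) ∘ (B V j ◁ o02 (coevS V k) T))).
Proof.
have K (X : C) n U : o11 (Symm n (invm (kappa X))) U ∘ o11 (lamS X n) U = idm (A X n ⊗ U).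
  by rewrite -o11_comp -Symm_kappa -Symm_comp (invmK (kappa_iso X)).1 Symm1 o11_id.
rewrite /Ddown; move: (Symm k _) (Symm g _) (@K V k) (@K (dual V) g) => a b Ka Kb.
transitivity (o11 a (B V g ⊗ T) ∘ ((A (dual (dual V)) k ◁ o11 b T) ∘ o12 (Dup (dual V) j k g) T)).
  move: (Dup _ _ _ _) => d; rewrite /o12.
  rewrite (@str_comp _ _ (rtens (ratom _) (ratom _)) (rtens (ratom _) (ratom _))).
  by rewrite (@str_tens _ (ratom _) (ratom _) (ratom _) (ratom _)) -!compA.
rewrite tDup tpolar tcoevS_dual !lcomp; apply: mor_ext => Z z; rewrite -!compA.
rw1 (Kb _).
rw0 (o21_nat (mulS (dual V) j k g) (o11 (lamS V k) T)).
by rw0 (esym (sw_o11 _ (lamS V k) _)); rw0 (Ka _).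
Qed.

Lemma tev_Ddown V j k g T :
  o20 (evS V k) (B V g ⊗ T) ∘ (B V k ◁ o12 (Ddown V j k g) T) =
  o21 (mulS (dual V) j k g) T ∘ sw (B V k) (B V j) T.
Proof.
have [z1 z2] := dualpair_evS V k.
rewrite tDdown !lcomp; apply: mor_ext => Z z; rewrite -!compA.
rw0 (o20_swr (B V g) (evS V k) T); rw0 (esym (sw_o21 (B V k) _ _)).
rw0 (esym (o21_nat (mulS (dual V) j k g) (o20 (evS V k) T))).
rw1 (esym (o20_swr (B V k) (evS V k) T)).
rw0 (sw_nat (B V k) (B V j) (sw (A V k) (B V k) T)); rw2 (swK _ _ _).
by rw0 (sw_nat (B V k) (B V j) (o02 (coevS V k) T)); rw1 (z2 _).
Qed.

Lemma tevtau V g T : o20 (evtau V g) T ∘ (B V g ◁ o11 (lamS V g) T) = o20 (evS V g) T.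
Proof.
rewrite /evtau; move: (tev_lamS V g T); move: (evS (dual V) g) => p E.
rewrite {1}/o20 (@str_comp _ _ (rtens (ratom _) (ratom _)) runit).
rewrite -/(o20 p T) -/(sw _ _ T) -compA -sw_o11 compA E -compA swK compm1.
by [].
Qed.

Lemma tpairing_bar V i j k g T (L := SymPow g (dual (dual V))) : o21 (pairing_bar V i j k g) T =
  (A V k ◁ o20 (evtau V g) T) ∘ (o12 (Ddown V (i + j) k g) (L ⊗ T) ∘
    (o21 (mulS (dual V) i j (i + j)) (L ⊗ T) ∘ ((B V i ◁ sw L (B V j) T) ∘
      o12 (Dup V i i g) (B V j ⊗ T)))).
Proof.
rewrite /pairing_bar -/L /mulS13.
move: (Ddown _ _ _ _) (mulS _ _ _ _) (Dup _ _ _ _) (evtau _ _) => d m u e.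
have E := @str_swap_last C (ratom (B V i)) (ratom L) (ratom (B V j)) T.
move: (swap_last _ _ _) E => s E; rewrite -!compA.
rewrite /o21 (@str_comp _ _ (rtens (ratom _) runit) (ratom _)) (str_run (ratom _)) comp1m.
rewrite (@str_comp _ _ (rtens (ratom _) (rtens (ratom _) (ratom _))) (rtens (ratom _) runit)).
rewrite (@str_lid _ (ratom _) (rtens (ratom _) (ratom _)) runit).
rewrite (@str_comp _ _ (rtens (rtens (ratom _) (ratom _)) (ratom _)) (rtens (ratom _) (rtens
  (ratom _) (ratom _)))).
rewrite (str_asc (ratom _) (ratom _) (ratom _)) comp1m.
rewrite (@str_comp _ _ (rtens (ratom _) (ratom _)) (rtens (rtens (ratom _) (ratom _)) (ratom _))).
rewrite (@str_rid _ (ratom _) (ratom _) (rtens (ratom _) (ratom _))).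
rewrite (@str_comp _ _ (rtens (rtens (ratom _) (ratom _)) (ratom _)) (rtens (ratom _) (ratom _))).
rewrite (@str_rid _ (ratom _) (rtens (ratom _) (ratom _)) (ratom _)).
rewrite (@str_comp _ _ (rtens (rtens (ratom _) (ratom _)) (ratom _)) (rtens (rtens (ratom _)
  (ratom _)) (ratom _))).
rewrite (@str_rid _ (ratom _) (ratom _) (rtens (ratom _) (ratom _))) E.
by [].
Qed.

(** For θ in [B k], η in [B j] and x in [A i], the left side unfolds to the sum of the pairings of θ
    η b^* with x b over dual bases of [A i]. Associativity and commutativity group θ η together, so
    that [tev_loops] applies. *)
Lemma tev_pairing_bar V i j k g T : i = (j + k)%N -> g = (i + i)%N ->
  o20 (evS V k) T ∘ (B V k ◁ o21 (pairing_bar V i j k g) T) =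
  escale (loopcoef V i i) (o20 (evS V i) T ∘
    (o21 (mulS (dual V) k j i) (A V i ⊗ T) ∘ (B V k ◁ sw (A V i) (B V j) T))).
Proof.
move=> iE gE.
rewrite -(@tev_loops _ V i i g T _ _ gE) tpairing_bar tDup !lcomp -/(B (dual V) g).
apply: mor_ext => Z z; rewrite -!compA.
rw0 (o20_nat (evS V k) (o20 (evtau V g) T)); rw0 (tev_Ddown _ _ _ _ _).
rw2 (o11_sw (B V j) (lamS V g) T).
rw1 (o21_nat (mulS (dual V) i j (i + j)) (o11 (lamS V g) T)).
rw0 (sw_nat (B V k) (B V (i + j)) (o11 (lamS V g) T)).
rw0 (o21_nat (mulS (dual V) (i + j) k g) (o11 (lamS V g) T)).
rw0 (tevtau _ _ _).
have P : (B V i ◁ sw (A V g) (B V j) T) ∘ o12 (polar V i i g) (B V j ⊗ T) =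
    sw (B V j) (B V i) (A V g ⊗ T) ∘ ((B V j ◁ o12 (polar V i i g) T) ∘ sw (A V i) (B V j) T).
  by rewrite -o12_sw compA swK comp1m.
have gE' : g = (i + j + k)%N by rewrite gE {2}iE addnA.
rw1 P; rw1 (tmulS_comm (dual V) _ (erefl (i + j)%N)); rw0 (tmulS_comm (dual V) _ gE').
rw0 (esym (tmulS_assoc (dual V) _ iE (erefl (i + j)%N) gE')); rewrite tpolar !lcomp -!compA.
rw0 (esym (o21_nat (mulS (dual V) k j i) (A V i ◁ _))).
rw0 (esym (o21_nat (mulS (dual V) k j i) (o21 (mulS V i i g) _))).
by rw0 (esym (o21_nat (mulS (dual V) k j i) (sw (A V g) _ _))).
Qed.

Lemma tpairing_bar_V V m g T : g = (m.+1 + m.+1)%N ->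
  o11 (of_Sym1 V) T ∘ o21 (pairing_bar V m.+1 m 1 g) T =
  escale (loopcoef V m.+1 m.+1) (o20 (evS V m) (V ⊗ T) ∘
    (sw (A V m) (B V m) (V ⊗ T) ∘ ((A V m ◁ sw V (B V m) T) ∘ o12 (nu m V) (B V m ⊗ T)))).
Proof.
move=> gE; have iE : m.+1 = (m + 1)%N by rewrite addn1.
(* The comparison takes place in the first symmetric power, where [evS_inj] tests against that of
   [dual V]. *)
suff E : o21 (pairing_bar V m.+1 m 1 g) T = o11 (to_Sym1 V) T ∘
    escale (loopcoef V m.+1 m.+1) (o20 (evS V m) (V ⊗ T) ∘
    (sw (A V m) (B V m) (V ⊗ T) ∘ ((A V m ◁ sw V (B V m) T) ∘ o12 (nu m V) (B V m ⊗ T)))).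
  by rewrite E compA tto_Sym1K comp1m.
apply: evS_inj; rewrite (tev_pairing_bar V T iE gE) escale_compr escale_l escale_compr.
congr escale.
apply: (cancel_epi (tof_Sym1K (dual V) _)).
rewrite !lcomp; apply: mor_ext => Z z; rewrite -!compA.
rw0 (esym (o11_nat (to_Sym1 (dual V)) (sw (A V m.+1) _ _))); rw0 (tmulS_1l (dual V) _ _).
do 5!rw0 (esym (o11_nat (to_Sym1 (dual V)) _)); rw0 (tev_1 V _).
rw0 (tev_mul V _ _); rw0 (esym (sw_nat (dual V) (B V m) (o12 (nu m V) T))).
rw1 (esym (o12_sw (B V m) (nu m V) T)); rw0 (o20_nat (evS V m) (o20 (ev V) T)).
by rw0 (sw_o20 (dual V) (evS V m) _).
Qed.

Lemma tpairing_bar_dual V m g T : g = (m.+1 + m.+1)%N ->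
  o21 (pairing_bar V m.+1 1 m g) T ∘ (A V m.+1 ◁ o11 (to_Sym1 (dual V)) T) =
  escale (loopcoef V m.+1 m.+1) ((A V m ◁ o20 (ev V) T) ∘
    ((A V m ◁ sw V (dual V) T) ∘ o12 (nu m V) (dual V ⊗ T))).
Proof.
move=> gE; apply: evS_inj; rewrite lcomp compA (tev_pairing_bar V T (esym (add1n m)) gE).
rewrite escale_l escale_compr escale_compl; congr escale.
rewrite !lcomp; apply: mor_ext => Z z; rewrite -!compA.
rw1 (esym (sw_o11 _ (to_Sym1 (dual V)) T)); rw0 (tmulS_1 (dual V) _ _); rw0 (tev_mul V _ _).
by rw1 (esym (o12_sw (dual V) (nu m V) T)); rw1 (swK _ _ _).
Qed.
End Dup.

Section Slide2.
Context {C : closedSymMonCat}.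
Implicit Types X Y Z T W : C.
Lemma o20_sw_sw X Y Z (f : Mor (Z ⊗ X) tunit) T :
  o20 f (Y ⊗ T) ∘ (sw X Z (Y ⊗ T) ∘ (X ◁ sw Y Z T)) =
  (Y ◁ o20 f T) ∘ ((Y ◁ sw X Z T) ∘ sw X Y (Z ⊗ T)).
Proof.
apply: mor_ext => S z; rewrite -!compA -(sw_o20 Y f T) -!compA.
by rw0 (esym (swYB X Y Z T)); rw1 (swK _ _ _).
Qed.
End Slide2.

(** * Dirac operators *)

Section Identities.
Context {C : rigidCat} (V : C).
Implicit Types T W : C.
Local Notation A n := (SymPow n V).
Local Notation B n := (SymPow n (dual V)).
Local Notation V' := (dual V).

(** Contracting the sum of b^* ⊗ x b with y in [A k] replaces b by y and returns x y. *)
Lemma tev_polar j k g T :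
  o20 (evS V k) (A g ⊗ T) ∘ (sw (A k) (B k) (A g ⊗ T) ∘ (A k ◁ o12 (polar V j k g) T)) =
  o21 (mulS V j k g) T ∘ sw (A k) (A j) T.
Proof.
have [z1 z2] := dualpair_evS V k.
rewrite tpolar !lcomp; apply: mor_ext => Z z; rewrite -!compA.
rw1 (o21_sw (B k) (mulS V j k g) T); rw0 (sw_nat (A k) (B k) (o21 (mulS V j k g) T)).
rw0 (o20_nat (evS V k) (o21 (mulS V j k g) T)); rw0 (o20_sw_sw _ (evS V k) _).
rw0 (sw_nat (A k) (A j) (sw (A k) _ _)); rw0 (sw_nat (A k) (A j) (o02 _ _)).
by rw1 (o20_sw_sw _ (evS V k) _); rw1 (esym (sw_o02 _ _ _)); rw1 (z1 _).
Qed.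

Variables (m N : nat).
Hypothesis NE : N = (m.+1 + m)%N.
Local Notation L := (SymPow N.+1 (dual V')).

(** In elements, with [nu] x = x' ⊗ x'', the composite of the two pairings sends x ⊗ y ⊗ v to a
    multiple of x'' ⊗ x' y v: contraction with x puts x' in place of the basis element b. *)
Lemma tdirac_bar_V T :
  o11 (of_Sym1 V) (L ⊗ T) ∘ (o21 (pairing_bar V m.+1 m 1 N.+1) (L ⊗ T) ∘
    (A m.+1 ◁ (o12 (Dup V m.+2 m N.+1) T ∘ o21 (mu m.+1 V) T))) =
  escale (loopcoef V m.+1 m.+1) ((V ◁ o11 (lamS V N.+1) T) ∘ ((V ◁ o21 (mu N V) T) ∘
    (sw (A N) V (V ⊗ T) ∘ (o21 (mulS V m m.+1 N) (V ⊗ (V ⊗ T)) ∘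
      ((A m ◁ sw V (A m.+1) (V ⊗ T)) ∘ o12 (nu m V) (A m.+1 ⊗ (V ⊗ T))))))).
Proof.
have gE : N.+1 = (m.+1 + m.+1)%N by rewrite NE addnS.
rewrite compA (tpairing_bar_V V _ gE) escale_compl; congr escale.
rewrite tDup !lcomp; apply: mor_ext => Z z; rewrite -!compA.
rw0 (o12_nat (nu m V) (B m ◁ o11 (lamS V N.+1) T)).
rw1 (sw_nat V (B m) (o11 (lamS V N.+1) T)); rw0 (sw_nat (A m) (B m) (V ◁ o11 (lamS V N.+1) T)).
rw0 (o20_nat (evS V m) (V ◁ o11 (lamS V N.+1) T)); rw0 (o20_sw_sw _ (evS V m) _).
rw0 (o12_nat (nu m V) (o12 (polar V m.+2 m N.+1) T)).
rw0 (o12_nat (nu m V) (o21 (mu m.+1 V) T)).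
rw0 (sw_nat (A m) V (o12 (polar V m.+2 m N.+1) T)).
rw1 (tev_polar _ _ _ _).
have gE' : N.+1 = (m.+2 + m)%N by rewrite NE.
rw1 (tmulS_comm V _ gE').
rw0 (sw_nat (A m) V (o21 (mu m.+1 V) T)); rw1 (tmulS_S V T NE).
by rw0 (o21_sw V (mulS V m m.+1 N) (V ⊗ T)); rw1 (swK _ _ _).
Qed.

Local Notation ratio := (N.+1%:R / m.+1%:R : rat).

Lemma tmulS_nu_sw T :
  o21 (mulS V m m.+1 N) (V ⊗ T) ∘ ((A m ◁ sw V (A m.+1) T) ∘
    (o12 (nu m V) (A m.+1 ⊗ T) ∘ sw (A m.+1) (A m.+1) T)) =
  o21 (mulS V m.+1 m N) (V ⊗ T) ∘ (A m.+1 ◁ o12 (nu m V) T).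
Proof.
have NE' : N = (m + m.+1)%N by rewrite NE addnC.
apply: mor_ext => S z; rewrite -!compA -(tmulS_comm V _ NE') -!compA.
by rw0 (sw_o12 (A m.+1) (nu m V) T); rw1 (swK _ _ _).
Qed.

(** [H] and [H'] are the two Leibniz terms for a product of two elements of [A m.+1], so their sum
    depends on the product alone. This is the origin of the factor g/i in ρ^i. *)
Lemma tnu_mulS_sym T Z (G : Mor (A N ⊗ (V ⊗ T)) Z) (H H' : Mor (A m.+1 ⊗ (A m.+1 ⊗ T)) Z) :
  H = G ∘ (o21 (mulS V m m.+1 N) (V ⊗ T) ∘ ((A m ◁ sw V (A m.+1) T) ∘
    o12 (nu m V) (A m.+1 ⊗ T))) ->
  H' = G ∘ (o21 (mulS V m.+1 m N) (V ⊗ T) ∘ (A m.+1 ◁ o12 (nu m V) T)) ->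
  H + H' = ratio *: (G ∘ (o12 (nu N V) T ∘ o21 (mulS V m.+1 m.+1 N.+1) T)).
Proof.
move=> -> ->; apply: (scalerI (natS_neq0 m)).
rewrite scalerA mulrC -mulrA mulVf ?natS_neq0 // mulr1 -[RHS]compZr (tnu_mulS V T NE) /nu_right.
by rewrite -scalerDr compZr compDr.
Qed.

Lemma tcoevS_1 T :
  (A 1 ◁ o11 (of_Sym1 V') T) ∘ o02 (coevS V 1) T = o11 (to_Sym1 V) (V' ⊗ T) ∘ o02 (coev V) T.
Proof.
rewrite tcoev_S tcoev_0; apply: mor_ext => S z; rewrite -!compA !tto_Sym1 -!compA.
rw0 (esym (o01_nat (symp 0 V) (sw _ _ _))); rw0 (o01_sw V (symp 0 V') _).
rw0 (o01_nat (symp 0 V) (V ◁ o01 (symp 0 V') _)); rw0 (o21_nat (mu 0 V) (o01 (symp 0 V') _)).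
have E : o11 (of_Sym1 V') T ∘ (o21 (mu 0 V') T ∘ o01 (symp 0 V') (V' ⊗ T)) = idm _.
  by rewrite -tto_Sym1 tto_Sym1K.
by rw1 E.
Qed.

Lemma tof_polar T :
  o11 (of_Sym1 V') (A N.+1 ⊗ T) ∘ o12 (polar V N 1 N.+1) T =
  sw (A N.+1) V' T ∘ (o21 (mu N V) (V' ⊗ T) ∘ (A N ◁ o02 (coev V) T)).
Proof.
rewrite tpolar; apply: mor_ext => S z; rewrite -!compA.
rw0 (sw_o11 (A N.+1) (of_Sym1 V') T); rw0 (esym (o21_nat (mulS V N 1 N.+1) (o11 (of_Sym1 V') T))).
by rw1 (tcoevS_1 T); rw0 (tmulS_1 V _ _).
Qed.

(** In elements, with [nu] y = y' ⊗ y'', the image of x ⊗ y ⊗ ξ is a multiple of the sum of e^* ⊗ x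
    y' e over a basis of V, weighted by the pairing of ξ with y''. *)
Lemma tdirac_dual T :
  o11 (of_Sym1 V') (L ⊗ T) ∘ (o12 (Dup V N 1 N.+1) T ∘ (o21 (mulS V m.+1 m N) T ∘
    (A m.+1 ◁ (o21 (pairing_bar V m.+1 1 m N.+1) T ∘ (A m.+1 ◁ o11 (to_Sym1 V') T))))) =
  escale (loopcoef V m.+1 m.+1) ((V' ◁ o11 (lamS V N.+1) T) ∘
    (sw (A N.+1) V' T ∘ (o21 (mu N V) (V' ⊗ T) ∘ ((A N ◁ o02 (coev V) T) ∘
    ((A N ◁ o20 (ev V) T) ∘ ((A N ◁ sw V V' T) ∘
    (o21 (mulS V m.+1 m N) (V ⊗ (V' ⊗ T)) ∘ (A m.+1 ◁ o12 (nu m V) (V' ⊗ T))))))))).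
Proof.
have gE : N.+1 = (m.+1 + m.+1)%N by rewrite NE addnS.
rewrite (tpairing_bar_dual V _ gE) escale_l !escale_compr; congr escale.
rewrite tDup !lcomp; apply: mor_ext => Z z; rewrite -!compA.
rw0 (o11_nat (of_Sym1 V') (o11 (lamS V N.+1) T)); rw0 (tof_polar T).
rw0 (o21_nat (mulS V m.+1 m N) (o20 (ev V) T)).
by rw0 (o21_nat (mulS V m.+1 m N) (sw V V' T)).
Qed.
Hypotheses (inv : invertible (A N.+1)) (rk : rank (A N.+1) * rank (A N.+1) = 1).

(** ρ^i as it arises: the Leibniz ratio, the constant of [tev_pairing_bar] and that of
    [invertible_mu_nu]. See [rho_symE]. *)
Definition rho_sym : Endo (@tunit C) :=
  ratio *: (loopcoef V m.+1 m.+1 * (rank (A N.+1) * loopcoef V 1 N)).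

Lemma tdirac_bar_V_sym T (G := o11 (of_Sym1 V) (L ⊗ T) ∘
  (o21 (pairing_bar V m.+1 m 1 N.+1) (L ⊗ T) ∘
    (A m.+1 ◁ (o12 (Dup V m.+2 m N.+1) T ∘ o21 (mu m.+1 V) T)))) :
  G + (G ∘ sw (A m.+1) (A m.+1) (V ⊗ T)) =
  escale rho_sym ((V ◁ o11 (lamS V N.+1) T) ∘ (sw (A N.+1) V T ∘
    o21 (mulS V m.+1 m.+1 N.+1) (V ⊗ T))).
Proof.
rewrite /G tdirac_bar_V escale_compl -escaleDr /rho_sym escaleZl escaleM -escaleZr.
congr escale; rewrite -[X in X + _]compm1.
set F := (V ◁ o11 (lamS V N.+1) T) ∘ ((V ◁ o21 (mu N V) T) ∘ sw (A N) V (V ⊗ T)).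
rewrite (@tnu_mulS_sym (V ⊗ T) _ F).
- congr (_ *: _).
  have E S (y : Mor S (A N.+1 ⊗ (V ⊗ T))) :
      (V ◁ o21 (mu N V) T) ∘ (sw (A N) V (V ⊗ T) ∘ (o12 (nu N V) (V ⊗ T) ∘ y)) =
      escale (rank (A N.+1) * loopcoef V 1 N) (sw (A N.+1) V T ∘ y).
    rewrite -[y in RHS]comp1m -escale_compr -escale_compl -(invertible_mu_nu _ inv rk) -!compA.
    by rw0 (o21_sw V (mu N V) T); rw1 (swK _ _ _).
  rewrite /F; apply: mor_ext => Z z; rewrite escale_compl -!compA E.
  by rewrite escale_compr.
- by rewrite /F compm1 -!compA.
by rewrite /F -!compA tmulS_nu_sw.
Qed.

Lemma dualpair_swap (X Y : C) (e : Mor (Y ⊗ X) tunit) (c : Mor tunit (X ⊗ Y)) T : dualpair e c ->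
  (Y ◁ o20 e T) ∘ ((Y ◁ sw X Y T) ∘ (sw X Y (Y ⊗ T) ∘ o02 c (Y ⊗ T))) = idm (Y ⊗ T).
Proof.
move=> [z1 z2]; apply: mor_ext => Z z; rewrite -!compA comp1m (sw_o02 Y c T) -!compA.
rw0 (swYB X Y Y T); rw0 (swK _ _ _); rw0 (esym (o20_swr Y e T)); rw1 (swK _ _ _).
by rw0 (z2 _).
Qed.

(** Creating the pair e ⊗ e^* before contracting lets [invertible_mu_nu] trade the removed letter of
    V for the created one; a triangle identity with crossings remains. *)
Lemma tcoev_ev_nu T :
  sw (A N.+1) V' T ∘ (o21 (mu N V) (V' ⊗ T) ∘ ((A N ◁ o02 (coev V) T) ∘
    ((A N ◁ o20 (ev V) T) ∘ ((A N ◁ sw V V' T) ∘ o12 (nu N V) (V' ⊗ T))))) =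
  escale (rank (A N.+1) * loopcoef V 1 N) (sw (A N.+1) V' T).
Proof.
apply: mor_ext => Z z; rewrite escale_compl -!compA.
rw1 (o02_nat (coev V) (o20 (ev V) T)); rw1 (o02_nat (coev V) (sw V V' T)).
rw1 (sw_o02 V (coev V) _).
rw0 (o21_nat (mu N V) (V' ◁ o20 (ev V) T)); rw0 (o21_nat (mu N V) (V' ◁ sw V V' T)).
rw0 (o21_nat (mu N V) (sw V V' (V' ⊗ T))).
rw0 (esym (o12_nat (nu N V) (o02 (coev V) (V' ⊗ T)))).
have E S (y : Mor S (A N.+1 ⊗ (V ⊗ (V' ⊗ (V' ⊗ T))))) :
    o21 (mu N V) (V ⊗ (V' ⊗ (V' ⊗ T))) ∘ ((A N ◁ sw V V (V' ⊗ (V' ⊗ T))) ∘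
      (o12 (nu N V) (V ⊗ (V' ⊗ (V' ⊗ T))) ∘ y)) = escale (rank (A N.+1) * loopcoef V 1 N) y.
  by rewrite -[y in RHS]comp1m -escale_compl -(invertible_mu_nu _ inv rk) -!compA.
rewrite E !escale_compr; congr escale.
by rw1 (dualpair_swap T (dualpair_ev V)).
Qed.

Lemma tdirac_dual_sym T (G := o11 (of_Sym1 V') (L ⊗ T) ∘ (o12 (Dup V N 1 N.+1) T ∘
  (o21 (mulS V m.+1 m N) T ∘
    (A m.+1 ◁ (o21 (pairing_bar V m.+1 1 m N.+1) T ∘ (A m.+1 ◁ o11 (to_Sym1 V') T)))))) :
  G + (G ∘ sw (A m.+1) (A m.+1) (V' ⊗ T)) =
  escale rho_sym ((V' ◁ o11 (lamS V N.+1) T) ∘ (sw (A N.+1) V' T ∘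
    o21 (mulS V m.+1 m.+1 N.+1) (V' ⊗ T))).
Proof.
rewrite /G tdirac_dual escale_compl -escaleDr /rho_sym escaleZl escaleM -escaleZr.
congr escale; rewrite -[X in X + _]compm1 addrC.
set F := (V' ◁ o11 (lamS V N.+1) T) ∘ (sw (A N.+1) V' T ∘ (o21 (mu N V) (V' ⊗ T) ∘
  ((A N ◁ o02 (coev V) T) ∘ ((A N ◁ o20 (ev V) T) ∘ (A N ◁ sw V V' T))))).
rewrite (@tnu_mulS_sym (V' ⊗ T) _ F).
- congr (_ *: _); rewrite /F; apply: mor_ext => Z z; rewrite escale_compl -!compA.
  have := congr1 (fun f => f ∘ (o21 (mulS V m.+1 m.+1 N.+1) (V' ⊗ T) ∘ z)) (tcoev_ev_nu T).
  by rewrite escale_compl -!compA => ->; rewrite escale_compr.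
- by rewrite /F -tmulS_nu_sw -!compA swK compm1.
by rewrite /F compm1 -!compA.
Qed.
End Identities.

(** * From pairings to operators *)

Section OperatorTails.
Context {C : rigidCat}.
Implicit Types X Y Z T : C.
Local Notation S n X := (SymPow n X).

Lemma diracopE X Y Z (psi : Mor (X ⊗ Y) Z) n :
  diracop psi n = (S n X ◁ psi) ∘ (asc (S n X) X Y ∘ (nu n X ⊠ idm Y)).
Proof.
rewrite /diracop nuE rcomp (compA (asc _ _ _)) asc_nat tensm1 -!compA.
by rewrite (compA (symp n X ⊠ _)) (compA (_ ◁ psi)) -tens_inter -!compA.
Qed.

Lemma laplaceopE X Z (psi : Mor (X ⊗ X) Z) n :
  laplaceop psi n = (S n X ◁ psi) ∘ (asc (S n X) X X ∘ ((nu n X ⊠ idm X) ∘ nu n.+1 X)).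
Proof.
rewrite /laplaceop nu_nu (compA (asc _ _ _)) asc_nat tensm1 -!compA.
by rewrite (compA (symp n X ⊠ _)) (compA (_ ◁ psi)) -tens_inter -!compA.
Qed.

Lemma tdiracop X Y (c : @robj C) (psi : Mor (X ⊗ Y) (rob c)) n T :
  @str C (rtens (ratom _) (ratom _)) (rtens (ratom _) c) (diracop psi n) T =
  (S n X ◁ @str C (rtens (ratom _) (ratom _)) c psi T) ∘ o12 (nu n X) (Y ⊗ T).
Proof.
rewrite diracopE (@str_comp _ _ (rtens (ratom _) (rtens (ratom _) (ratom _)))).
rewrite (@str_lid _ (ratom _) (rtens (ratom _) (ratom _)) c).
rewrite (@str_comp _ _ (rtens (rtens (ratom _) (ratom _)) (ratom _))).
rewrite (str_asc (ratom _) (ratom _) (ratom _)) comp1m.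
by rewrite (@str_rid _ (ratom _) (ratom _) (rtens (ratom _) (ratom _))).
Qed.

Lemma tlaplaceop X (c : @robj C) (psi : Mor (X ⊗ X) (rob c)) n T :
  @str C (ratom _) (rtens (ratom _) c) (laplaceop psi n) T =
  (S n X ◁ @str C (rtens (ratom _) (ratom _)) c psi T) ∘ (o12 (nu n X) (X ⊗ T) ∘
    o12 (nu n.+1 X) T).
Proof.
rewrite laplaceopE (@str_comp _ _ (rtens (ratom _) (rtens (ratom _) (ratom _)))).
rewrite (@str_lid _ (ratom _) (rtens (ratom _) (ratom _)) c).
rewrite (@str_comp _ _ (rtens (rtens (ratom _) (ratom _)) (ratom _))).
rewrite (str_asc (ratom _) (ratom _) (ratom _)) comp1m.
rewrite (@str_comp _ _ (rtens (ratom _) (ratom _))).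
by rewrite (@str_rid _ (ratom _) (ratom _) (rtens (ratom _) (ratom _))).
Qed.

(** The two letters taken out by successive [nu] are symmetric, so [G] and its exchanged version
    contribute equally. *)
Lemma tnu_nu_half X T Z (G F : Mor (X ⊗ (X ⊗ T)) Z) s n :
  G + (G ∘ sw X X T) = escale s F ->
  (S n X ◁ G) ∘ (o12 (nu n X) (X ⊗ T) ∘ o12 (nu n.+1 X) T) =
  escale ((2^-1 : rat) *: s) ((S n X ◁ F) ∘ (o12 (nu n X) (X ⊗ T) ∘ o12 (nu n.+1 X) T)).
Proof.
move=> GF; rewrite escaleZl; apply: (scalerI (natS_neq0 1)).
rewrite scalerA mulfV ?natS_neq0 // scale1r -escale_compl -escale_l -GF tensDr compDl.
by rewrite scaler_nat mulr2n; congr (_ + _); rewrite lcomp -compA tnu_comm.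
Qed.

Lemma escale_tens s X Y Z (f : Mor Y Z) : escale s (idm X) ⊠ f = escale s (X ◁ f).
Proof. by rewrite tensE escale_r tensm1 escale_compl comp1m. Qed.
End OperatorTails.

Section Operators.
Context {C : rigidCat} (V : C) (m : nat).
Local Notation i := m.+1.
Local Notation g := (2 * i)%N.
Local Notation A := (SymPow i V).
Local Notation L := (Lobj V i).
Implicit Types T : C.

Lemma tpsi_1 T : @str C (rtens (ratom _) (ratom _)) (rtens (ratom _) (ratom _)) (psi_1 V i) T =
  o12 (Dup V i.+1 m g) T ∘ o21 (mu i V) T.
Proof.
rewrite -(tmulS_1 V i T) /psi_1 [i.-1]/=.
move: (Dup _ _ _ _) (mulS _ _ _ _) => d p.
rewrite -compA (@str_comp _ _ (ratom _)) (@str_comp _ _ (rtens (ratom _) (ratom _)) (ratom _)).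
by rewrite (@str_lid _ (ratom _) (ratom _) (ratom _)).
Qed.
Lemma tpsibar_im1 T : o21 (psibar_im1 V i) T = o11 (of_Sym1 V) T ∘ o21 (pairing_bar V i m 1 g) T.
Proof.
rewrite /psibar_im1 [i.-1]/=; move: (pairing_bar _ _ _ _ _) => d.
by rewrite {1}/o21 (@str_comp _ (rtens (ratom _) (ratom _)) (ratom _) (ratom _)).
Qed.
Lemma tpsi_im1 T : @str C (rtens (ratom _) (ratom _)) (rtens (ratom _) (ratom _))
  (psi_im1 V i) T =
  o11 (of_Sym1 (dual V)) (L ⊗ T) ∘ (o12 (Dup V g.-1 1 g) T ∘ o21 (mulS V i m g.-1) T).
Proof.
rewrite /psi_im1 [i.-1]/=; move: (Dup _ _ _ _) (mulS _ _ _ _) => d p.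
rewrite -compA (@str_comp _ _ (rtens (ratom _) (ratom _))) (@str_comp _ _ (ratom _)).
by rewrite (@str_rid _ (ratom _) (ratom _) (ratom _)).
Qed.
Lemma tpsibar_1 T : o21 (psibar_1 V i) T =
  o21 (pairing_bar V i 1 m g) T ∘ (A ◁ o11 (to_Sym1 (dual V)) T).
Proof.
rewrite /psibar_1 [i.-1]/=; move: (pairing_bar _ _ _ _ _) => d.
rewrite {1}/o21 (@str_comp _ _ (rtens (ratom _) (ratom _))).
by rewrite (@str_lid _ (ratom _) (ratom _) (ratom _)).
Qed.
Hypotheses (inv : invertible (SymPow g V)) (rk : rank (SymPow g V) * rank (SymPow g V) = 1).

Local Notation half_rho := ((2^-1 : rat) *: rho_sym V m g.-1).
Local Notation S n := (SymPow n A).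

Lemma pred_double_i : g.-1 = (m.+1 + m)%N.
Proof. by rewrite mul2n -addnn addnS. Qed.

Lemma tLaplace n T : o12 (Laplace V i n) T =
  (S n ◁ (o11 (lamS V g) T ∘ o21 (mulS V i i g) T)) ∘ (o12 (nu n A) (A ⊗ T) ∘ o12 (nu n.+1 A) T).
Proof.
rewrite /Laplace -lamSE {1}/o12 (@tlaplaceop _ A (ratom _)); congr (_ ∘ _); congr (_ ◁ _).
by move: (lamS _ _) (mulS _ _ _ _) => l p; rewrite (@str_comp _ _ (ratom _)).
Qed.

Lemma Diracbar_im1_Dirac1 n :
  (Diracbar_im1 V i n ⊠ idm L) ∘ ascV (S n.+1) (SymPow i.-1 (dual V)) L ∘ Dirac1 V i n.+1 =
  ascV (S n) V L ∘ (escale half_rho (idm (S n)) ⊠ swap L V) ∘ asc (S n) L V ∘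
    (Laplace V i n ⊠ idm V).
Proof.
rewrite -!compA; apply: (@str_inj C (rtens (ratom _) (ratom _)) (rtens (rtens (ratom _)
  (ratom _)) (ratom _))).
rewrite (@str_comp _ _ (rtens (rtens (ratom _) (ratom _)) (ratom _))).
rewrite (@str_rid _ (ratom _) (rtens (ratom _) (ratom _)) (rtens (ratom _) (ratom _))).
rewrite (@str_comp _ _ (rtens (ratom _) (rtens (ratom _) (ratom _)))).
rewrite (str_ascV (ratom _) (ratom _) (ratom _)) comp1m.
rewrite /Diracbar_im1 /Dirac1.
rewrite (@tdiracop _ _ _ (ratom _)) (@tdiracop _ _ _ (rtens (ratom _) (ratom _))).
rewrite tpsi_1 -/(o21 _ _) tpsibar_im1.
have H := tnu_nu_half n (tdirac_bar_V_sym pred_double_i inv rk tunit).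
transitivity (escale half_rho ((S n ◁ ((V ◁ o11 (lamS V g) tunit) ∘ (sw (SymPow g V) V tunit ∘
    o21 (mulS V i i g) (V ⊗ tunit)))) ∘ (o12 (nu n A) (A ⊗ (V ⊗ tunit)) ∘
      o12 (nu n.+1 A) (V ⊗ tunit)))).
  move: H => <-; apply: mor_ext => Z z; rewrite !lcomp -!compA.
  by rw0 (o12_nat (nu n A) (o12 (Dup V m.+2 m g) _)); rw0 (o12_nat (nu n A) (o21 (mu m.+1 V) _)).
move: half_rho => h {H}.
rewrite escale_tens !(escale_compl, escale_compr) str_escale; congr escale.
rewrite (@str_comp _ _ (rtens (ratom _) (rtens (ratom _) (ratom _))) (rtens (rtens (ratom _)
  (ratom _)) (ratom _))).
rewrite (str_ascV (ratom _) (ratom _) (ratom _)) comp1m.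
rewrite (@str_comp _ _ (rtens (ratom _) (rtens (ratom _) (ratom _))) (rtens (ratom _) (rtens
  (ratom _) (ratom _)))).
rewrite (@str_lid _ (ratom _) (rtens (ratom _) (ratom _)) (rtens (ratom _) (ratom _))).
rewrite (@str_comp _ _ (rtens (rtens (ratom _) (ratom _)) (ratom _)) (rtens (ratom _) (rtens
  (ratom _) (ratom _)))).
rewrite (str_asc (ratom _) (ratom _) (ratom _)) comp1m.
rewrite (@str_rid _ (ratom _) (ratom _) (rtens (ratom _) (ratom _))) -/(o12 _ _)
  -/(sw _ _ _) tLaplace.
rewrite !lcomp -!compA; apply: mor_ext => Z z; rewrite -!compA.
by rw1 (o11_sw V (lamS V g) _).
Qed.

Lemma Dirac_im1_Diracbar_1 n :
  Dirac_im1 V i n ∘ Diracbar_1 V i n.+1 =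
  (escale half_rho (idm (S n)) ⊠ swap L (dual V)) ∘ asc (S n) L (dual V) ∘
    (Laplace V i n ⊠ idm (dual V)).
Proof.
rewrite -(compA (_ ⊠ swap _ _));
  apply: (@str_inj C (rtens (ratom _) (ratom _)) (rtens (ratom _) (rtens (ratom _) (ratom _)))).
rewrite (@str_comp _ _ (rtens (ratom _) (ratom _))) /Dirac_im1 /Diracbar_1.
rewrite (@tdiracop _ _ _ (rtens (ratom _) (ratom _))).
rewrite (@tdiracop _ _ _ (ratom _)).
rewrite tpsi_im1 -/(o21 _ _) tpsibar_1.
have H := tnu_nu_half n (tdirac_dual_sym pred_double_i inv rk tunit).
transitivity (escale half_rho ((S n ◁ ((dual V ◁ o11 (lamS V g) tunit) ∘
  (sw (SymPow g V) (dual V) tunit ∘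
    o21 (mulS V i i g) (dual V ⊗ tunit)))) ∘ (o12 (nu n A) (A ⊗ (dual V ⊗ tunit)) ∘
      o12 (nu n.+1 A) (dual V ⊗ tunit)))).
  move: H => <-; apply: mor_ext => Z z; rewrite !lcomp -!compA.
  rw0 (o12_nat (nu n A) (o21 (pairing_bar V i 1 m g) _)).
  by rw0 (o12_nat (nu n A) (A ◁ o11 (to_Sym1 (dual V)) _)).
move: half_rho => h {H}.
rewrite escale_tens !(escale_compl, escale_compr) str_escale; congr escale.
rewrite (@str_comp _ _ (rtens (ratom _) (rtens (ratom _) (ratom _))) (rtens (ratom _) (rtens
  (ratom _) (ratom _)))).
rewrite (@str_lid _ (ratom _) (rtens (ratom _) (ratom _)) (rtens (ratom _) (ratom _))).
rewrite (@str_comp _ _ (rtens (rtens (ratom _) (ratom _)) (ratom _)) (rtens (ratom _) (rtens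
  (ratom _) (ratom _)))).
rewrite (str_asc (ratom _) (ratom _) (ratom _)) comp1m.
rewrite (@str_rid _ (ratom _) (ratom _) (rtens (ratom _) (ratom _))) -/(o12 _ _)
  -/(sw _ _ _) tLaplace.
rewrite !lcomp -!compA; apply: mor_ext => Z z; rewrite -!compA.
by rw1 (o11_sw (dual V) (lamS V g) _).
Qed.
End Operators.

(** * Sections of the Laplace operator *)

Section LaplaceSection.
Context {C : rigidCat}.
Variables (X Om : C) (P : Mor (X ⊗ X) Om) (q : Mor Om (X ⊗ X)) (c : Endo (@tunit C)).
Implicit Types T Z : C.
Local Notation S n := (SymPow n X).
Hypothesis P_comm : forall T, o21 P T ∘ sw X X T = o21 P T.
Hypothesis q_comm : forall T, sw X X T ∘ o12 q T = o12 q T.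
Hypothesis Pq : forall T,
  (X ◁ o21 P T) ∘ (sw X X (X ⊗ T) ∘ (X ◁ o12 q T)) = escale c (idm (X ⊗ (Om ⊗ T))).

(** Closing the strand X in [Pq] gives a loop of value [rank X] on the right and a zigzag on the
    left. *)
Lemma P_q T : o21 P T ∘ o12 q T = escale (c * rank X) (idm (Om ⊗ T)).
Proof.
have [z1 _] := dualpair_ev X.
rewrite escaleM -loop_rank -escale_compr; apply: mor_ext => Z z.
rewrite !escale_compr escale_compl.
have := congr1 (fun f => o20 (ev X) (Om ⊗ T) ∘ ((dual X ◁ f) ∘ (sw X (dual X) (Om ⊗ T) ∘
  (o02 (coev X) _ ∘ z)))) (Pq T).
rewrite escale_l ltens1 escale_compl comp1m escale_compr -!compA => <-; rewrite !lcomp -!compA.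
rw0 (o20_nat (ev X) (o21 P T)); rw0 (o20_swr X (ev X) _).
rw0 (esym (sw_nat X (dual X) (o12 q T))); rw0 (esym (o02_nat (coev X) (o12 q T))).
by rw0 (swK _ _ _); rw0 (z1 _).
Qed.

Lemma P_q_sw T : o21 P (X ⊗ T) ∘ (X ◁ o12 q T) = escale c (sw X Om T).
Proof.
rewrite -[sw X Om T]compm1 -escale_compr -Pq; apply: mor_ext => Z z; rewrite -!compA.
by rw0 (esym (sw_o21 X P T)); rw0 (swK _ _ _); rw1 (q_comm _).
Qed.

(** With q(w) the sum of a ⊗ b, the sum of P(x,a) ⊗ P(y,b) is c P(x,y) ⊗ w by [Pq] and c w ⊗ P(y,x)
    by [P_q_sw]; then P is commutative. *)
Lemma sw_P T : escale c (sw Om Om T ∘ o21 P (Om ⊗ T)) = escale c (o21 P (Om ⊗ T)).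
Proof.
rewrite -[in RHS](compm1 (o21 P (Om ⊗ T))) -[in RHS](ltens1 X) -[RHS]escale_compr -escale_l -Pq.
apply: mor_ext => Z z; rewrite escale_compl !lcomp -!compA.
rw0 (o21_nat P (o21 P T)).
have E S (y : Mor S (X ⊗ (X ⊗ (X ⊗ (X ⊗ T))))) :
    o21 P (X ⊗ (X ⊗ T)) ∘ ((X ◁ sw X X (X ⊗ T)) ∘ y) =
    sw X Om (X ⊗ T) ∘ ((X ◁ o21 P (X ⊗ T)) ∘ (sw X X (X ⊗ (X ⊗ T)) ∘ y)).
  by rw0 (esym (sw_o21 X P (X ⊗ T))); rw0 (swK _ _ _).
rewrite E; rw0 (sw_nat X X (o12 q T)).
have := congr1 (fun f => (X ◁ f) ∘ (sw X X (Om ⊗ T) ∘ z)) (P_q_sw T).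
rewrite escale_l escale_compl lcomp -!compA => ->; rewrite !escale_compr; congr escale.
by rw0 (esym (swYB X X Om T)); rw1 (P_comm _); rw0 (o21_sw Om P T).
Qed.

(* Up to a scalar, [raise] is adjoint to the Laplace operator [lower]. *)
Definition raise n T : Mor (S n ⊗ (Om ⊗ T)) (S n.+2 ⊗ T) :=
  locked_with str_key (o21 (mu n.+1 X) T ∘ (o21 (mu n X) (X ⊗ T) ∘ (S n ◁ o12 q T))).
Lemma raiseE n T : raise n T = o21 (mu n.+1 X) T ∘ (o21 (mu n X) (X ⊗ T) ∘ (S n ◁ o12 q T)).
Proof. by rewrite /raise unlock. Qed.

Definition lower n T : Mor (S n.+2 ⊗ T) (S n ⊗ (Om ⊗ T)) :=
  locked_with str_key ((S n ◁ o21 P T) ∘ (o12 (nu n X) (X ⊗ T) ∘ o12 (nu n.+1 X) T)).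
Lemma lowerE n T : lower n T = (S n ◁ o21 P T) ∘ (o12 (nu n X) (X ⊗ T) ∘ o12 (nu n.+1 X) T).
Proof. by rewrite /lower unlock. Qed.

Lemma raise_nat n T T' (h : Mor T T') :
  (S n.+2 ◁ h) ∘ raise n T = raise n T' ∘ (S n ◁ Om ◁ h).
Proof.
rewrite !raiseE; apply: mor_ext => Z z; rewrite -!compA.
rw0 (esym (o21_nat (mu n.+1 X) h)); rw0 (esym (o21_nat (mu n X) (X ◁ h))).
by rw1 (esym (o12_nat q h)).
Qed.

Definition nu_raise_rest n T : Mor (S n ⊗ (Om ⊗ T)) (S n.+1 ⊗ (X ⊗ T)) :=
  if n is k.+1 then
    k.+1%:R *: (raise k (X ⊗ T) ∘ ((S k ◁ sw X Om T) ∘ o12 (nu k X) (Om ⊗ T)))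
  else 0.

(** The letter removed is either one of the two legs of [q], which are interchangeable and give the
    factor 2, or a letter already present. *)
Lemma nu_raise n T Z (z : Mor Z (S n ⊗ (Om ⊗ T))) :
  n.+2%:R *: (o12 (nu n.+1 X) T ∘ (raise n T ∘ z)) =
  2%:R *: (o21 (mu n X) (X ⊗ T) ∘ ((S n ◁ o12 q T) ∘ z)) + (nu_raise_rest n T ∘ z).
Proof.
rewrite raiseE -!compA tnu_muE [2%:R *: _]scaler_nat mulr2n -addrA; congr (_ + _).
case: n z => [|n] z.
  rw0 (tnu_mu0 _ _); rw1 (q_comm _); by rewrite scale1r comp0l addr0.
rewrite -(compZr n.+2%:R) -(compZr n.+2%:R) tnu_muE !(compDr, compZr) compZl; congr (_ + _ *: _).
  by rw1 (q_comm _).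
rewrite raiseE -!compA.
rw0 (esym (o21_nat (mu n X) (sw X X T))); rw0 (o12_nat (nu n X) (o12 q T)).
by rw1 (sw_o12 X q T).
Qed.

Definition lower_raise_rest n T : Mor (S n ⊗ (Om ⊗ T)) (S n ⊗ (Om ⊗ T)) :=
  if n is k.+2 then
    (k.+2 * k.+1)%:R *: (raise k (Om ⊗ T) ∘ ((S k ◁ sw Om Om T) ∘ lower k (Om ⊗ T)))
  else 0.

(** Two letters are removed and multiplied by P. Both legs of [q] give 2 c rank(X) by [P_q]; one leg
    and one of the n old letters, removed in either order, give 2 n c each by [Pq]; two old letters
    give the rest. *)
Lemma lower_raise n T Z (z : Mor Z (S n ⊗ (Om ⊗ T))) :
  (n.+2 * n.+1)%:R *: (lower n T ∘ (raise n T ∘ z)) =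
  escale (c * (2%:R * rank X + (4 * n)%:R)) z + (lower_raise_rest n T ∘ z).
Proof.
have PqS k Y (y : Mor Y (S k ⊗ (Om ⊗ T))) : (S k ◁ o21 P T) ∘ ((S k ◁ o12 q T) ∘ y) =
  escale (c * rank X) y.
  by rewrite compA -lcomp P_q escale_l ltens1 escale_compl comp1m.
rewrite natrM mulrC -scalerA lowerE -!compA -2!compZr nu_raise.
have -> : escale (c * (2%:R * rank X + (4 * n)%:R)) z =
    2%:R *: escale (c * rank X) z + (4 * n)%:R *: escale c z.
  rewrite mulrDr escaleDl mulrA -(endoC 2%:R) -mulrA escaleM; congr (_ + _).
    by rewrite -scaler_nat escaleZl escale1.
  by rewrite escaleM -scaler_nat escaleZl escale1 escaleZr.
case: n z => [|n] z.
  rewrite muln0 scale0r addr0 scale1r !comp0l !addr0 !compZr; congr (_ *: _).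
  by rw0 (tnu_mu0 _ _); rewrite PqS.
have L Y (y : Mor Y (S n.+2 ⊗ (X ⊗ T))) (a : rat) :
    n.+2%:R *: ((S n.+1 ◁ o21 P T) ∘ (o12 (nu n.+1 X) (X ⊗ T) ∘ (a *: y))) =
    a *: ((S n.+1 ◁ o21 P T) ∘ (n.+2%:R *: (o12 (nu n.+1 X) (X ⊗ T) ∘ y))).
  by rewrite !compZr !scalerA mulrC.
rewrite !compDr scalerDr L tnu_muE compDr scalerDr PqS -!addrA; congr (_ + _).
rewrite [nu_raise_rest n.+1 T]/= compZl L -!compA nu_raise !compDr !compZr.
have E1 Y (y : Mor Y (S n.+1 ⊗ (Om ⊗ T))) : (S n.+1 ◁ o21 P T) ∘ (o21 (mu n X) (X ⊗ (X ⊗ T)) ∘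
    ((S n ◁ sw X X (X ⊗ T)) ∘ ((S n ◁ X ◁ o12 q T) ∘ (o12 (nu n X) (Om ⊗ T) ∘ y)))) = escale c y.
  rw0 (esym (o21_nat (mu n X) (o21 P T))).
  have := congr1 (fun f => (S n ◁ f) ∘ (o12 (nu n X) (Om ⊗ T) ∘ y)) (Pq T).
  rewrite escale_l ltens1 escale_compl comp1m !lcomp -!compA => ->.
  by rewrite escale_compr; congr escale; rw0 (tmu_nu n X (Om ⊗ T)).
rw0 (o12_nat (nu n X) (o12 q T)); rewrite E1.
have -> : (S n.+1 ◁ o21 P T) ∘ (o21 (mu n X) (X ⊗ (X ⊗ T)) ∘ ((S n ◁ o12 q (X ⊗ T)) ∘
    ((S n ◁ sw X Om T) ∘ (o12 (nu n X) (Om ⊗ T) ∘ z)))) = escale c z.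
  rewrite -[RHS]E1; rw1 (sw_o12 X q T).
  by do 2!rw0 (esym (o21_nat (mu n X) (o21 P T))); rw2 (P_comm T).
rewrite scalerDr addrA !scalerA -scalerDl; congr (_ *: _ + _).
  by rewrite -!natrM -natrD; congr (_%:R); rewrite mulnC -mulnDr mulnC.
case: n z {L E1} => [|n] z; first by rewrite /= !comp0l comp0r scaler0.
rewrite /= compZl !compZr compZl scalerA -natrM; congr (_ *: _); rewrite -!compA.
rw0 (raise_nat n (o21 P T)).
rw0 (o12_nat (nu n X) (sw X Om T)); rewrite lowerE -!compA.
by rw1 (o21_sw Om P T).
Qed.

Lemma escale_inj t u (Y Z : C) (a b : Mor Y Z) : t * u = 1 -> escale t a = escale t b -> a = b.
Proof. by move=> tu ab; rewrite -[a]escale1 -[b]escale1 -tu endoC !escaleM ab. Qed.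

Lemma escale0 t (Y Z : C) : escale t (0 : Mor Y Z) = 0.
Proof. by rewrite -[0 in LHS](scale0r 0) escaleZr scale0r. Qed.
Lemma escale_l0 (Y Z : C) (h : Mor Y Z) : escale 0 h = 0.
Proof. by rewrite -[0 in LHS](scale0r 0) escaleZl scale0r. Qed.

Lemma is_iso_scalar t u (Y : C) : t * u = 1 -> is_iso (escale t (idm Y)).
Proof.
move=> tu; exists (escale u (idm Y)).
by split; rewrite escale_compl comp1m -escaleM ?tu 1?endoC ?tu escale1.
Qed.

Lemma is_iso_scalar_comp (Y Z : C) (a : Mor Y Z) (b : Mor Z Y) (t u : Endo
  (@tunit C)) : t * u = 1 ->
  is_iso (escale t (idm Z) + (a ∘ b)) -> is_iso (escale t (idm Y) + (b ∘ a)).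
Proof.
move=> tu [w [wl wr]].
have uK (W : C) (h : Mor W W) : escale u (escale t h) = h by rewrite -escaleM endoC tu escale1.
(* The classical inverse of t + b a from the inverse w of t + a b, namely (1 - b w a) / t. *)
exists (escale u (idm Y - (b ∘ (w ∘ a)))); split.
  rewrite escale_compl compDl compNl comp1m.
  have -> : b ∘ (w ∘ a) ∘ (escale t (idm Y) + (b ∘ a)) =
      b ∘ (w ∘ (escale t (idm Z) + (a ∘ b)) ∘ a).
    by rewrite !(compDl, compDr, escale_compl, escale_compr, compm1) -!compA.
  by rewrite wl comp1m addrK uK.
rewrite escale_compr compDr compNr compm1.
have -> : (escale t (idm Y) + (b ∘ a)) ∘ (b ∘ (w ∘ a)) =
    b ∘ ((escale t (idm Z) + (a ∘ b)) ∘ w ∘ a).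
  by rewrite !(compDl, compDr, escale_compl, escale_compr, comp1m) -!compA.
by rewrite wr comp1m addrK uK.
Qed.

Variables (K : realFieldType) (f : {rmorphism K ->
  Endo (@tunit C)}) (x : K) (c' : Endo (@tunit C)).
Hypotheses (fx : f x = rank X) (x_gt0 : 0 < x) (cK : c * c' = 1).

(** P has a right inverse, as c rank(X) is a unit, so the exchange that it absorbs is the
    identity. *)
Lemma sw_Om T : sw Om Om T = idm (Om ⊗ (Om ⊗ T)).
Proof.
have xK : rank X * f x^-1 = 1 by rewrite -fx -rmorphM mulfV ?rmorph1 // gt_eqF.
apply: (escale_inj xK); apply: (escale_inj cK); apply: (escale_inj cK).
rewrite -!(escaleM c (rank X)).
have E (h : Mor (Om ⊗ (Om ⊗ T)) (Om ⊗ (Om ⊗ T))) :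
    escale (c * rank X) h = h ∘ (o21 P (Om ⊗ T) ∘ o12 q (Om ⊗ T)).
  by rewrite P_q escale_compr compm1.
by rewrite !E comp1m compA -escale_compl sw_P escale_compl.
Qed.

(** [lower_raise] turns s into t = s + 2 x + 4 n and leaves a multiple of [raise] after [lower] in
    degree n - 2. Exchanging these two factors gives the claim in degree n - 2 with scalar t and
    tail Om ⊗ T, so s and T vary in the induction. *)
Lemma lower_raise_iso n T (s : K) : 0 <= s ->
  is_iso (escale (f s) (idm (S n ⊗ (Om ⊗ T))) +
    (escale c' ((n.+2 * n.+1)%:R *: lower n T) ∘ raise n T)).
Proof.
elim/ltn_ind: n T s => n IHn T s s_ge0.
pose t := s + (2%:R * x + (4 * n)%:R).
have t_gt0 : 0 < t by rewrite ltr_wpDl // ltr_pwDl // mulr_gt0.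
have tK : f t * f t^-1 = 1 by rewrite -rmorphM mulfV ?rmorph1 // gt_eqF.
have -> : escale (f s) (idm (S n ⊗ (Om ⊗ T))) + (escale c' ((n.+2 * n.+1)%:R *: lower n T) ∘
  raise n T) =
    escale (f t) (idm _) + escale c' (lower_raise_rest n T).
  have := @lower_raise n T _ (idm _); rewrite !compm1 => /(congr1 (escale c')).
  rewrite escaleDr -(escaleM c') mulrA (endoC c') cK mul1r => E.
  have -> : f t = f s + (2%:R * rank X + (4 * n)%:R).
    by rewrite /t rmorphD rmorphD rmorphM !rmorph_nat fx.
  by rewrite escale_compl compZl E addrA (escaleDl (f s)).
case: n t t_gt0 tK IHn => [|[|n]] t t_gt0 tK IHn.
- by rewrite [lower_raise_rest _ _]/= escale0 addr0; exact: is_iso_scalar tK.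
- by rewrite [lower_raise_rest _ _]/= escale0 addr0; exact: is_iso_scalar tK.
rewrite [lower_raise_rest _ _]/= sw_Om ltens1 comp1m -compZr -escale_compr.
by apply: (is_iso_scalar_comp tK); apply: IHn => //; exact: ltW.
Qed.

Lemma lower_section n T : exists r, lower n T ∘ r = idm (S n ⊗ (Om ⊗ T)).
Proof.
have [w [_ ]] := lower_raise_iso n T (lexx 0).
rewrite rmorph0 escale_l0 add0r => E.
exists (escale c' ((n.+2 * n.+1)%:R *: (raise n T ∘ w))).
by rewrite -E escale_compr !escale_compl compZr !compZl -!compA.
Qed.
End LaplaceSection.

Section Misc.
Context {C : rigidCat}.
Implicit Types X Y Z T L V : C.

(** Converts a section found on words back into a morphism of bracketed objects. *)
Lemma str_full (a b : @robj C) (h : Mor (rF a tunit) (rF b tunit)) :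
  exists f : Mor (rob a) (rob b), str f tunit = h.
Proof.
exists (run (rob b) ∘ (rJ b tunit ∘ h ∘ rI a tunit) ∘ runV (rob a)); rewrite strE.
have E X Y (f : Mor X Y) : f ⊠ idm tunit = runV Y ∘ (f ∘ run X).
  by rewrite -run_nat compA runK comp1m.
rewrite E -!compA (compA (runV _)) runK comp1m (compA (runV _)) runK comp1m.
by rewrite rIJ compm1 compA rIJ comp1m.
Qed.

Lemma tens_invertible_inj L X Y (f f' : Mor X Y) :
  invertible L -> f ⊠ idm L = f' ⊠ idm L -> f = f'.
Proof.
move=> [L' [u [v [vu uv]]]] ff'.
have uvT T : o20 u T ∘ o02 v T = idm T.
  by rewrite -(@str_comp _ runit (rtens (ratom _) (ratom _)) runit) uv (str_id runit).
have {}ff' T : o11 f (L ⊗ T) = o11 f' (L ⊗ T).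
  by rewrite /o11 -!(@str_rid _ (ratom L) (ratom X) (ratom Y)) ff'.
apply: o11_inj; apply: (cancel_epi (ltens20 X (uvT tunit))).
by rewrite !o11_nat ff'.
Qed.

(** The kernel is the image of the idempotent 1 - s f. *)
Lemma has_kernel_section X Y (f : Mor X Y) (s : Mor Y X) : f ∘ s = idm Y -> has_kernel f.
Proof.
move=> fs; pose e : Mor X X := idm X - (s ∘ f).
have fe : f ∘ e = 0 by rewrite compDr compNr compm1 compA fs comp1m subrr.
have ee : e ∘ e = e by rewrite {1}/e compDl compNl comp1m -compA fe comp0r subr0.
have [ip pi] := im_split ee.
exists (im e), (imi e); split.
  by rewrite -[imi e]compm1 -pi (compA (imi e)) ip compA fe comp0l.
move=> T h fh; exists (imp e ∘ h); split.
  by rewrite compA ip compDl compNl comp1m -compA fh comp0r subr0.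
by move=> u <-; rewrite compA pi comp1m.
Qed.

Lemma loopcoef_ffact V j k :
  ((k + j) ^_ k)%:R *: loopcoef V j k = \prod_(l < k) (rank V + (l + j)%:R).
Proof.
elim: k => [|k IHk]; first by rewrite big_ord0 ffactn0 scale1r.
rewrite addSn ffactSS big_ord_recr /= -IHk natrM scalerA mulrAC mulfV ?natS_neq0 // mul1r.
exact: esym (compZl _ _ _).
Qed.

(** The factors r + j, ..., r + k + j - 1, multiplied in opposite orders. *)
Lemma ebinom_prod V j k :
  \prod_(l < k) (rank V + (k + j)%:R - 1 - (l : nat)%:R) =
  \prod_(l < k) (rank V + (l + j)%:R) :> Endo (@tunit C).
Proof.
elim: k => [|k IHk]; first by rewrite !big_ord0.
rewrite [RHS]big_ord_recr [LHS]big_ord_recl /= -IHk endoC; congr (_ * _); last first.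
  by rewrite subr0 addSn -natr1 addrA addrK.
apply: eq_bigr => l _; rewrite addSn -(natr1 (k + j)) addrA addrK.
by rewrite /bump /= -natr1 opprD addrA (addrAC _ (- l%:R)).
Qed.

Lemma loopcoefE V j k :
  loopcoef V j k = ('C(k + j, k)%:R^-1 : rat) *: ebinom (rank V + (k + j)%:R - 1) k.
Proof.
have Ck : 'C(k + j, k)%:R != 0 :> rat by rewrite pnatr_eq0 -lt0n bin_gt0 leq_addr.
have k0 : k`!%:R != 0 :> rat by rewrite pnatr_eq0 -lt0n fact_gt0.
rewrite /ebinom ebinom_prod -loopcoef_ffact -bin_ffact natrM !scalerA.
by rewrite -mulrA (mulrCA k`!%:R^-1) mulVf // mulr1 mulVf // scale1r.
Qed.

Section ComulComm.
Variables (V : C) (j n : nat).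
Hypothesis nE : n = (j + j)%N.
Local Notation A := (SymPow j V).
Local Notation B := (SymPow j (dual V)).

(** The transpose of commutativity of the product, tested by pairing both legs with [B]. *)
Lemma comulS_comm T : sw A A T ∘ o12 (comulS V j j n) T = o12 (comulS V j j n) T.
Proof.
have pair2 W (h : Mor W (A ⊗ (A ⊗ T))) :
    o20 (evS V j) T ∘ ((B ◁ A ◁ o20 (evS V j) T) ∘ ((B ◁ sw B A (A ⊗ T)) ∘ (B ◁ B ◁ h))) =
    o20 (evS V j) T ∘ (B ◁ (o20 (evS V j) (A ⊗ T) ∘ (B ◁ (sw A A T ∘ h)))).
  by rewrite !lcomp; apply: mor_ext => Z z; rewrite -!compA; rw1 (o20_swr A (evS V j) T).
have pairC W (h : Mor W (A ⊗ (A ⊗ T))) :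
    o20 (evS V j) T ∘ (B ◁ (o20 (evS V j) (A ⊗ T) ∘ (B ◁ (sw A A T ∘ h)))) =
    o20 (evS V j) T ∘ ((B ◁ o20 (evS V j) (A ⊗ T)) ∘ (sw B B (A ⊗ (A ⊗ T)) ∘ (B ◁ B ◁ h))).
  rewrite !lcomp; apply: mor_ext => Z z; rewrite -!compA.
  rw1 (o20_swr A (evS V j) T); rw0 (o20_nat (evS V j) (o20 (evS V j) T)).
  by rewrite -(sw_o20 B (evS V j) (A ⊗ T)) -!compA; rw0 (swK _ _ _).
have M := comulS_adj V j j n T; rewrite pair2 in M.
apply: (dual_inj (dualpair_evS V j)); apply: (dual_inj (dualpair_evS V j)).
have Msw : o20 (evS V n) T ∘ o21 (mulS (dual V) j j n) (SymPow n V ⊗ T) =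
    o20 (evS V n) T ∘ o21 (mulS (dual V) j j n) (SymPow n V ⊗ T) ∘ sw B B (SymPow n V ⊗ T).
  by rewrite -compA tmulS_comm.
rewrite -M Msw M pairC lcomp; apply: mor_ext => Z z; rewrite -!compA.
by rw0 (esym (sw_nat B B (o12 (comulS V j j n) T))); rw0 (swK _ _ _).
Qed.
End ComulComm.
End Misc.

(** * Sections of the three operators *)

Section Sections.
Context {C : rigidCat} (V : C) (m : nat).
Local Notation i := m.+1.
Local Notation g := (2 * i)%N.
Local Notation A := (SymPow i V).
Local Notation L := (Lobj V i).
Local Notation S n := (SymPow n A).
Local Notation r := (rank V).
Implicit Types T : C.
Hypotheses (inv : invertible (SymPow g V)) (rk : rank (SymPow g V) * rank (SymPow g V) = 1).

Lemma endoZl (a : rat) (s t : Endo (@tunit C)) : (a *: s) * t = a *: (s * t).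
Proof. exact: compZl. Qed.
Lemma endoZr (a : rat) (s t : Endo (@tunit C)) : s * (a *: t) = a *: (s * t).
Proof. exact: compZr. Qed.

Lemma double_i : g = (i + i)%N.
Proof. by rewrite mul2n addnn. Qed.

Lemma rank_Lobj : rank L = rank (SymPow g V).
Proof. by rewrite (rank_iso (lamS_iso V g)). Qed.

Lemma rho_symE : rho_sym V m g.-1 = rho V i.
Proof.
rewrite /rho_sym /rho rank_Lobj (loopcoefE V i i) (loopcoefE V 1 g.-1) -double_i addn1.
have -> : g.-1.+1 = g by [].
move: (ebinom _ _) (ebinom _ _) (rank (SymPow g V)) => a b s.
rewrite !(endoZl, endoZr) !scalerA (endoC _ (s * _)); congr (_ *: _).
by rewrite -mulrA mulrC; congr (_ * _); rewrite mulrC.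
Qed.

Lemma Laplace_section n : epositive (rank A) -> (exists u, ebinom (r + g%:R - 1) i * u = 1) ->
  exists s : Mor (S n ⊗ L) (S n.+2), Laplace V i n ∘ s = idm (S n ⊗ L).
Proof.
move=> [K [f [x [_ fx x_gt0]]]] [u bu].
pose c := rank (SymPow g V) * loopcoef V i i.
(* [rank (SymPow g V)] is its own inverse, and [u] inverts the binomial. *)
pose c' := 'C(g, i)%:R *: (u * rank (SymPow g V)) : Endo (@tunit C).
have cK : c * c' = 1.
  have C0 : 'C(g, i)%:R != 0 :> rat by rewrite pnatr_eq0 -lt0n bin_gt0 mul2n -addnn leq_addr.
  rewrite /c /c' loopcoefE -double_i endoZr endoZr endoZl !scalerA mulfV // scale1r.
  by rewrite -mulrA (mulrA (ebinom _ _)) bu mul1r.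
have := lower_section (P := mulS V i i g) (q := comulS V i i g) (c :=
  c) _ _ _ fx x_gt0 cK n tunit.
case=> [T|T|T|t tK].
- exact: tmulS_comm double_i.
- exact: comulS_comm double_i T.
- exact: invertible_mul_comul double_i T inv rk.
have [l [lK Kl]] := lamS_iso V g.
have [s sE] := @str_full C (rtens (ratom (S n)) (ratom L)) (ratom (S n.+2)) (t ∘
  (S n ◁ o11 l tunit)).
exists s; apply: (@str_inj C (rtens (ratom _) (ratom _)) (rtens (ratom _) (ratom _))).
rewrite (@str_comp _ _ (ratom _)) sE -/(o12 _ _) tLaplace (str_id (rtens (ratom _) (ratom _))).
rewrite lcomp -[(S n ◁ o11 (lamS V g) tunit) ∘ _ ∘ _]compA -lowerE.
apply: mor_ext => Z z; rewrite -!compA comp1m.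
rewrite (compA (lower _ _ _)) tK comp1m compA -lcomp -o11_comp Kl o11_id ltens1 comp1m.
by [].
Qed.

Hypotheses (n : nat) (s : Mor (S n ⊗ L) (S n.+2)).
Hypothesis sK : Laplace V i n ∘ s = idm (S n ⊗ L).
Hypothesis half_rho_unit : exists u, ((2^-1 : rat) *: rho_sym V m g.-1) * u = 1.

Lemma Dirac_im1_section : exists t, Dirac_im1 V i n ∘ t = idm (S n ⊗ (dual V ⊗ L)).
Proof.
have [u hu] := half_rho_unit; move: hu => hu.
have H := Dirac_im1_Diracbar_1 inv rk n; move: (_ *: rho_sym _ _ _) hu H => h hu H.
exists (Diracbar_1 V i n.+1 ∘ ((s ⊠ idm (dual V)) ∘ (ascV (S n) L (dual V) ∘
  (escale u (S n ◁ swap (dual V) L))))).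
rewrite compA H -!compA.
rewrite (compA (Laplace V i n ⊠ _)) -rcomp sK tensm1 comp1m (compA (asc _ _ _)) ascVK comp1m.
by rewrite escale_tens escale_compl escale_compr -lcomp swapK ltens1 -escaleM hu escale1.
Qed.

Lemma invertible_Lobj : invertible L.
Proof.
have [f' [f'f ff']] := lamS_iso V g; have [Y [u [u' [u'u uu']]]] := inv.
exists Y, (u ∘ (f' ⊠ idm Y)), ((lamS V g ⊠ idm Y) ∘ u'); split.
  by rewrite -compA (compA u') u'u comp1m -rcomp ff' tensm1.
by rewrite -compA (compA (_ ⊠ _)) -rcomp f'f tensm1 comp1m.
Qed.

Lemma Diracbar_im1_section : exists t, Diracbar_im1 V i n ∘ t = idm (S n ⊗ V).
Proof.
have [u hu] := half_rho_unit.
have H := Diracbar_im1_Dirac1 inv rk n; move: (_ *: rho_sym _ _ _) hu H => h hu.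
move: (Diracbar_im1 V i n) (Dirac1 V i n.+1) => D D1 H.
(* The first identity and a section of the Laplace operator give a section of [D ⊠ idm L]. As L is
   invertible, it has the form [t ⊠ idm L], and L can be cancelled. *)
have [t tE] := invertible_full (ascV (S n.+1) (SymPow i.-1 (dual V)) L ∘ D1 ∘
  ((s ⊠ idm V) ∘ (ascV (S n) L V ∘ (escale u (S n ◁ swap V L) ∘ asc (S n) V L)))) invertible_Lobj.
exists t; apply: (tens_invertible_inj invertible_Lobj); rewrite rcomp -tE tensm1.
rewrite (compA (D ⊠ _)) (compA (D ⊠ _)) H escale_tens
  !(escale_compl, escale_compr) -escaleM ?hu 1?endoC ?hu.
rewrite escale1 -!compA.
rewrite (compA (Laplace V i n ⊠ _)) -rcomp sK tensm1 comp1m (compA (asc _ _ _)) ascVK comp1m.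
by rewrite (compA (S n ◁ _)) -lcomp swapK ltens1 comp1m ascK.
Qed.
End Sections.

Theorem theorem5p3 (C : rigidCat)
    (rank_invertible : forall X : C, invertible X -> rank X = 1 \/ rank X = -1)
    (V : C) (i : nat) (i_ge1 : (1 <= i)%N)
    (SymgV_invertible : invertible (SymPow (2 * i) V)) :
  let g := (2 * i)%N in
  let L := Lobj V i in
  let A := SymPow i V in
  let r := rank V in
  let b := ebinom (r + g%:R - 1) i in
  let half_rho := (2^-1 : rat) *: rho V i in
  [/\ (* r_L *)
      rank L = rank (SymPow g V) /\ (rank L = 1 \/ rank L = -1),
      (* (1) *)
      (forall n : nat,
        (Diracbar_im1 V i n ⊠ idm L)
          ∘ ascV (SymPow n.+1 A) (SymPow i.-1 (dual V)) L ∘ Dirac1 V i n.+1 =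
        ascV (SymPow n A) V L
          ∘ (escale half_rho (idm (SymPow n A)) ⊠ swap L V)
          ∘ asc (SymPow n A) L V ∘ (Laplace V i n ⊠ idm V)),
      (* (2) *)
      (rank L = 1 -> forall n : nat,
        escale b (Dirac_im1 V i n ∘ Diracbar_1 V i n.+1) =
          (escale (b * half_rho) (idm (SymPow n A)) ⊠ swap L (dual V))
          ∘ asc (SymPow n A) L (dual V) ∘ (Laplace V i n ⊠ idm (dual V)) /\
        (GRing.lreg b ->
          (escale b (Dirac_im1 V i n ∘ Diracbar_1 V i n.+1) =
            (escale (b * half_rho) (idm (SymPow n A)) ⊠ swap L (dual V))
            ∘ asc (SymPow n A) L (dual V) ∘ (Laplace V i n ⊠ idm (dual V))
          <->
          Dirac_im1 V i n ∘ Diracbar_1 V i n.+1 =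
            (escale half_rho (idm (SymPow n A)) ⊠ swap L (dual V))
            ∘ asc (SymPow n A) L (dual V)
            ∘ (Laplace V i n ⊠ idm (dual V))))) &
      (* (3) *)
      ((exists M : C, invertible M /\ isomorphic L (M ⊗ M)) ->
       epositive (rank A) -> symmetric_rank V g ->
       (forall n : nat,
         (exists s : Mor (SymPow n A ⊗ L) (SymPow n.+2 A),
            Laplace V i n ∘ s = idm (SymPow n A ⊗ L)) /\
         has_kernel (Laplace V i n)) /\
       (forall n : nat,
         (exists s : Mor (SymPow n A ⊗ V) (SymPow n.+1 A ⊗ SymPow i.-1 (dual V)),
            Diracbar_im1 V i n ∘ s = idm (SymPow n A ⊗ V)) /\
         has_kernel (Diracbar_im1 V i n)) /\
       (forall n : nat,
         (exists s : Mor (SymPow n A ⊗ (dual V ⊗ L)) (SymPow n.+1 A ⊗ SymPow i.-1 V),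
            Dirac_im1 V i n ∘ s = idm (SymPow n A ⊗ (dual V ⊗ L))) /\
         has_kernel (Dirac_im1 V i n)))].
Proof.
(* With i = m.+1 the truncated predecessor [i.-1] becomes m. *)
case: i i_ge1 SymgV_invertible => [//|m] _ inv g L A r b half_rho.
have rkL : rank L = rank (SymPow g V) by exact: rank_Lobj.
have rkpm := rank_invertible _ inv.
have rk : rank (SymPow g V) * rank (SymPow g V) = 1.
  by case: rkpm => ->; rewrite ?mulrNN mulr1.
have hrE : half_rho = (2^-1 : rat) *: rho_sym V m g.-1 by rewrite rho_symE.
split.
- by rewrite rkL.
- by move=> n; rewrite hrE; apply: Diracbar_im1_Dirac1.
- move=> _ n; have E := Dirac_im1_Diracbar_1 inv rk n; rewrite -hrE in E.
  have Eb : escale b (Dirac_im1 V m.+1 n ∘ Diracbar_1 V m.+1 n.+1) =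
      (escale (b * half_rho) (idm (SymPow n A)) ⊠ swap L (dual V))
      ∘ asc (SymPow n A) L (dual V) ∘ (Laplace V m.+1 n ⊠ idm (dual V)).
    by rewrite E !escale_tens escaleM !escale_compl.
  by split.
move=> _ A_pos [_ _ bin_iso].
have [b_iso b1_iso] : is_iso b /\ is_iso (ebinom (r + g%:R - 1) g.-1).
  split; first by case: (bin_iso m.+1) => //; rewrite /g mul2n -addnn leq_addr.
  by case: (bin_iso g.-1) => //; exact: leq_pred.
have bu : exists u, b * u = 1 by case: b_iso => u [_ bu]; exists u.
(* ρ^i is a non-zero rational multiple of [rank L] and two binomials; all three are units, the
   binomials by the symmetric rank at j = i and j = g - 1. *)
have hu : exists u, ((2^-1 : rat) *: rho_sym V m g.-1) * u = 1.
  have L_iso : is_iso (rank L) by exists (rank L); rewrite rkL; split; exact: rk.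
  have [u [_ uK]] := is_iso_comp (is_iso_comp L_iso b1_iso) b_iso.
  have {}uK : rank L * ebinom (r + g%:R - 1) g.-1 * b * u = 1 by exact: uK.
  rewrite -hrE /half_rho /rho scalerA; set a := _ * _.
  have a0 : a != 0.
    rewrite !mulf_neq0 ?invr_neq0 ?pnatr_eq0 -?lt0n ?bin_gt0 ?leq_pred //.
    by rewrite mul2n -addnn leq_addr.
  by exists (a^-1 *: u); rewrite endoZl endoZr scalerA mulfV // scale1r.
have lap n := Laplace_section inv rk n A_pos bu.
split; [|split] => n; have [s sK] := lap n.
- by split; [exists s | exact: has_kernel_section sK].
- have [t tK] := Diracbar_im1_section inv rk sK hu.
  by split; [exists t | exact: has_kernel_section tK].
have [t tK] := Dirac_im1_section inv rk sK hu.
by split; [exists t | exact: has_kernel_section tK].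
Qed.
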